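(* Let $(Z,F)$ be a regular symmetric bilinear space over $\overline{\mathbb Q}$ with $Z\subseteq\overline{\mathbb Q}^N$ of dimension $L$, $1\le L\le N$, $N\ge2$. Let $\sigma\in\mathcal{O}(Z,F)$. Then either $\sigma$ is the identity, or there exist an integer $1\le l\le 2L-1$ and reflections $\tau_1,\dots,\tau_l\in\mathcal{O}(Z,F)$ such that $$\sigma=\tau_1\circ\dots\circ\tau_l,$$ and for each $1\le i\le l$, $$\mathcal{H}(\tau_i)\leq\left\{\left(2N^2\,3^{\frac{L-1}{2}}\right)^{\frac{L^2}{2}}\mathcal{H}(F)^{\frac{L}{3}}\,H(Z)^{\frac{L}{2}}\,\mathcal{H}(\sigma)\right\}^{5^{L-1}}.$$
   Context: Bilinear spaces. $F(X,Y)=\sum_{i,j=1}^N f_{ij}X_iY_j$ is a symmetric bilinear form in $N$ variables with coefficients $f_{ij}=f_{ji}$ in a number field (contained in $\overline{\mathbb Q}$), and $F(X)=F(X,X)$. $(Z,F)$ is regular if for each $0\neq x\in Z$ there exists $y\in Z$ with $F(x,y)\neq0$. An isometry of a bilinear space $(Z,F)$ is a linear isomorphism $\sigma:Z\to Z$ with $F(\sigma(x),\sigma(y))=F(x,y)$ for all $x,y\in Z$; the group of isometries is $\mathcal{O}(Z,F)$. For $x\in Z$ with $F(x)\neq0$, the reflection $\tau_x\in\mathcal{O}(Z,F)$ is $\tau_x(y)=y-\frac{2F(x,y)}{F(x)}x$; a reflection is an isometry of this form. Heights. For a number field $K$ of degree $d$ with set of places $M(K)$, let $d_v=[K_v:\mathbb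 Q_v]$, let $\|\cdot\|_v$ be the absolute value on $K_v$ extending the usual archimedean absolute value on $\mathbb R$ or $\mathbb C$ if $v\mid\infty$, or the usual $p$-adic absolute value on $\mathbb Q_p$ if $v\mid p$, and let $|a|_v=\|a\|_v^{d_v/d}$. For $x\in K_v^n$ put $H_v(x)=\max_i|x_i|_v$ if $v\nmid\infty$ and $H_v(x)=\left(\sum_i\|x_i\|_v^2\right)^{d_v/2d}$ if $v\mid\infty$. For $x\in K^n$, $H(x)=\prod_{v\in M(K)}H_v(x)$; this does not depend on the number field $K$ containing the coordinates, so $H$ is defined on $\overline{\mathbb Q}^n$. $\mathcal{H}(A)$ for an $N\times N$ matrix $A$ is the height $H$ of $A$ viewed as a vector in $\overline{\mathbb Q}^{N^2}$, and $\mathcal{H}(F)=\mathcal{H}((f_{ij}))$. For a subspace $V\subseteq\overline{\mathbb Q}^N$ with basis $x_1,\dots,x_J$, $J\ge 1$, $H(V)=H(x_1\wedge\cdots\wedge x_J)$, the height of the vector of all $J\times J$ minors of the $N\times J$ matrix $(x_1\ \dots\ x_J)$; this is independent of the basis. Height of an isometry. Since $(Z,F)$ is regular, $\overline{\mathbb Q}^N=Z\perp Z'$ (orthogonal direct sum) with $Z'=\{x\in\overline{\mathbb Q}^N: F(x,z)=0\ \forall z\in Z\}$. An isometry of $(\overline{\mathbb Q}^N,F)$ is identified with its $N\times N$ matrix $A\in GL_N(\overline{\mathbb Q})$ and its height is $\mathcal{H}(A)$. Each $\sigma\in\mathcal{O}(Z,F)$ extends to an isometry $\hat\sigma\in\mathcal{O}(\overline{\mathbb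 Q}^N,F)$ by choosing some $\sigma'\in\mathcal{O}(Z',F)$ and letting $\hat\sigma$ act as $\sigma$ on $Z$ and as $\sigma'$ on $Z'$; choose such an extension $\hat\sigma$ with $\mathcal{H}(\hat\sigma)$ minimal and define $\mathcal{H}(\sigma)=\mathcal{H}(\hat\sigma)$ for this choice. *)

(* Defs.v *)
From HB Require Import structures.
From mathcomp Require Import all_boot all_order all_algebra all_field.
From mathcomp Require Import all_classical all_reals all_analysis.
Set Implicit Arguments.
Unset Strict Implicit.
Unset Printing Implicit Defensive.
Import Order.TTheory GRing.Theory Num.Theory.
Import numFieldNormedType.Exports.
Local Open Scope classical_set_scope.
Local Open Scope ring_scope.

(* The field \overline{Q} is the type algC; a number field is a
   [fieldExtType rat] together with an embedding into algC; real numbers are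
   those of an arbitrary R : realType. *)

Section Places.
Variables (R : realType) (K : fieldExtType rat).
Implicit Types v : K -> R.

Definition absolute_value v : Prop :=
  [/\ forall x, 0 <= v x,
      forall x, v x = 0 <-> x = 0,
      forall x y, v (x * y) = v x * v y
    & forall x y, v (x + y) <= v x + v y].

Definition padic_abs (p : nat) (q : rat) : R :=
  if q == 0 then 0
  else p%:R ^ ((logn p `|denq q|%N)%:Z - (logn p `|numq q|%N)%:Z).

Definition archimedean v : Prop := forall q : rat, v q%:A = `|ratr q|.

Definition over_prime (p : nat) v : Prop :=
  prime p /\ forall q : rat, v q%:A = padic_abs p q.

(* The set M(K).  Each place of K is represented by its unique absolute value
   that extends the usual archimedean or p-adic one of Q, that is, by ||.||_v *)
Definition places : set (K -> R) :=
  [set v | absolute_value v /\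
           (archimedean v \/ exists p : nat, over_prime p v)].

Definition cauchy_for v (u : nat -> K) : Prop :=
  forall e : R, 0 < e ->
    exists M : nat, forall m n : nat, (M <= m)%N -> (M <= n)%N ->
      v (u m - u n) < e.

Definition null_for v (u : nat -> K) : Prop :=
  (fun n => v (u n)) @ \oo --> (0 : R).

Definition rat_seq (c : nat -> rat) : nat -> K := fun m => (c m)%:A.

(* The completion K_v consists of the Cauchy sequences of K modulo the null
   sequences, and Q_v is the image in it of the Cauchy sequences of rationals.
   With this encoding, b is a basis of K_v over Q_v: it generates, and it is
   linearly independent. *)
Definition completion_basis v (n : nat) (b : 'I_n -> nat -> K) : Prop :=
  [/\ forall i, cauchy_for v (b i),
      forall u, cauchy_for v u ->
        exists c : 'I_n -> nat -> rat,
          (forall i, cauchy_for v (rat_seq (c i))) /\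
          null_for v (fun m => u m - \sum_i c i m *: b i m)
    & forall c : 'I_n -> nat -> rat,
        (forall i, cauchy_for v (rat_seq (c i))) ->
        null_for v (fun m => \sum_i c i m *: b i m) ->
        forall i, null_for v (rat_seq (c i))].

(* d_v = [K_v : Q_v] *)
Definition local_degree v : nat :=
  xget 0%N [set n | exists b : 'I_n -> nat -> K, completion_basis v b].

Definition degree : nat := \dim {:K}.

Definition local_height (I : finType) v (x : I -> K) : R :=
  if `[< archimedean v >]
  then (\sum_i v (x i) ^+ 2) `^ ((local_degree v)%:R / (2 * degree%:R))
  else \big[Num.max/0]_i (v (x i) `^ ((local_degree v)%:R / degree%:R)).

(* For x != 0 all but finitely many factors are equal to 1, and the finitely
   supported product below is the product over all places.  The height of the
   zero vector carries no information. *)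
Definition field_height (I : finType) (x : I -> K) : R :=
  \big[*%R/1]_(v \in places) local_height v x.

End Places.

(* The height of a vector over \overline{Q}, computed in the number field that
   is generated by its coordinates. *)
Definition height (R : realType) (I : finType) (x : I -> algC) : R :=
  let: existT K (existT _ (exist2 s _ _)) := num_field_exists (codom x) in
  @field_height R K I (fun i => s`_(enum_rank i)).

Definition mx_height (R : realType) (m n : nat) (A : 'M[algC]_(m, n)) : R :=
  height R (fun ij : 'I_m * 'I_n => A ij.1 ij.2).

Section Subspaces.
Variable N : nat.
Implicit Types Z : {vspace 'cV[algC]_N}.

Definition basis_mx Z : 'M[algC]_(N, \dim Z) :=
  \matrix_(i, j) (vbasis Z)`_j i 0.

(* Row selections of the J x J minors; only increasing ones are allowed, so
   that each minor occurs once. *)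
Definition row_choice (J : nat) :=
  {f : {ffun 'I_J -> 'I_N} |
    [forall i : 'I_J, forall j : 'I_J, (i < j)%N ==> (f i < f j)%N]}.

Definition subspace_height (R : realType) Z : R :=
  height R (fun f : row_choice (\dim Z) => \det (rowsub (val f) (basis_mx Z))).

End Subspaces.

Section BilinearSpaces.
Variables (N : nat) (F : 'M[algC]_N).
Implicit Types Z : {vspace 'cV[algC]_N}.

Definition bilin (x y : 'cV[algC]_N) : algC :=
  \sum_i \sum_j F i j * x i 0 * y j 0.

Definition bilin_regular Z : Prop :=
  forall x, x \in Z -> x != 0 -> exists2 y, y \in Z & bilin x y != 0.

Definition bilin_isometry Z (s : 'End(subvs_of Z)) : Prop :=
  bijective s /\
  forall x y, bilin (vsval (s x)) (vsval (s y)) = bilin (vsval x) (vsval y).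

Definition bilin_reflection Z (t : 'End(subvs_of Z)) : Prop :=
  bilin_isometry t /\
  exists2 x : subvs_of Z, bilin (vsval x) (vsval x) != 0 &
    forall y, t y = y - (2 * bilin (vsval x) (vsval y) /
                         bilin (vsval x) (vsval x)) *: x.

(* The subspace Z' of all x with F(x, z) = 0 for z in Z, see mem_orthc *)
Definition orthc Z : {vspace 'cV[algC]_N} :=
  lker (linfun (mulmx ((basis_mx Z)^T *m F^T))).

Lemma bilinE x y : bilin x y = (x^T *m F *m y) 0 0.
Proof.
rewrite /bilin !mxE exchange_big; apply: eq_bigr => j _ /=.
rewrite !mxE mulr_suml; apply: eq_bigr => i _.
by rewrite !mxE (mulrC (F i j)).
Qed.

Lemma mem_orthc Z x :
  reflect (forall z, z \in Z -> bilin x z = 0) (x \in orthc Z).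
Proof.
have bE z : bilin x z = (z^T *m (F^T *m x)) 0 0.
  have <- : (x^T *m F *m z)^T = z^T *m (F^T *m x) by rewrite !trmx_mul trmxK.
  by rewrite bilinE [RHS]mxE.
have rowE (j : 'I_(\dim Z)) :
    ((basis_mx Z)^T *m F^T *m x) j 0 = bilin x (vbasis Z)`_j.
  rewrite bE -mulmxA !mxE; apply: eq_bigr => i _; by rewrite !mxE.
rewrite memv_ker lfunE /=; apply: (iffP eqP) => [x0 z zZ | xZ].
  rewrite (coord_vbasis zZ) bE linear_sum /= mulmx_suml summxE big1 // => j _.
  by rewrite linearZ /= -scalemxAl mxE -bE -rowE x0 mxE mulr0.
apply/matrixP => j k; rewrite ord1 rowE xZ ?mxE //.
by apply: vbasis_mem; rewrite mem_nth ?size_tuple.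
Qed.

(* The matrices A of the isometries of (\overline{Q}^N, F) that act as s on Z
   and as some isometry s' of (Z', F) on Z' *)
Definition isometry_extensions Z (s : 'End(subvs_of Z)) : set 'M[algC]_N :=
  [set A | [/\ A \in unitmx,
               forall x y, bilin (A *m x) (A *m y) = bilin x y,
               forall z : subvs_of Z, A *m vsval z = vsval (s z)
             & exists2 s' : 'End(subvs_of (orthc Z)), bilin_isometry s' &
                 forall z : subvs_of (orthc Z), A *m vsval z = vsval (s' z)]].

(* The least height of an extension, taken as an infimum: it is equal to the
   minimum whenever the latter is attained. *)
Definition isometry_height (R : realType) Z (s : 'End(subvs_of Z)) : R :=
  inf [set mx_height R A | A in isometry_extensions s].

End BilinearSpaces.

(* Main.v *)
(* Fix one absolute value of algC over each place of Q.  Every place of a number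
   field K is obtained from it along embeddings of K, and the local degree is
   proportional to the number of embeddings into a Galois closure that yield
   this place.  Hence a height is a product over all embeddings, whatever the
   field, and a multiplicative inequality between local norms that holds for all
   the absolute values of algC, with a constant factor at the archimedean ones,
   gives the same inequality between heights.

   The reflections are found by induction on dim Z.  Let A extend sigma and let
   the columns of X form a basis of Z.  Among these columns and the sums of two
   of them there is an anisotropic vector x, and A x - x or A x + x is
   anisotropic.  Thus at most two reflections turn A into an isometry that fixes
   x, and the other columns, projected orthogonally to x, are a basis in the next
   step.  All heights grow polynomially at each step.  By Cramer's rule the first
   basis can be chosen with H(X) <= N H(Z).  If dim Z = 1, sigma is the reflection
   itself; otherwise an extension with H(A) <= 2 H(sigma) is good enough. *)

(* The height of a vector is computed in the field generated by its coordinates, so heights of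
   different vectors cannot be compared place by place. A common Galois field [E] removes this
   obstacle once the exponent [d_v / d] is known to be the proportion of automorphisms of [E] that
   induce [v]. As [d_v] is defined by Cauchy sequences, this takes a density argument: an element
   fixed by the decomposition group is a limit of rationals. Extending the automorphisms of [E] to
   algC then turns every factor into a norm over algC itself.

   The exponents of the statement constrain the induction. The height of a reflection of Z is the
   least height of its extensions, and the reflection matrix of its vector need not be the cheapest
   one. On the last remaining line, the isometry reached so far is itself an extension, of height
   [s]. The reflection matrix would cost [f h^2] instead, which for [L = 2] leads to [h^6], while
   the statement allows [H(Z)^5]. Hence every reflection carries its own extension, which must also
   fix the vectors already split off. *)
Require Import Defs.
From HB Require Import structures.
From mathcomp Require Import all_boot all_order all_fingroup all_algebra all_field.
From mathcomp Require Import all_classical all_reals all_analysis.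
From mathcomp Require Import ring lra zify.
Set Implicit Arguments.
Unset Strict Implicit.
Unset Printing Implicit Defensive.
Import Order.TTheory GRing.Theory Num.Theory.
Import numFieldNormedType.Exports.
Local Open Scope ring_scope.

(** * Absolute values and weak approximation *)

Section AbsoluteValues.
Variable R : realType.

Definition absval (F : fieldType) (v : F -> R) : Prop :=
  [/\ forall x, 0 <= v x,
      forall x, v x = 0 <-> x = 0,
      forall x y, v (x * y) = v x * v y
    & forall x y, v (x + y) <= v x + v y].

Lemma pow_unbounded (r b : R) :
  1 < r -> exists N, forall n, (N <= n)%N -> b < r ^+ n.
Proof.
move=> r1; exists (Num.truncn (b / (r - 1))).+1 => n Nn.
have r0 : 0 < r - 1 by rewrite subr_gt0.
(* Bernoulli's inequality, proved below by induction on [n]. *)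
apply: (@lt_le_trans _ _ (1 + (r - 1) *+ n)).
  rewrite -mulr_natr -[ltLHS](divfK (lt0r_neq0 r0)) [ltLHS]mulrC.
  apply: (@lt_le_trans _ _ ((r - 1) * n%:R)); last by rewrite lerDr ler01.
  rewrite ltr_pM2l //; have := truncnS_gt (b / (r - 1)).
  by move/lt_le_trans; apply; rewrite ler_nat.
elim: n {Nn} => [|n IHn]; first by rewrite mulr0n addr0 expr0.
rewrite exprS; apply: (@le_trans _ _ (r * (1 + (r - 1) *+ n))).
  rewrite mulrS -mulr_natr.
  suff : 0 <= (r - 1) * ((r - 1) * n%:R) by nra.
  by rewrite !mulr_ge0 ?ler0n // ltW.
by rewrite ler_pM2l // (lt_trans _ r1).
Qed.

Lemma pow_small (r e : R) : 0 <= r -> r < 1 -> 0 < e ->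
  exists N, forall n, (N <= n)%N -> r ^+ n < e.
Proof.
rewrite le_eqVlt => /predU1P[<- _ e0|r0 r1 e0].
  by exists 1%N => -[//|n] _; rewrite expr0n.
have [|N HN] := @pow_unbounded r^-1 e^-1; first by rewrite invf_gt1.
exists N => n /HN; rewrite exprVn ltf_pV2 // posrE // exprn_gt0 //.
Qed.

Lemma eventually_all (I : eqType) (s : seq I) (Q : I -> nat -> Prop) :
  (forall i, i \in s -> exists N, forall n, (N <= n)%N -> Q i n) ->
  exists N, forall n, (N <= n)%N -> forall i, i \in s -> Q i n.
Proof.
elim: s => [|a s IH] H; first by exists 0%N.
have [N1 HN1] := H a (mem_head _ _).
have [|N2 HN2] := IH; first by move=> i si; apply: H; rewrite inE si orbT.
exists (maxn N1 N2) => n; rewrite geq_max => /andP[n1 n2] i.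
by rewrite inE => /predU1P[->|/HN2]; [exact: HN1 | exact].
Qed.

Section Basic.
Variables (F : fieldType) (v : F -> R).
Hypothesis av : absval v.

Lemma absv_ge0 x : 0 <= v x. Proof. by case: av. Qed.
Lemma absvM x y : v (x * y) = v x * v y. Proof. by case: av. Qed.
Lemma absvD x y : v (x + y) <= v x + v y. Proof. by case: av. Qed.
Lemma absv0 : v 0 = 0. Proof. by case: av => _ H _ _; apply/H. Qed.

Lemma absv_eq0 x : (v x == 0) = (x == 0).
Proof. by case: av => _ H _ _; apply/eqP/eqP => /H. Qed.

Lemma absv_gt0 x : (0 < v x) = (x != 0).
Proof. by rewrite lt_def absv_ge0 andbT absv_eq0. Qed.

Lemma absv1 : v 1 = 1.
Proof.
have n0 : v 1 != 0 by rewrite absv_eq0 oner_eq0.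
by apply: (mulfI n0); rewrite -absvM !mulr1.
Qed.

Lemma absvN x : v (- x) = v x.
Proof.
suff v1 : v (- 1) = 1 by rewrite -mulN1r absvM v1 mul1r.
have : v (- 1) ^+ 2 = 1 by rewrite expr2 -absvM mulrNN mulr1 absv1.
move/eqP; rewrite sqrf_eq1 => /predU1P[//|/eqP E].
by have := absv_ge0 (- 1); rewrite E; lra.
Qed.

Lemma absvB x y : v (x - y) <= v x + v y.
Proof. by rewrite -(absvN y) absvD. Qed.

Lemma absvV x : v x^-1 = (v x)^-1.
Proof.
have [->|x0] := eqVneq x 0; first by rewrite invr0 absv0 invr0.
have vx0 : v x != 0 by rewrite absv_eq0.
by apply: (mulfI vx0); rewrite -absvM !divff // absv1.
Qed.

Lemma absvX x n : v (x ^+ n) = v x ^+ n.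
Proof. by elim: n => [|n IH]; rewrite ?expr0 ?absv1 // !exprS absvM IH. Qed.

Lemma absv_sum (I : Type) (s : seq I) (P : pred I) (f : I -> F) :
  v (\sum_(i <- s | P i) f i) <= \sum_(i <- s | P i) v (f i).
Proof.
apply: (big_ind2 (fun a b => v a <= b)); rewrite ?absv0 // => a b c d ab cd.
by apply: le_trans (absvD _ _) _; exact: lerD.
Qed.

Lemma absv_prod (I : Type) (s : seq I) (P : pred I) (f : I -> F) :
  v (\prod_(i <- s | P i) f i) = \prod_(i <- s | P i) v (f i).
Proof. by rewrite (big_morph v absvM absv1). Qed.

Lemma absv1D_ge x : 1 - v x <= v (1 + x).
Proof. by have := absvB (1 + x) x; rewrite addrK absv1; lra. Qed.

(* z^n / (1 + z^n) tends to 1 where z is large and to 0 where z is small *)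
Definition squash (z : F) n := z ^+ n / (1 + z ^+ n).

Lemma squash_large z n : 1 < v z -> (0 < n)%N ->
  squash z n = (1 + z^-1 ^+ n)^-1 /\ v (1 + z^-1 ^+ n) > 0.
Proof.
move=> z1 n0.
have z0 : z != 0 by rewrite -absv_gt0 (lt_trans _ z1).
have h : v (1 + z^-1 ^+ n) > 0.
  apply: lt_le_trans (absv1D_ge _); rewrite subr_gt0 absvX absvV.
  have zi : (v z)^-1 < 1 by rewrite invf_lt1 // (lt_trans _ z1).
  by rewrite exprn_ilt1 ?invr_ge0 ?absv_ge0 // -lt0n.
split=> //; move: h; rewrite absv_gt0 => h; rewrite /squash.
have zn : z ^+ n != 0 by rewrite expf_neq0.
have -> : 1 + z ^+ n = z ^+ n * (1 + z^-1 ^+ n).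
  by rewrite exprVn mulrDr mulr1 divff // addrC.
by rewrite invfM mulrA divff // mul1r.
Qed.

Lemma squash_to1 z (e : R) : 1 < v z -> 0 < e ->
  exists N, forall n, (N <= n)%N -> v (squash z n - 1) < e.
Proof.
move=> z1 e0.
have [|||N HN] := @pow_small (v z)^-1 (Num.min 1 e / 2); rewrite ?invr_ge0 ?absv_ge0 //.
- by rewrite invf_lt1 // (lt_trans _ z1).
- by rewrite divr_gt0 // lt_min ltr01.
exists N.+1 => n nN; have n0 : (0 < n)%N by exact: leq_trans nN.
have [-> h] := squash_large z1 n0; have h' := h; rewrite absv_gt0 in h'.
have -> : (1 + z^-1 ^+ n)^-1 - 1 = - z^-1 ^+ n / (1 + z^-1 ^+ n) by field.
rewrite absvM absvN absvV ltr_pdivrMr //.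
have := HN n (ltnW nN); rewrite ltr_pdivlMr // lt_min => /andP[a b].
have := absv1D_ge (z^-1 ^+ n); move: a b; rewrite absvX absvV.
set t := _ ^+ n; set u := v _; move=> a b c.
have t0 : 0 <= t by rewrite /t exprn_ge0 // invr_ge0 absv_ge0.
by nra.
Qed.

Lemma squash_to0 z (e : R) : v z < 1 -> 0 < e ->
  exists N, forall n, (N <= n)%N -> v (squash z n) < e.
Proof.
move=> z1 e0.
have [|||N HN] := @pow_small (v z) (Num.min 1 e / 2); rewrite ?absv_ge0 //.
  by rewrite divr_gt0 // lt_min ltr01.
exists N => n /HN; rewrite ltr_pdivlMr // lt_min => /andP[a b].
have := absv1D_ge (z ^+ n); rewrite absvM absvV absvX.
set t := _ ^+ n; set u := v _; move: a b; rewrite -/t => a b c.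
have t0 : 0 <= t by rewrite /t exprn_ge0 // absv_ge0.
have u0 : 0 < u by lra.
by rewrite ltr_pdivrMr //; nra.
Qed.

End Basic.

Section Approximation.
Variable F : fieldType.
Implicit Types v w : F -> R.

Lemma absval_neq v w : v <> w -> exists x, v x != w x.
Proof.
move=> vw; apply: contrapT => H; apply: vw; apply/funext => x.
by apply/eqP/negPn/negP => h; apply: H; exists x.
Qed.

(* Since v and w agree at c, a power of x can be rescaled by a power of c so
   that 1 lies between its two values. *)
Lemma absval_separate2 v w c : absval v -> absval w -> v c = w c -> 1 < v c ->
  v <> w -> exists z, 1 < v z /\ w z < 1.
Proof.
move=> av aw vwc c1 vw.
have c0 : c != 0 by rewrite -(absv_gt0 av) (lt_trans _ c1).
have [x0 x00 xlt0] : exists2 x, x != 0 & w x < v x.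
  have [x vwx] := absval_neq vw.
  have x0 : x != 0.
    by apply: contraNneq vwx => ->; rewrite !absv0.
  have [lt|gt|E] := ltgtP (w x) (v x); first by exists x.
    exists x^-1; rewrite ?invr_eq0 // !absvV // ltf_pV2 // posrE absv_gt0 //.
  by rewrite E eqxx in vwx.
have [x [x0' xlt x1]] : exists x, [/\ x != 0, w x < v x & 1 <= w x].
  have [N /(_ N (leqnn _)) HN] := @pow_unbounded (v c) (w x0)^-1 c1.
  exists (x0 * c ^+ N).
  rewrite (absvM av) (absvM aw) (absvX av) (absvX aw) -vwc; split.
  - by rewrite mulf_neq0 // expf_neq0.
  - by rewrite ltr_pM2r // exprn_gt0 // (lt_trans _ c1).
  - by rewrite mulrC -ler_pdivrMr ?absv_gt0 // mul1r ltW.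
have wx0 : 0 < w x by rewrite absv_gt0.
have [|n /(_ n (leqnn _)) Hn] := @pow_unbounded (v x / w x) (v c).
  by rewrite ltr_pdivlMr // mul1r.
have [m0 Hm0] := @pow_unbounded (v c) (w x ^+ n) c1.
have exm : exists m, w x ^+ n < v c ^+ m by exists m0; exact: Hm0.
(* Minimality gives [v c ^+ m <= w x ^+ n < v c ^+ m.+1], and [v x ^+ n] exceeds [v c * w x ^+ n],
   so [x ^+ n / c ^+ m.+1] separates. *)
case: (ex_minnP exm) => -[|m] Hm mmin.
  by move: Hm; rewrite expr0 ltNge exprn_ege1.
have cm : v c ^+ m <= w x ^+ n.
  by rewrite leNgt; apply/negP => /mmin; rewrite ltnn.
have cp k : 0 < v c ^+ k by rewrite exprn_gt0 // (lt_trans _ c1).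
exists (x ^+ n / c ^+ m.+1); rewrite (absvM av) (absvM aw).
rewrite (absvV av) (absvV aw) !(absvX av) !(absvX aw) -vwc.
rewrite ltr_pdivlMr // mul1r ltr_pdivrMr // mul1r; split=> //.
rewrite exprS; apply: (@le_lt_trans _ _ (v c * w x ^+ n)).
  by rewrite ler_pM2l // (lt_trans _ c1).
by move: Hn; rewrite expr_div_n ltr_pdivlMr // exprn_gt0.
Qed.

(** The common value at [c], larger than 1, prevents distinct absolute values from being powers of
    each other. In the induction, [z] settles the tail and [u] separates [v] from the new [vs i]. If
    [vs i z <= 1], a large power of [z] times [u] works. Otherwise such a power may be large at [i],
    and [squash z n], which tends to 1 at [v] and at [i] and to 0 on the tail, takes its place. *)
Lemma absval_separate (I : eqType) (s : seq I) (vs : I -> F -> R) v c :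
  absval v -> 1 < v c ->
  (forall i, i \in s -> [/\ absval (vs i), vs i c = v c & v <> vs i]) ->
  exists z, 1 < v z /\ forall i, i \in s -> vs i z < 1.
Proof.
move=> av c1; elim: s => [|i s IH] H; first by exists c.
have [|z [vz sz]] := IH; first by move=> j js; apply: H; rewrite inE js orbT.
have [ai ci vi] := H i (mem_head _ _).
have [u [vu iu]] := absval_separate2 av ai (esym ci) c1 vi.
have as_ j : j \in s -> absval (vs j) by move=> js; case: (H j); rewrite ?inE ?js ?orbT.
have small j : j \in s -> exists N, forall n, (N <= n)%N ->
    vs j (z ^+ n * u) < 1.
  move=> js; have aj := as_ j js.
  have [|N HN] := @pow_small (vs j z) (vs j u + 1)^-1 (absv_ge0 aj _) (sz j js).
    by rewrite invr_gt0 ltr_wpDl ?absv_ge0.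
  exists N => n /HN; rewrite absvM // absvX //.
  have u0 := absv_ge0 aj u; have z0 : 0 <= vs j z ^+ n by rewrite exprn_ge0 ?absv_ge0.
  by rewrite -[ltRHS]mul1r ltr_pdivlMr ?ltr_wpDl //; nra.
have [iz|iz] := lerP (vs i z) 1.
  have [N HN] := eventually_all small.
  exists (z ^+ N * u); split.
    rewrite absvM // absvX //; have := exprn_ege1 N (ltW vz).
    by move: vu; nra.
  move=> j; rewrite inE => /predU1P[->|js]; last exact: HN.
  rewrite absvM // absvX //; apply: le_lt_trans iu.
  by rewrite ler_piMl ?absv_ge0 // exprn_ile1 // absv_ge0.
have [N1 HN1] : exists N, forall n, (N <= n)%N -> 1 < v (squash z n * u).
  have [|N HN] := @squash_to1 _ _ av z (1 - (v u)^-1) vz.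
    by rewrite subr_gt0 invf_lt1 // (lt_trans _ vu).
  exists N => n /HN h; rewrite absvM //.
  have u0 : 0 < v u by rewrite (lt_trans _ vu).
  rewrite -ltr_pdivrMr // mul1r.
  have := absvD av (squash z n) (1 - squash z n).
  by rewrite subrKC absv1 // -(absvN av (1 - _)) opprB; lra.
have [N2 HN2] : exists N, forall n, (N <= n)%N -> vs i (squash z n * u) < 1.
  have [u00|u0] := eqVneq (vs i u) 0.
    by exists 0%N => n _; rewrite absvM // u00 mulr0.
  have {}u0 : 0 < vs i u by rewrite lt_def u0 absv_ge0.
  have [|N HN] := @squash_to1 _ _ ai z ((vs i u)^-1 - 1) iz.
    by rewrite subr_gt0 invf_gt1.
  exists N => n /HN h; rewrite absvM // -ltr_pdivlMr // mul1r.
  have := absvD ai 1 (squash z n - 1).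
  by rewrite subrKC absv1 //; lra.
have [N3 HN3] : exists N, forall n, (N <= n)%N ->
    forall j, j \in s -> vs j (squash z n * u) < 1.
  apply: eventually_all => j js; have aj := as_ j js.
  have [|N HN] := @squash_to0 _ _ aj z (vs j u + 1)^-1 (sz j js).
    by rewrite invr_gt0 ltr_wpDl ?absv_ge0.
  exists N => n /HN; rewrite absvM //.
  have u0 := absv_ge0 aj u; have z0 := absv_ge0 aj (squash z n).
  by rewrite -[ltRHS]mul1r ltr_pdivlMr ?ltr_wpDl //; nra.
pose n := maxn N1 (maxn N2 N3).
exists (squash z n * u); split; first by apply: HN1; rewrite leq_maxl.
move=> j; rewrite inE => /predU1P[->|js].
  by apply: HN2; rewrite /n maxnCA leq_maxl.
by apply: HN3 => //; rewrite /n maxnA leq_maxr.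
Qed.

Lemma absval_approx (I : eqType) (s : seq I) (vs : I -> F -> R) v c (e : R) :
  absval v -> 1 < v c -> 0 < e ->
  (forall i, i \in s -> [/\ absval (vs i), vs i c = v c & v <> vs i]) ->
  exists z, v (z - 1) < e /\ forall i, i \in s -> vs i z < e.
Proof.
move=> av c1 e0 H; have [z [vz sz]] := absval_separate av c1 H.
have [N1 HN1] := squash_to1 av vz e0.
have [N2 HN2] : exists N, forall n, (N <= n)%N ->
    forall j, j \in s -> vs j (squash z n) < e.
  apply: (@eventually_all _ s (fun j n => vs j (squash z n) < e)) => j js.
  have [aj _ _] := H j js.
  by have [N HN] := squash_to0 aj (sz j js) e0; exists N => n /HN.
exists (squash z (maxn N1 N2)); split; first by apply: HN1; rewrite leq_maxl.
by move=> j; apply: HN2; rewrite leq_maxr.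
Qed.

End Approximation.
End AbsoluteValues.

(** * Local degrees *)

Section CauchySequences.
Variables (R : realType) (F : fieldType) (v : F -> R).
Hypothesis av : absval v.
Implicit Types u w : nat -> F.

(** Stated for any field, because coordinates with respect to a basis of the completion are
    sequences of rationals. *)
Definition cauchy u := forall e : R, 0 < e ->
  exists M : nat, forall m n : nat, (M <= m)%N -> (M <= n)%N -> v (u m - u n) < e.

Definition null u := forall e : R, 0 < e ->
  exists M : nat, forall n : nat, (M <= n)%N -> v (u n) < e.

Lemma cauchy_cst x : cauchy (fun=> x).
Proof. by move=> e e0; exists 0%N => m n _ _; rewrite subrr absv0. Qed.

Lemma null0 : null (fun=> 0).
Proof. by move=> e e0; exists 0%N => n _; rewrite absv0. Qed.

Lemma eq_null u w : u =1 w -> null u -> null w.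
Proof. by move=> /funext ->. Qed.

Lemma eq_cauchy u w : u =1 w -> cauchy u -> cauchy w.
Proof. by move=> /funext ->. Qed.

Lemma nullD u w : null u -> null w -> null (fun n => u n + w n).
Proof.
move=> nu nw e e0; have e2 : 0 < e / 2 by rewrite divr_gt0.
have [M HM] := nu _ e2; have [N HN] := nw _ e2.
exists (maxn M N) => n; rewrite geq_max => /andP[/HM h1 /HN h2].
by apply: le_lt_trans (absvD av _ _) _; lra.
Qed.

Lemma cauchyD u w : cauchy u -> cauchy w -> cauchy (fun n => u n + w n).
Proof.
move=> nu nw e e0; have e2 : 0 < e / 2 by rewrite divr_gt0.
have [M HM] := nu _ e2; have [N HN] := nw _ e2.
exists (maxn M N) => m n; rewrite !geq_max => /andP[m1 m2] /andP[n1 n2].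
have h1 := HM _ _ m1 n1; have h2 := HN _ _ m2 n2.
by rewrite opprD addrACA; apply: le_lt_trans (absvD av _ _) _; lra.
Qed.

Lemma cauchyN u : cauchy u -> cauchy (fun n => - u n).
Proof.
move=> nu e /nu[M HM]; exists M => m n mM nM.
by rewrite -opprD absvN // HM.
Qed.

Lemma cauchy_bounded u : cauchy u -> exists2 B : R, 0 < B & forall n, v (u n) < B.
Proof.
move=> /(_ 1 ltr01)[M HM].
exists (1 + v (u M) + \sum_(i < M) v (u i)).
  by rewrite -addrA ltr_wpDr // addr_ge0 ?absv_ge0 // sumr_ge0 // => i _; rewrite absv_ge0.
move=> n; have [nM|Mn] := ltnP n M.
  rewrite (bigD1 (Ordinal nM)) //=.
  have := absv_ge0 av (u M); set S := bigop _ _ _.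
  have : 0 <= S by rewrite sumr_ge0 // => i _; rewrite absv_ge0.
  by lra.
have := HM n M Mn (leqnn _); have := absvD av (u n - u M) (u M); rewrite subrK.
set S := bigop _ _ _; have : 0 <= S by rewrite sumr_ge0 // => i _; rewrite absv_ge0.
by lra.
Qed.

Lemma nullM u w : cauchy u -> null w -> null (fun n => u n * w n).
Proof.
move=> /cauchy_bounded[B B0 HB] nw e e0.
have [|M HM] := nw (e / B); first by rewrite divr_gt0.
exists M => n /HM; rewrite ltr_pdivlMr // => h; rewrite (absvM av).
by have := HB n; have := absv_ge0 av (w n); have := absv_ge0 av (u n); nra.
Qed.

Lemma cauchyM u w : cauchy u -> cauchy w -> cauchy (fun n => u n * w n).
Proof.
move=> cu cw e e0.
have [B B0 HB] := cauchy_bounded cu; have [C C0 HC] := cauchy_bounded cw.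
have [|M HM] := cu (e / 2 / C); first by rewrite !divr_gt0.
have [|N HN] := cw (e / 2 / B); first by rewrite !divr_gt0.
exists (maxn M N) => m n; rewrite !geq_max => /andP[m1 m2] /andP[n1 n2].
have := HM _ _ m1 n1; have := HN _ _ m2 n2; rewrite !ltr_pdivlMr // => h1 h2.
have -> : u m * w m - u n * w n = u m * (w m - w n) + w n * (u m - u n) by ring.
apply: le_lt_trans (absvD av _ _) _; rewrite !(absvM av).
have k1 := ler_wpM2r (absv_ge0 av (w m - w n)) (ltW (HB m)).
have k2 := ler_wpM2r (absv_ge0 av (u m - u n)) (ltW (HC n)).
by lra.
Qed.

Lemma null_sum n (u : 'I_n -> nat -> F) :
  (forall i, null (u i)) -> null (fun m => \sum_i u i m).
Proof.
elim: n u => [|n IH] u H.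
  by apply: eq_null null0 => m; rewrite big_ord0.
apply: (@eq_null (fun m => u ord0 m + \sum_(i < n) u (lift ord0 i) m)).
  by move=> m; rewrite big_ord_recl.
by apply: nullD (H _) _; apply: IH => i; exact: H.
Qed.

Lemma cauchy_sum n (u : 'I_n -> nat -> F) :
  (forall i, cauchy (u i)) -> cauchy (fun m => \sum_i u i m).
Proof.
elim: n u => [|n IH] u H.
  by apply: eq_cauchy (cauchy_cst 0) => m; rewrite big_ord0.
apply: (@eq_cauchy (fun m => u ord0 m + \sum_(i < n) u (lift ord0 i) m)).
  by move=> m; rewrite big_ord_recl.
by apply: cauchyD (H _) _; apply: IH => i; exact: H.
Qed.

(** A Cauchy sequence that is not null stays away from 0: its value is at least [e] at arbitrarily
    late indices, and eventually it moves by less than [e / 2]. *)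
Lemma null_cancel u w : cauchy u -> ~ null u ->
  null (fun n => u n * w n) -> null w.
Proof.
move=> cu nu nuw.
have [e e0 He] : exists2 e : R, 0 < e & forall M, exists2 n, (M <= n)%N & e <= v (u n).
  apply: contrapT => H; apply: nu => e e0; apply: contrapT => H'; apply: H.
  exists e => // M; apply: contrapT => H2; apply: H'; exists M => n nM.
  by rewrite ltNge; apply/negP => h; apply: H2; exists n.
have e2 : 0 < e / 2 by rewrite divr_gt0.
have [M HM] := cu _ e2; have [n0 n0M en0] := He M.
move=> d d0; have [|N HN] := nuw (e / 2 * d); first by rewrite mulr_gt0.
exists (maxn M N) => n; rewrite geq_max => /andP[/(HM _ _ n0M) h1 /HN].
have := absvD av (u n0 - u n) (u n); rewrite subrK (absvM av) => h2 h3.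
have h4 : e / 2 < v (u n) by lra.
rewrite -(ltr_pM2l e2); apply: le_lt_trans h3.
by rewrite ler_wpM2r ?absv_ge0 // ltW.
Qed.

(* Gaussian elimination over the ring of Cauchy sequences modulo its maximal
   ideal of null sequences *)
Lemma cauchy_kernel n (C : 'I_n.+1 -> 'I_n -> nat -> F) :
  (forall j i, cauchy (C j i)) ->
  exists a : 'I_n.+1 -> nat -> F,
    [/\ forall j, cauchy (a j), exists j, ~ null (a j) &
        forall i, null (fun m => \sum_j a j m * C j i m)].
Proof.
elim: n C => [|n IH] C cC.
  exists (fun _ _ => 1); split=> [_||[]//]; first exact: cauchy_cst.
  exists ord0 => /(_ 1 ltr01)[M /(_ M (leqnn _))].
  by rewrite absv1 // ltxx.
(* If the first column is null, it is dropped together with one row, whose coefficient is 0.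
   Otherwise some entry of it serves as the pivot. *)
have [H|/existsNP[j0 nj0]] := pselect (forall j, null (C j ord0)).
  have [a [ca [j nj] Ha]] := IH (fun j i => C (lift ord0 j) (lift ord0 i))
    (fun j i => cC _ _).
  pose b j := if unlift ord0 j is Some j' then a j' else fun=> 0.
  have bS k m : \sum_j b j m * C j k m = \sum_j a j m * C (lift ord0 j) k m.
    rewrite big_ord_recl {1}/b unlift_none mul0r add0r.
    by apply: eq_bigr => i _; rewrite /b liftK.
  exists b; split=> [i||i].
  - by rewrite /b; case: unliftP => [k _|_]; [exact: ca | exact: cauchy_cst].
  - by exists (lift ord0 j); rewrite /b liftK.
  apply: (@eq_null (fun m => \sum_j a j m * C (lift ord0 j) i m)) => [m|].
    by rewrite bS.
  have [k ->|->] := unliftP ord0 i; first exact: Ha.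
  by apply: null_sum => k; apply: nullM.
(* The elimination is fraction-free, since single terms of the pivot sequence may vanish. *)
pose C' j i m := C j0 ord0 m * C (lift j0 j) (lift ord0 i) m
                 - C (lift j0 j) ord0 m * C j0 (lift ord0 i) m.
have cC' j i : cauchy (C' j i).
  by apply: cauchyD; [|apply: cauchyN]; apply: cauchyM.
have [a [ca [j nj] Ha]] := IH C' cC'.
(* The coefficient of row [j0] makes the first column cancel exactly; the factor [C j0 ord0] of the
   others is removed by [null_cancel] when nontriviality is checked. *)
pose b j := if unlift j0 j is Some j' then fun m => a j' m * C j0 ord0 m
            else fun m => - \sum_k a k m * C (lift j0 k) ord0 m.
have b0 : b j0 = fun m => - \sum_k a k m * C (lift j0 k) ord0 m.
  by rewrite /b unlift_none.
have bl k : b (lift j0 k) = fun m => a k m * C j0 ord0 m by rewrite /b liftK.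
exists b; split=> [i||i].
- have [k ->|->] := unliftP j0 i; first by rewrite bl; apply: cauchyM.
  by rewrite b0; apply/cauchyN/cauchy_sum => k; apply: cauchyM.
- exists (lift j0 j); rewrite bl => H; apply: nj.
  apply: null_cancel nj0 _ => //; apply: eq_null H => m; exact: mulrC.
have S m k : \sum_j b j m * C j k m =
    \sum_j a j m * (C j0 ord0 m * C (lift j0 j) k m
                    - C (lift j0 j) ord0 m * C j0 k m).
  rewrite (bigD1_ord j0) //= b0 mulNr mulr_suml -sumrN -big_split /=.
  by apply: eq_bigr => l _; rewrite bl; ring.
have [k ->|->] := unliftP ord0 i.
  by apply: eq_null (Ha k) => m; rewrite S.
apply: eq_null null0 => m; rewrite S big1 // => l _.
by rewrite mulrC [_ * C j0 _ _]mulrC subrr mul0r.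
Qed.

End CauchySequences.

Section CompletionBasis.
Variables (R : realType) (K : fieldExtType rat) (v : K -> R).
Hypothesis av : absval v.

Lemma null_forE u : null_for v u <-> null v u.
Proof.
split=> [/cvgrPdist_lt H e /H[N _ HN]|H].
  by exists N => n /HN; rewrite /= sub0r normrN ger0_norm // absv_ge0.
apply/cvgrPdist_lt => e /H[N HN]; exists N => // n /= /HN.
by rewrite sub0r normrN ger0_norm // absv_ge0.
Qed.

Definition rat_absv (q : rat) := v q%:A.

Lemma absval_rat : absval rat_absv.
Proof.
split=> [x|x|x y|x y]; rewrite /rat_absv.
- exact: absv_ge0.
- split=> [/eqP|->]; last by rewrite scale0r absv0.
  by rewrite (absv_eq0 av) -in_algE fmorph_eq0 => /eqP.
- by rewrite -(absvM av) -(rmorphM (in_alg K)).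
- by rewrite -in_algE rmorphD /=; exact: absvD.
Qed.

Lemma cauchy_rat c : cauchy_for v (rat_seq K c) <-> cauchy rat_absv c.
Proof.
by split=> H e /H[M HM]; exists M => m n mM nM; have := HM _ _ mM nM;
  rewrite /rat_seq /rat_absv scalerBl.
Qed.

(** By [cauchy_kernel], more than [n] vectors with [n] coordinates are dependent. Hence all bases
    have the same size, and [local_degree] does not depend on the choice made by [xget]. *)
Lemma completion_basis_le n n' (b : 'I_n -> nat -> K) (b' : 'I_n' -> nat -> K) :
  completion_basis v b -> completion_basis v b' -> (n' <= n)%N.
Proof.
move=> [cb gb _] [cb' _ fb']; rewrite leqNgt; apply/negP => nn'.
have /fin_all_exists[c Hc] j : exists c : 'I_n -> nat -> rat,
    (forall i, cauchy rat_absv (c i)) /\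
    null v (fun m => b' j m - \sum_i c i m *: b i m).
  have [c [cc nc]] := gb _ (cb' j).
  by exists c; split=> [i|]; [apply/cauchy_rat | apply/null_forE].
pose w := widen_ord nn'.
have [a [ca [j nj] Ha]] := @cauchy_kernel _ _ _ absval_rat n
  (fun j => c (w j)) (fun j => (Hc (w j)).1).
(* Only the first [n.+1] vectors of [b'] take part; the others get the coefficient 0. *)
pose a' (k : 'I_n') := if insub (k : nat) is Some j then a j else fun=> 0.
have ca' k : cauchy rat_absv (a' k).
  by rewrite /a'; case: insubP => // *; apply: cauchy_cst absval_rat _.
have a'w k : a' (w k) = a k.
  by rewrite /a' insubT //= => h; congr a; exact: val_inj.
have cA k : cauchy v (rat_seq K (a' k)) by exact/cauchy_rat.
suff H : null_for v (fun m => \sum_i a' i m *: b' i m).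
  have /null_forE H' := fb' a' (fun k => (cauchy_rat _).2 (ca' k)) H (w j).
  by apply: nj => e /H'[M HM]; exists M => m /HM; rewrite /rat_absv /rat_seq a'w.
apply/null_forE.
apply: (@eq_null _ _ _ (fun m =>
   (\sum_k (a' k m)%:A * (b' k m - \sum_i c k i m *: b i m)) +
   \sum_i b i m * (\sum_k a k m * c (w k) i m)%:A)) => [m|].
  rewrite (eq_bigr (fun k => a' k m *: b' k m - \sum_i (a' k m * c k i m) *: b i m)).
    rewrite sumrB -addrA [X in _ + X](_ : _ = 0) ?addr0 //.
    apply/eqP; rewrite addrC subr_eq0 exchange_big; apply/eqP/eq_bigr => i _ /=.
    rewrite mulrC -scaler_suml mulr_algl; congr (_ *: _).
    rewrite (bigID (fun k : 'I_n' => (k < n.+1)%N)) /= [X in _ + X]big1 ?addr0.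
      by rewrite (big_ord_narrow nn'); apply: eq_bigr => k _; rewrite -a'w.
    by move=> k kn; rewrite /a' insubN // mul0r.
  move=> k _; rewrite mulr_algl scalerBr scaler_sumr; congr (_ - _).
  by apply: eq_bigr => i _; rewrite scalerA.
apply: (nullD av); apply: (null_sum av) => k; apply: (nullM av).
- exact: cA.
- exact: (Hc k).2.
- exact: cb.
- exact: Ha.
Qed.

Lemma local_degreeE n (b : 'I_n -> nat -> K) :
  completion_basis v b -> local_degree v = n.
Proof.
move=> bb; rewrite /local_degree; case: xgetP => [m -> [b' bb']|H].
  by apply/eqP; rewrite eqn_leq (completion_basis_le bb bb') (completion_basis_le bb' bb).
by case: (H n); exists b.
Qed.

End CompletionBasis.

(** * Places of Galois extensions and of their subfields *)

Section GaloisAction.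
Variable E : splittingFieldType rat.
Implicit Types g h : gal_of {:E}.

Lemma pchar_ext0 (L : fieldExtType rat) : [pchar L] =i pred0.
Proof. by move=> p; rewrite (pchar_lalg L) pchar_num. Qed.

Lemma galois_rat : galois 1 {:E}.
Proof.
apply/and3P; split; rewrite ?sub1v ?normalFieldf //.
apply/separableP => y _; apply: pcharf0_separable; exact: pchar_ext0.
Qed.

Lemma gal_ratP (x : E) : (forall g, g x = x) -> exists q : rat, x = q%:A.
Proof.
move=> H; have /galois_fixedField fix1 := galois_rat.
have : x \in fixedField 'Gal({:E} / 1)%g.
  by apply/fixedFieldP; rewrite ?memvf // => g _; exact: H.
by rewrite fix1 => /vlineP[q ->]; exists q.
Qed.

Lemma gal_compE g h (x : E) : (g * h)%g x = h (g x).
Proof. by rewrite galM // memvf. Qed.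

Lemma gal_alg g (q : rat) : g q%:A = q%:A.
Proof. by rewrite linearZ rmorph1. Qed.

Lemma gal_sum_rat (y : E) : exists r : rat, \sum_(g : gal_of {:E}) g y = r%:A.
Proof.
apply: gal_ratP => h; rewrite rmorph_sum [RHS](reindex_inj (mulIg h)) /=.
by apply: eq_bigr => g _; rewrite gal_compE.
Qed.

Lemma gal_prod_rat (y : E) : exists r : rat, \prod_(g : gal_of {:E}) g y = r%:A.
Proof.
apply: gal_ratP => h; rewrite rmorph_prod [RHS](reindex_inj (mulIg h)) /=.
by apply: eq_bigr => g _; rewrite gal_compE.
Qed.

Lemma gal_charpoly_rat (y : E) k : exists r : rat,
  (\prod_(g : gal_of {:E}) ('X - (g y)%:P))`_k = r%:A.
Proof.
apply: gal_ratP => h; rewrite -coef_map rmorph_prod; congr ((_ : {poly _})`_k).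
rewrite [RHS](reindex_inj (mulIg h)) /=.
by apply: eq_bigr => g _; rewrite rmorphB /= map_polyX map_polyC gal_compE.
Qed.

Variables (R : realType) (w : E -> R).
Hypothesis aw : absval w.

Lemma absval_comp (L M : fieldType) (f : {rmorphism L -> M}) (u : M -> R) :
  absval u -> absval (u \o f).
Proof.
move=> au; split=> [x|x|x y|x y] /=.
- exact: absv_ge0.
- split=> [/eqP|->]; last by rewrite rmorph0 absv0.
  by rewrite (absv_eq0 au) fmorph_eq0 => /eqP.
- by rewrite rmorphM (absvM au).
- by rewrite rmorphD; exact: absvD.
Qed.

Definition decomposition : pred (gal_of {:E}) := fun g => `[< w \o g = w >].

Lemma decompP g : reflect (forall x, w (g x) = w x) (g \in decomposition).
Proof.
rewrite unfold_in; apply: (iffP (asboolP _)) => [H x|H]; last exact/funext.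
by rewrite -[LHS]/((w \o g) x) H.
Qed.

Variable c : rat.
Hypothesis c1 : 1 < w c%:A.

(* Averaging z x over the Galois group, where z is close to 1 at w and close
   to 0 at the other conjugates of w *)
Lemma decomposition_dense (x : E) (e : R) : 0 < e ->
  (forall h, h \in decomposition -> h x = x) -> exists r : rat, w (r%:A - x) < e.
Proof.
move=> e0 xD; pose d := #|decomposition|.
have d0 : (d%:R : E) != 0.
  rewrite -(rmorph_nat (in_alg E)) fmorph_eq0 pnatr_eq0 -lt0n; apply/card_gt0P.
  by exists 1%g; apply/decompP => y; rewrite gal_id.
(* If each [g z] is within [e'] of its target, 1 or 0, then the trace of [z * x] is within [e' * T]
   of [d] times [x]. The denominator [T + 1] below also covers [T = 0]. *)
pose T : R := w x *+ d + \sum_(g | g \notin decomposition) w (g x).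
have T0 : 0 <= T.
  by rewrite addr_ge0 ?mulrn_wge0 ?sumr_ge0 // => *; rewrite absv_ge0.
have wd : 0 < w d%:R by rewrite absv_gt0.
have [||z [z1 zs]] := @absval_approx R E _
  [seq g <- enum {: gal_of {:E}} | g \notin decomposition]
  (fun g => w \o g) w c%:A (e * w d%:R / (T + 1)) aw c1.
- by rewrite !divr_gt0 ?mulr_gt0 // ltr_wpDl.
- move=> g; rewrite mem_filter => /andP[gD _]; split.
  + exact: absval_comp aw.
  + by rewrite /= gal_alg.
  + by move=> H; move/negP: gD; apply; apply/decompP => y; rewrite {2}H.
set e' := _ / _ in z1 zs.
have [r rE] := gal_sum_rat (z * x).
have rdE : (r / d%:R)%:A - x = (\sum_(g | g \in decomposition) (g z - 1) * x +
    \sum_(g | g \notin decomposition) g z * g x) / d%:R :> E.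
  apply: (mulIf d0); rewrite divfK // mulrBl.
  have -> : (r / d%:R)%:A = r%:A / d%:R :> E.
    by rewrite -!in_algE rmorphM fmorphV rmorph_nat.
  rewrite divfK // -rE.
  rewrite (bigID (mem decomposition)) /= addrAC; congr (_ + _); last first.
    by apply: eq_bigr => g _; rewrite rmorphM.
  rewrite -mulr_suml sumrB mulrBl; congr (_ - _).
    rewrite mulr_suml; apply: eq_bigr => g gD; by rewrite rmorphM /= xD.
  by rewrite sumr_const mulr_natr mulr_natl.
exists (r / d%:R); rewrite rdE absvM // absvV // ltr_pdivrMr //.
apply: (@le_lt_trans _ _ (e' * T)); last first.
  rewrite /e' mulrAC ltr_pdivrMr ?ltr_wpDl // ltr_pM2l ?ltrDl //.
  by rewrite mulr_gt0.
apply: le_trans (absvD aw _ _) _; rewrite mulrDr; apply: lerD.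
  apply: le_trans (absv_sum aw _ _ _) _.
  rewrite mulrnAr -sumr_const; apply: ler_sum => g gD.
  rewrite (absvM aw) ler_wpM2r ?absv_ge0 //.
  by rewrite -[1](rmorph1 g) -rmorphB (decompP _ gD) ltW.
apply: le_trans (absv_sum aw _ _ _) _.
rewrite mulr_sumr; apply: ler_sum => g gD.
rewrite (absvM aw) ler_wpM2r ?absv_ge0 // ltW // zs //.
by rewrite mem_filter gD mem_enum.
Qed.
End GaloisAction.

Lemma invS_small (R : realType) (e : R) : 0 < e ->
  exists M, forall m, (M <= m)%N -> m.+1%:R^-1 < e.
Proof.
move=> e0; exists (Num.truncn e^-1) => m mM.
rewrite invf_plt ?posrE //; apply: lt_le_trans (truncnS_gt _) _.
by rewrite ler_nat ltnS.
Qed.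

(** * Local degrees as numbers of conjugates *)

Section LocalDegree.
Variables (R : realType) (E : splittingFieldType rat) (K : fieldExtType rat).
Variables (iota : {rmorphism K -> E}).
Implicit Types g h : gal_of {:E}.

Lemma iota_alg (q : rat) : iota q%:A = q%:A.
Proof. by rewrite !alg_num_field fmorph_rat. Qed.

Lemma primitive_element : exists t : K, <<1; t>>%VS = fullv.
Proof.
exists (separable_generator 1 {:K}).
rewrite -eq_adjoin_separable_generator ?sub1v //.
by apply/separableP => y _; apply: pcharf0_separable; exact: pchar_ext0.
Qed.

Variable t : K.
Hypothesis genK : <<1; t>>%VS = fullv :> {vspace K}.

Lemma iota_horner (f : {rmorphism E -> E}) u :
  f (iota u) = (map_poly (f \o iota) (Fadjoin_poly 1 t u)).[f (iota t)].
Proof.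
have -> : f (iota t) = (f \o iota) t by [].
by rewrite horner_map /= Fadjoin_poly_eq // genK memvf.
Qed.

Lemma gal_iota_eq g h : g (iota t) = h (iota t) -> forall u, g (iota u) = h (iota u).
Proof.
move=> ght u; rewrite (iota_horner g u) (iota_horner h u) /= ght; congr (_.[_]).
apply/polyP => i; rewrite !coef_map.
have /polyOverP/(_ i)/vlineP[q ->] := Fadjoin_polyOver 1 t u.
by rewrite /= !iota_alg !gal_alg.
Qed.

Variables (w : E -> R) (v : K -> R) (c : rat).
Hypotheses (aw : absval w) (c1 : 1 < w c%:A).

Definition over_place : pred (gal_of {:E}) :=
  fun g => `[< forall u, w (g (iota u)) = v u >].

Lemma over_placeP g : reflect (forall u, w (g (iota u)) = v u) (g \in over_place).
Proof. by rewrite unfold_in; apply: (iffP (asboolP _)). Qed.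

Definition conj_roots : seq E :=
  undup [seq g (iota t) | g : gal_of {:E} in over_place].

Let n := size conj_roots.

Lemma conj_rootsP (i : 'I_n) :
  exists g, g \in over_place /\ g (iota t) = conj_roots`_i.
Proof.
have : conj_roots`_i \in conj_roots by rewrite mem_nth.
rewrite {2}/conj_roots mem_undup => H.
by have /fintype.imageP[g gS gE] := H; exists g.
Qed.

Lemma mem_conj_roots g : g \in over_place -> g (iota t) \in conj_roots.
Proof. by move=> gS; rewrite /conj_roots mem_undup fintype.image_f. Qed.

(** The powers [t ^+ j] with [j < n] form a basis of the completion. The coordinates [C u] of [u]
    solve the Vandermonde system of the [n] conjugates of [t] above [v]; they are fixed by the
    decomposition group, hence are limits of rationals. *)
Lemma local_degree_conj g0 : g0 \in over_place -> local_degree v = n.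
Proof.
move=> g0S; have wv := over_placeP _ g0S.
have av : absval v.
  have -> : v = w \o (g0 \o iota) by apply/funext => u; rewrite /= wv.
  exact: absval_comp aw.
have /fin_all_exists[gi Hgi] := conj_rootsP.
have giS i : gi i \in over_place by case: (Hgi i).
have git i : gi i (iota t) = conj_roots`_i by case: (Hgi i).
have wgi i u : w (gi i (iota u)) = v u by exact: (over_placeP _ (giS i)).
have Urs : uniq conj_roots by exact: undup_uniq.
pose V : 'M[E]_n := \matrix_(i, j) conj_roots`_i ^+ j.
have Vu : V \in unitmx.
  rewrite -unitmx_tr.
  have -> : V^T = Vandermonde n (\row_i conj_roots`_i).
    by apply/matrixP => i j; rewrite !mxE.
  rewrite unitmxE det_Vandermonde unitfE; apply/prodf_neq0 => i _.
  apply/prodf_neq0 => j ij; rewrite !mxE subr_eq0 nth_uniq //.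
  by apply: contraTneq ij => ->; rewrite ltnn.
have VE i j : V i j = conj_roots`_i ^+ j by rewrite mxE.
have Vinj (A B : 'cV_n) : V *m A = V *m B -> A = B.
  by move=> H; rewrite -(mulKmx Vu A) H mulKmx.
pose phi u : 'cV[E]_n := \col_i gi i (iota u).
pose C u := invmx V *m phi u.
have CE u : V *m C u = phi u by rewrite mulKVmx.
(* [h] permutes the conjugates above [v], so it permutes the equations of the system and fixes their
   unique solution. *)
have Cfix u h : h \in decomposition w -> map_mx h (C u) = C u.
  move=> hD; have hS i : (gi i * h)%g \in over_place.
    by apply/over_placeP => x; rewrite gal_compE (decompP w _ hD) wgi.
  have ix i : (index (h (gi i (iota t))) conj_roots < n)%N.
    by rewrite index_mem -gal_compE mem_conj_roots.
  pose p i := Ordinal (ix i).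
  have pE i : h (gi i (iota t)) = conj_roots`_(p i).
    by rewrite /= nth_index // -index_mem ix.
  have pinj : injective p.
    move=> i j pij; have : h (gi i (iota t)) = h (gi j (iota t)) by rewrite !pE pij.
    move/fmorph_inj; rewrite !git => /eqP; rewrite nth_uniq // => /eqP.
    exact: val_inj.
  apply: Vinj; rewrite CE.
  apply/colP => k; have [q _ qK] := injF_bij pinj.
  rewrite -(qK k); set i := q k; rewrite mxE [RHS]mxE.
  have := congr1 (fun A : 'cV_n => h (A i 0)) (CE u).
  rewrite [(V *m _) _ _]mxE [phi u _ _]mxE rmorph_sum /= => H.
  have <- : h (gi i (iota u)) = gi (p i) (iota u).
    by rewrite -gal_compE; apply: gal_iota_eq; rewrite gal_compE pE git.
  rewrite -H; apply: eq_bigr => j _.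
  rewrite [map_mx _ _ _ _]mxE !VE rmorphM rmorphXn /= -(git i) pE.
  by rewrite nth_index // mem_nth.
pose Cc u i := C u i 0.
have Cdense u (e : R) : 0 < e -> exists r : 'I_n -> rat, forall i, w ((r i)%:A - Cc u i) < e.
  move=> e0; have Hi i : exists r : rat, w (r%:A - Cc u i) < e.
    apply: (decomposition_dense aw c1 e0) => h hD.
    by have := congr1 (fun A : 'cV_n => A i 0) (Cfix u h hD); rewrite mxE.
  by have /fin_all_exists[r Hr] := Hi; exists r.
(* The coordinates of [u] are bounded by a multiple of [v u], so they form Cauchy or null sequences
   whenever [u] does. *)
pose B := \sum_i \sum_j w (invmx V i j) + 1.
have B0 : 0 < B.
  by rewrite ltr_wpDl // sumr_ge0 // => i _; rewrite sumr_ge0 // => j _; rewrite absv_ge0.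
have CB u i : w (Cc u i) <= B * v u.
  rewrite /Cc mxE; apply: le_trans (absv_sum aw _ _ _) _.
  rewrite (eq_bigr (fun j => w (invmx V i j) * v u)); last first.
    by move=> j _; rewrite (absvM aw) mxE wgi.
  rewrite -mulr_suml ler_wpM2r ?absv_ge0 // /B [X in X + 1](bigD1 i) //= -addrA lerDl.
  by rewrite addr_ge0 // sumr_ge0 // => k _; rewrite sumr_ge0 // => j _; rewrite absv_ge0.
have CD u u' i : Cc (u - u') i = Cc u i - Cc u' i.
  rewrite /Cc /C -[_ - _ in RHS](_ : (invmx V *m phi u - invmx V *m phi u') i 0 = _).
    rewrite -mulmxBr; congr (_ i 0); congr (_ *m _).
    by apply/colP => k; rewrite !mxE !rmorphB.
  by rewrite !mxE.
have Ct i (r : 'I_n -> rat) : Cc (\sum_j r j *: t ^+ j) i = (r i)%:A.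
  rewrite /Cc; have -> : C (\sum_j r j *: t ^+ j) = \col_j (r j)%:A.
    apply: Vinj; rewrite CE; apply/colP => k; rewrite !mxE.
    rewrite !rmorph_sum; apply: eq_bigr => j _.
    rewrite !mxE -[X in iota X]mulr_algl !rmorphM !rmorphXn /= git iota_alg gal_alg.
    by rewrite mulrC.
  by rewrite mxE.
have vE (q : rat) : v q%:A = w q%:A by rewrite -wv iota_alg gal_alg.
apply: (@local_degreeE _ _ _ av n (fun j _ => t ^+ j)); split.
- by move=> i; exact: (cauchy_cst av).
- move=> u cu.
  (* Rational approximations of the coordinates of [u m], with errors that tend to 0; they are
     Cauchy because the coordinates are. *)
  have /choice[r Hr] m : exists r : 'I_n -> rat, forall i,
      w ((r i)%:A - Cc (u m) i) < m.+1%:R^-1.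
    by apply: Cdense; rewrite invr_gt0.
  exists (fun i m => r m i); split=> [i e e0|].
    have e3 : 0 < e / 3 by rewrite divr_gt0.
    have [M HM] := invS_small e3.
    have [|N HN] := cu (e / 3 / B); first by rewrite divr_gt0.
    exists (maxn M N) => m m'; rewrite !geq_max => /andP[mM mN] /andP[mM' mN'].
    rewrite /rat_seq -scalerBl vE scalerBl.
    have := HN _ _ mN mN'; rewrite ltr_pdivlMr // => h1.
    have h2 := CB (u m - u m') i; rewrite CD in h2.
    have h3 := lt_trans (Hr m i) (HM _ mM).
    have h4 := lt_trans (Hr m' i) (HM _ mM').
    set a := (r m i)%:A in h3 *; set b := (r m' i)%:A in h4 *.
    have -> : a - b = (a - Cc (u m) i) - (b - Cc (u m') i)
       + (Cc (u m) i - Cc (u m') i) by ring.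
    have k1 := absvD aw (a - Cc (u m) i - (b - Cc (u m') i)) (Cc (u m) i - Cc (u m') i).
    have k2 := absvB aw (a - Cc (u m) i) (b - Cc (u m') i).
    by apply: le_lt_trans k1 _; lra.
  have ix : (index (g0 (iota t)) conj_roots < n)%N by rewrite index_mem mem_conj_roots.
  pose i0 := Ordinal ix.
  pose B' := \sum_j w (V i0 j) + 1.
  have B'0 : 0 < B' by rewrite ltr_wpDl // sumr_ge0 // => j _; rewrite absv_ge0.
  apply/(null_forE av) => e e0.
  have [|M HM] := @invS_small _ (e / B'); first by rewrite divr_gt0.
  exists M => m /HM; rewrite ltr_pdivlMr // => h.
  apply: le_lt_trans h; set y := _ - _.
  have -> : v y = w (phi y i0 0) by rewrite mxE wgi.
  rewrite -CE mxE mulrC /B' mulrDl mulr_suml mul1r.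
  apply: le_trans (absv_sum aw _ _ _) _.
  rewrite -[leLHS]addr0; apply: lerD; last by rewrite invr_ge0.
  apply: ler_sum => j _; rewrite (absvM aw) ler_wpM2l ?absv_ge0 // ltW //.
  rewrite -/(Cc y j) /y CD Ct -(absvN aw) opprB; exact: Hr.
- move=> r cr /(null_forE av) nr i; apply/(null_forE av) => e e0.
  have [|M HM] := nr (e / B); first by rewrite divr_gt0.
  exists M => m /HM; rewrite ltr_pdivlMr // => h; rewrite /rat_seq vE.
  apply: le_lt_trans h; have := CB (\sum_j r j m *: t ^+ j) i.
  by rewrite (Ct i (fun j => r j m)) mulrC.
Qed.

End LocalDegree.

(** * Local degrees as proportions of automorphisms *)

Section DegreeCount.
Variables (R : realType) (E : splittingFieldType rat) (K : fieldExtType rat).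
Variables (iota : {rmorphism K -> E}).
Implicit Types g h : gal_of {:E}.
Variable t : K.
Hypothesis genK : <<1; t>>%VS = fullv :> {vspace K}.

Definition conj_seq (S : pred (gal_of {:E})) : seq E :=
  undup [seq g (iota t) | g : gal_of {:E} in S].

Lemma card_gal_fiber g0 :
  #|[pred g : gal_of {:E} | g (iota t) == g0 (iota t)]| =
  #|[pred g : gal_of {:E} | g (iota t) == iota t]|.
Proof.
rewrite -(fintype.card_image (mulIg g0^-1%g)).
apply: eq_card => g; rewrite !inE; apply/fintype.imageP/eqP => [[h]|gt].
  by rewrite inE => /eqP ht ->; rewrite gal_compE ht -gal_compE mulgV gal_id.
by exists (g * g0)%g; rewrite ?inE ?gal_compE ?gt // mulgK.
Qed.

(** [S] is a union of fibres of the map from [g] to [g (iota t)], and all fibres have the size of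
    the stabilizer of [iota t]. *)
Lemma card_conj_seq (S : pred (gal_of {:E})) :
  (forall g h, g \in S -> h (iota t) = g (iota t) -> h \in S) ->
  #|S| = (size (conj_seq S) * #|[pred g : gal_of {:E} | g (iota t) == iota t]|)%N.
Proof.
move=> Scl.
rewrite -sum1_card (eq_bigr (fun g => \sum_(r <- conj_seq S) (r == g (iota t)))%N).
  rewrite exchange_big /= big_seq (eq_bigr (fun=>
    #|[pred g : gal_of {:E} | g (iota t) == iota t]|)).
    by rewrite -big_seq big_const_seq count_predT iter_addn_0 mulnC.
  move=> r; rewrite mem_undup => /fintype.imageP[g0 g0S ->].
  rewrite -(card_gal_fiber g0) -sum1_card big_mkcond [RHS]big_mkcond /=.
  apply: eq_bigr => g _; rewrite inE eq_sym; case: eqP => [gt|_]; last by case: ifP.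
  by rewrite (Scl g0).
move=> g gS; have gr : g (iota t) \in conj_seq S by rewrite mem_undup fintype.image_f.
have -> : (\sum_(r <- conj_seq S) (r == g (iota t)) = count_mem (g (iota t)) (conj_seq S))%N.
  by rewrite -sumn_count sumnE big_map.
by rewrite count_uniq_mem ?undup_uniq // gr.
Qed.

(** The degree of K is that of the minimal polynomial of its generator [t], whose conjugates in the
    Galois extension [E] are the [g (iota t)]. The minimal polynomials of [t] and [iota t] have
    equal size because each, being rational, can be moved to the other field, where it is divisible
    by the other. *)
Lemma dim_conj : \dim {:K} = size (conj_seq predT).
Proof.
have /polyOver1P[m mE] := minPolyOver 1 t.
have /polyOver1P[m' m'E] := minPolyOver 1 (iota t).
have mapmap p : map_poly (in_alg E) p = map_poly iota (map_poly (in_alg K) p).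
  by rewrite -map_poly_comp; apply: eq_map_poly => q; rewrite /= iota_alg.
have sz : size (minPoly 1 t) = size (minPoly 1 (iota t)).
  apply/eqP; rewrite eqn_leq; apply/andP; split.
    rewrite m'E mapmap size_map_poly.
    apply: dvdp_leq; first by rewrite
      map_poly_eq0 -(map_poly_eq0 (in_alg E)) -m'E monic_neq0 ?monic_minPoly.
    apply: minPoly_dvdp; first by apply/polyOver1P; exists m'.
    by rewrite -(fmorph_root iota) -mapmap -m'E root_minPoly.
  rewrite mE -(size_map_poly iota) -mapmap.
  apply: dvdp_leq; first by rewrite
    map_poly_eq0 -(map_poly_eq0 (in_alg K)) -mE monic_neq0 ?monic_minPoly.
  apply: minPoly_dvdp; first by apply/polyOver1P; exists m.
  by rewrite mapmap fmorph_root -mE root_minPoly.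
have := sz; rewrite size_minPoly adjoin_degreeE dimv1 divn1 genK.
have [r /= [_ Ur Dr]] :=
  elimT (galois_factors (sub1v _)) (galois_rat E) (iota t) (memvf _).
rewrite Dr size_prod_XsubC => -[->].
apply/perm_size/uniq_perm => //; first exact: undup_uniq.
move=> x; rewrite -root_prod_XsubC -Dr mem_undup; apply/idP/fintype.imageP => [|[g _ ->]].
  rewrite Dr root_prod_XsubC => /mapP[g _ ->]; by exists g.
by apply: root_minPoly_gal; rewrite ?sub1v ?memvf // gal_kHom ?sub1v // k1HomE ahomWin.
Qed.

Variables (w : E -> R) (v : K -> R) (c : rat).
Hypotheses (aw : absval w) (c1 : 1 < w c%:A).

(** Both cardinals are a number of conjugates of [t] times the size of one fibre, so [d_v / d] is
    the proportion of automorphisms that induce [v]. *)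
Lemma local_degree_count g0 : g0 \in over_place iota w v ->
  (local_degree v * #|{: gal_of {:E}}| = \dim {:K} * #|over_place iota w v|)%N.
Proof.
move=> g0S; rewrite (local_degree_conj genK aw c1 g0S) dim_conj.
rewrite (card_conj_seq (S := predT)) // (@card_conj_seq (over_place iota w v)).
  by rewrite mulnCA.
move=> g h /over_placeP gS ht; apply/over_placeP => u.
by rewrite -gS (gal_iota_eq genK ht).
Qed.

End DegreeCount.

(** * Conjugacy of the absolute values above one place *)

Section ConjugatePlaces.
Variables (R : realType) (E : splittingFieldType rat) (K : fieldExtType rat).
Variables (iota : {rmorphism K -> E}).
Implicit Types g h : gal_of {:E}.
Variables (w : E -> R) (v : K -> R) (c : rat).
Hypotheses (aw : absval w) (c1 : 1 < w c%:A).

(** A coefficient below the leading one is a sum of at most [2 ^+ size s] products of roots, each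
    with at least one factor; [e <= 1] takes care of the further factors. *)
Lemma coef_prod_XsubC_small (s : seq E) (e : R) : 0 <= e <= 1 ->
  (forall a, a \in s -> w a <= e) -> forall k,
  w (\prod_(a <- s) ('X - a%:P))`_k <= 2 ^+ size s *
    (if (k < size s)%N then e else 1).
Proof.
case/andP=> e0 e1; elim: s => [|a s IH] Hs k.
  rewrite big_nil expr0 mul1r coefC; case: k => [|k] /=; first by rewrite absv1.
  by rewrite absv0.
rewrite big_cons mulrBl coefB coefXM coefCM /= exprS -mulrA.
have wa : w a <= e by apply: Hs; rewrite mem_head.
have {}IH := IH (fun b bs => Hs b (mem_behead (s := a :: s) bs)).
set Q := \prod_(_ <- s) _ in IH *.
have S0 : 0 <= 2 ^+ size s :> R by rewrite exprn_ge0.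
apply: le_trans (absvB aw _ _) _; rewrite mulrDl mul1r; apply: lerD.
  case: k => [|k] /=; last by rewrite ltnS.
  by rewrite absv0 // mulr_ge0.
rewrite (absvM aw); have Qk : w Q`_k <= 2 ^+ size s.
  apply: le_trans (IH k) _; rewrite ler_piMr //; by case: ifP.
apply: (@le_trans _ _ (e * 2 ^+ size s)).
  by apply: ler_pM; rewrite ?absv_ge0.
by rewrite mulrC; case: ifP => _ //; rewrite ler_wpM2l.
Qed.

(* If v were not conjugate to w, some z in K would be large at v and small at
   all the conjugates of w; but z is a root of its characteristic polynomial,
   whose coefficients are rational and small. *)
Lemma absval_conjugate : absval v -> (forall q : rat, v q%:A = w q%:A) ->
  exists g : gal_of {:E}, g \in over_place iota w v.
Proof.
move=> av vw; apply: contrapT => H; pose m := #|{: gal_of {:E}}|.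
have [||z [z1 zs]] := @absval_separate R K _ (enum {: gal_of {:E}})
  (fun g => w \o (g \o iota)) v c%:A av.
- by rewrite vw.
- move=> g _; split; first exact: absval_comp aw.
  + by rewrite /= iota_alg gal_alg vw.
  + by move=> vE; apply: H; exists g; apply/over_placeP => u; rewrite vE.
(* Chosen with [m * 2 ^ m * e < 1], so that the [m] lower terms of the characteristic polynomial
   cannot cancel [y ^+ m], as [v y > 1]. *)
pose e : R := (m%:R * 2 ^+ m + 1)^-1.
have e0 : 0 < e by rewrite invr_gt0 ltr_wpDl // mulr_ge0 // exprn_ge0.
have e1 : e <= 1 by rewrite invf_le1 ?lerDr ?ltr_wpDl // mulr_ge0 // exprn_ge0.
have [N HN] : exists N, forall n, (N <= n)%N -> forall g, g \in enum {: gal_of {:E}} ->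
    w (g (iota (z ^+ n))) < e.
  apply: (@eventually_all _ _ (fun (g : gal_of {:E}) n => w (g (iota (z ^+ n))) < e)).
  move=> g gE; have [||N HN] := @pow_small R (w (g (iota z))) e _ _ e0.
  - exact: absv_ge0.
  - exact: zs.
  by exists N => n /HN; rewrite !rmorphXn (absvX aw).
pose y := z ^+ N.+1.
have y1 : 1 < v y by rewrite (absvX av) exprn_egt1.
pose s := [seq g (iota y) | g : gal_of {:E}].
have sm : size s = m by rewrite size_map -cardE.
have /fin_all_exists[r Hr] : forall k : 'I_m, exists q : rat,
    (\prod_(a <- s) ('X - a%:P))`_k = q%:A.
  by move=> k; rewrite big_image; exact: gal_charpoly_rat.
have rs k : v (r k)%:A <= 2 ^+ m * e.
  rewrite vw -Hr; apply: le_trans (coef_prod_XsubC_small (e := e) _ _ k) _.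
  - by rewrite ltW.
  - by move=> a /fintype.imageP[g _ ->]; apply/ltW/HN; rewrite ?mem_enum.
  - by rewrite sm ltn_ord.
have P0 : (\prod_(a <- s) ('X - a%:P)).[iota y] = 0.
  apply/rootP; rewrite root_prod_XsubC; apply/fintype.imageP.
  by exists 1%g; rewrite ?gal_id.
have yE : y ^+ m = - \sum_(k < m) (r k)%:A * y ^+ k.
  apply: (fmorph_inj iota); apply/eqP; rewrite rmorphN -addr_eq0; apply/eqP.
  have lead1 : (\prod_(a <- s) ('X - a%:P))`_m = 1.
    have := monic_prod_XsubC s predT id; rewrite monicE lead_coefE size_prod_XsubC.
    by rewrite sm => /eqP.
  rewrite -P0 horner_coef size_prod_XsubC sm big_ord_recr /= addrC lead1 mul1r.
  rewrite rmorphXn rmorph_sum; congr (_ + _).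
  by apply: eq_bigr => k _; rewrite Hr rmorphM rmorphXn /= iota_alg.
have ym k : (k <= m)%N -> v y ^+ k <= v y ^+ m by move=> km; rewrite ler_weXn2l // ltW.
have : 1 * v y ^+ m <= m%:R * 2 ^+ m * e * v y ^+ m.
  rewrite mul1r -[leLHS](absvX av) {1}yE absvN //; apply: le_trans (absv_sum av _ _ _) _.
  apply: (@le_trans _ _ (\sum_(k < m) 2 ^+ m * e * v y ^+ m)).
    apply: ler_sum => k _; rewrite (absvM av) (absvX av).
    apply: ler_pM (rs k) (ym _ (ltnW (ltn_ord k))); rewrite ?exprn_ge0 //; exact: absv_ge0.
  by rewrite sumr_const card_ord -[_ *+ m]mulr_natl !mulrA.
have y0 : 0 < v y ^+ m by rewrite exprn_gt0 // (lt_trans _ y1).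
have h0 : 0 <= m%:R * 2 ^+ m :> R by rewrite mulr_ge0 // exprn_ge0.
rewrite ler_pM2r // /e ler_pdivlMr ?ltr_wpDl //.
by rewrite mul1r gerDl ler10.
Qed.

End ConjugatePlaces.

(** * Absolute values of algC *)

Section PadicPlace.
Variables (R : realType) (p : nat).
Hypothesis pp : prime p.

Local Notation pC := (p%:R : algC).

Lemma pC_neq0 : pC != 0. Proof. by rewrite pnatr_eq0 -lt0n prime_gt0. Qed.

(** Chevalley's construction of an extension of the p-adic valuation: a subring that is maximal with
    this property is a valuation ring whose maximal ideal contains [p]. *)
Definition subring_no_pinv (A : set algC) : Prop :=
  [/\ A 1, forall x y, A x -> A y -> A (x - y),
      forall x y, A x -> A y -> A (x * y) & ~ A pC^-1].

Lemma exists_maximal_subring : exists A, subring_no_pinv A /\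
  forall B, (A `<=` B)%classic -> subring_no_pinv B -> (B `<=` A)%classic.
Proof.
have [F FP Ftot|A [PA Amax]] := @Zorn_bigcup algC
    [set A | A = set0 \/ subring_no_pinv A]%classic.
  have [H|H] := pselect (exists2 B, F B & subring_no_pinv B); last first.
    left; rewrite -subset0 => x [B FB Bx]; have [B0|sB] := FP B FB.
      by rewrite B0 in Bx.
    by case: H; exists B.
  right; have [B FB sB] := H.
  have two X Y x y : F X -> F Y -> X x -> Y y ->
      exists Z, [/\ F Z, subring_no_pinv Z, Z x & Z y].
    move=> FX FY Xx Yy.
    have sX : subring_no_pinv X by have [X0|//] := FP X FX; rewrite X0 in Xx.
    have sY : subring_no_pinv Y by have [Y0|//] := FP Y FY; rewrite Y0 in Yy.
    by have [XY|YX] := Ftot X Y FX FY; [exists Y|exists X]; split => //;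
      [apply: XY|apply: YX].
  split.
  - by exists B => //; case: sB.
  - move=> x y [X FX Xx] [Y FY Yy]; have [Z [FZ [_ sZ _ _] Zx Zy]] := two _ _ _ _ FX FY Xx Yy.
    by exists Z => //; apply: sZ.
  - move=> x y [X FX Xx] [Y FY Yy]; have [Z [FZ [_ _ sZ _] Zx Zy]] := two _ _ _ _ FX FY Xx Yy.
    by exists Z => //; apply: sZ.
  - move=> [X FX Xx]; have [Z [_ [_ _ _]]] := two _ _ _ _ FX FX Xx Xx; by [].
have sA : subring_no_pinv A.
  have [A0|//] := PA; case: (Amax [set x | x \in Num.int]%classic).
    rewrite A0; split=> [x []|/(_ 1)]; apply; exact: rpred1.
  right; split => /=; rewrite ?rpred1 //.
  - by move=> x y xZ yZ; exact: rpredB.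
  - by move=> x y xZ yZ; exact: rpredM.
  - move/norm_intr_ge1; rewrite invr_eq0 pC_neq0 => /(_ isT).
    by rewrite normfV normr_nat invf_ge1 ?ltr0n ?prime_gt0 // lern1 leqNgt prime_gt1.
exists A; split=> // B AB sB; apply: contrapT => BA.
by apply: (Amax B); [split | right].
Qed.

Section ValuationRing.
Variable A : set algC.
Hypothesis sA : subring_no_pinv A.
Hypothesis Amax : forall B, (A `<=` B)%classic -> subring_no_pinv B -> (B `<=` A)%classic.

Let A1 : A 1. Proof. by case: sA. Qed.
Let AB x y : A x -> A y -> A (x - y). Proof. by case: sA => _ H _ _; exact: H. Qed.
Let AM x y : A x -> A y -> A (x * y). Proof. by case: sA => _ _ H _; exact: H. Qed.
Let Ap : ~ A pC^-1. Proof. by case: sA. Qed.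
Let A0 : A 0. Proof. by rewrite -(subrr 1); exact: AB. Qed.
Let AN x : A x -> A (- x). Proof. by rewrite -sub0r; exact: AB. Qed.
Let AD x y : A x -> A y -> A (x + y).
Proof. by move=> Ax Ay; rewrite -(opprK y); apply: AB => //; exact: AN. Qed.
Let AX x n : A x -> A (x ^+ n).
Proof. by move=> Ax; elim: n => [|n IH]; rewrite ?expr0 ?exprS //; exact: AM. Qed.
Let Asum (I : Type) (s : seq I) (P : pred I) (f : I -> algC) :
  (forall i, P i -> A (f i)) -> A (\sum_(i <- s | P i) f i).
Proof. by move=> H; apply: big_ind. Qed.
Let Anat n : A n%:R.
Proof. by elim: n => [//|n IH]; rewrite mulrSr; exact: AD. Qed.

(** Otherwise [A[x]] would be a larger subring without [1 / p]. *)
Lemma adjoin_pinv x : ~ A x -> exists q : {poly algC},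
  (forall i, A q`_i) /\ 1 = pC * q.[x].
Proof.
move=> nAx; apply: contrapT => H.
pose B := [set y | exists q : {poly algC}, (forall i, A q`_i) /\ y = q.[x]]%classic.
have AB' : (A `<=` B)%classic.
  move=> y Ay; exists y%:P; rewrite hornerC; split=> // i.
  by rewrite coefC; case: ifP.
apply: nAx; apply: (Amax AB'); last first.
  exists 'X; rewrite hornerX; split=> // i; rewrite coefX; by case: eqP.
split.
- exact: AB'.
- move=> y z [q [Aq ->]] [r [Ar ->]]; exists (q - r); rewrite hornerD hornerN.
  by split=> // i; rewrite coefB; exact: AB.
- move=> y z [q [Aq ->]] [r [Ar ->]]; exists (q * r); rewrite hornerM.
  by split=> // i; rewrite coefM; apply: Asum => j _; exact: AM.
- move=> [q [Aq qE]]; apply: H; exists q; split=> //.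
  by rewrite -qE divff // pC_neq0.
Qed.

(** If [u = 1 - p a] had no inverse in [A], clearing denominators in [1 = p q(1 / u)] would give
    [u ^+ n = p d]. Since also [u ^+ n = 1 - p b], the sum [b + d] would be [1 / p]. *)
Lemma valring_unit a : A a -> A (1 - pC * a)^-1.
Proof.
move=> Aa; set u := 1 - _; apply: contrapT => nAu.
have Au : A u by apply: AB => //; apply: AM => //; exact: Anat.
have u0 : u != 0 by apply: contra_not_neq nAu => ->; rewrite invr0.
have uX n : exists2 b, A b & u ^+ n = 1 - pC * b.
  elim: n => [|n [b Ab bE]]; first by exists 0; rewrite // mulr0 subr0.
  exists (a + u * b); first by apply: AD => //; exact: AM.
  by rewrite exprS bE /u; ring.
have [q [Aq qE]] := adjoin_pinv nAu.
have [b Ab bE] := uX (size q).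
have [d Ad dE] : exists2 d, A d & u ^+ (size q) = pC * d.
  exists (\sum_(i < size q) q`_i * u ^+ (size q - i)).
    by apply: Asum => i _; apply: AM => //; exact: AX.
  have := congr1 (fun z => z * u ^+ size q) qE; rewrite mul1r => ->.
  rewrite -mulrA; congr (_ * _); rewrite horner_coef mulr_suml.
  apply: eq_bigr => i _; rewrite -mulrA; congr (_ * _).
  have -> : u ^+ size q = u ^+ i * u ^+ (size q - i) by rewrite -exprD subnKC // ltnW.
  by rewrite exprVn mulKf // expf_neq0.
apply: Ap; have -> : pC^-1 = b + d; last exact: AD.
apply: (mulfI pC_neq0); rewrite divff ?pC_neq0 // mulrDr -dE bE.
by rewrite addrC subrK.
Qed.

(** Since [1 - p r_0] is a unit by [valring_unit], the second relation times [x ^+ n] expresses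
    [x ^+ n] as [p] times a combination of lower powers. This is substituted in the leading term of
    [q]. *)
Lemma pinv_reduce x n (q r : {poly algC}) : x != 0 -> (0 < n)%N ->
  (size q <= n.+1)%N -> (size r <= n.+1)%N ->
  (forall i, A q`_i) -> (forall i, A r`_i) ->
  1 = pC * q.[x] -> 1 = pC * r.[x^-1] ->
  exists q' : {poly algC},
    [/\ (size q' <= n)%N, forall i, A q'`_i & 1 = pC * q'.[x]].
Proof.
move=> x0 n0 sq sr Aq Ar qE rE.
pose u := 1 - pC * r`_0.
have u0 : u != 0.
  apply/eqP => u0; apply: Ap.
  have -> : pC^-1 = r`_0; last exact: Ar.
  apply: (mulfI pC_neq0); rewrite divff ?pC_neq0 //.
  by apply/eqP; rewrite -subr_eq0 -/u u0.
have Aui : A u^-1 by exact: valring_unit.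
pose q' := \poly_(i < n) (q`_i + pC * q`_n * (r`_(n - i) / u)).
exists q'; split.
- exact: size_poly.
- move=> i; rewrite /q' coef_poly; case: ifP => // _.
  by apply: AD => //; do ?apply: AM => //; exact: Anat.
have rS : \sum_(i < n) r`_(n - i) / u * x ^+ i = x ^+ n / pC.
  have E : u = pC * \sum_(i < n) r`_(i.+1) * x^-1 ^+ i.+1.
    rewrite /u [X in X - _ = _]rE (horner_coef_wide _ sr) big_ord_recl.
    by rewrite expr0 mulr1 mulrDr addrC addKr.
  rewrite (reindex_inj rev_ord_inj) /=.
  have -> : x ^+ n / pC = x ^+ n * (\sum_(i < n) r`_(i.+1) * x^-1 ^+ i.+1) / u.
    set S := bigop _ _ _ in E *.
    have S0 : S != 0 by apply: contraNneq u0 => S0; rewrite E S0 mulr0.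
    by rewrite E invfM mulrACA -mulrA divff // mulr1.
  rewrite mulr_sumr mulr_suml; apply: eq_bigr => i _.
  rewrite subnA // subnn add0n mulrAC; congr (_ / _).
  rewrite mulrCA; congr (_ * _).
  have -> : x ^+ n = x ^+ (n - i.+1) * x ^+ i.+1 by rewrite -exprD subnK.
  by rewrite exprVn mulfK // expf_neq0.
apply: (etrans qE); congr (_ * _); rewrite (horner_coef_wide _ sq) big_ord_recr /=.
rewrite (horner_coef_wide _ (size_poly _ _)).
rewrite [RHS](eq_bigr (fun i : 'I_n => q`_i * x ^+ i +
   pC * q`_n * (r`_(n - i) / u * x ^+ i))); last first.
  by move=> i _; rewrite /q' coef_poly ltn_ord mulrDl !mulrA.
rewrite big_split /=; congr (_ + _); rewrite -mulr_sumr rS.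
by rewrite [pC * _]mulrC -!mulrA; congr (_ * _); rewrite mulrCA divff ?mulr1 // pC_neq0.
Qed.

(** Descent on the total degree of the two relations: [pinv_reduce] lowers the larger degree, and a
    relation of degree 0 says that [1 / p] is in [A]. *)
Lemma valring_total_aux N : forall x n m (q r : {poly algC}), (n + m <= N)%N ->
  x != 0 -> (size q <= n.+1)%N -> (size r <= m.+1)%N ->
  (forall i, A q`_i) -> (forall i, A r`_i) ->
  1 = pC * q.[x] -> 1 = pC * r.[x^-1] -> False.
Proof.
have H0 (q : {poly algC}) x : (size q <= 1)%N -> (forall i, A q`_i) ->
    1 = pC * q.[x] -> False.
  move=> /size1_polyC -> Aq; rewrite hornerC => E; apply: Ap.
  have -> : pC^-1 = q`_0.
    by apply: (mulfI pC_neq0); rewrite divff ?pC_neq0 // E coefC.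
  by have := Aq 0%N; rewrite coefC.
elim: N => [|N IH] x n m q r nm x0 sq sr Aq Ar qE rE.
  apply: (H0 q x) => //; apply: leq_trans sq _; lia.
case: n nm sq => [|n] nm sq; first exact: (H0 q x).
case: m nm sr => [|m] nm sr; first exact: (H0 r x^-1).
have [mn|nm'] := leqP m n.
  have [||q' [sq' Aq' q'E]] := @pinv_reduce x n.+1 q r x0 _ sq _ Aq Ar qE rE => //.
    by apply: leq_trans sr _; lia.
  by apply: (IH x n m.+1 q' r) => //; lia.
have [||||r' [sr' Ar' r'E]] := @pinv_reduce x^-1 m.+1 r q _ _ sr _ Ar Aq rE _ => //.
- by rewrite invr_eq0.
- by apply: leq_trans sq _; lia.
- by rewrite invrK.
by apply: (IH x n.+1 m q r') => //; lia.
Qed.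

Lemma valring_total x : A x \/ A x^-1.
Proof.
have [Ax|nAx] := pselect (A x); first by left.
right; apply: contrapT => nAxi.
have x0 : x != 0 by apply: contra_not_neq nAx => ->.
have [q [Aq qE]] := adjoin_pinv nAx; have [r [Ar rE]] := adjoin_pinv nAxi.
by apply: (@valring_total_aux _ x (size q) (size r) q r (leqnn _)).
Qed.

Definition vunit x := [/\ x != 0, A x & A x^-1].

Lemma vunitM x y : vunit x -> vunit y -> vunit (x * y).
Proof.
move=> [x0 Ax Axi] [y0 Ay Ayi].
by split; rewrite ?invfM ?mulf_neq0 //; exact: AM.
Qed.

Lemma vunitV x : vunit x -> vunit x^-1.
Proof. by move=> [x0 Ax Axi]; split; rewrite ?invrK ?invr_eq0. Qed.

Lemma vunitX x n : vunit x -> vunit (x ^+ n).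
Proof.
by move=> [x0 Ax Axi]; split; rewrite -?exprVn ?expf_neq0 //; exact: AX.
Qed.

Lemma vunitN1 : vunit (-1).
Proof. by split; rewrite ?invrN ?invr1 ?oppr_eq0 ?oner_eq0 //; exact: AN. Qed.

Lemma vunit_expp (k : int) : vunit (pC ^ k) -> k = 0.
Proof.
have H n : ~ A (pC ^- n.+1).
  move=> Hn; apply: Ap; have -> : pC^-1 = pC ^+ n * pC ^- n.+1.
    by rewrite exprS invfM mulrCA divff ?mulr1 // expf_neq0 ?pC_neq0.
  by apply: AM => //; apply: AX; exact: Anat.
by case: k => [[//|n]|n] [_ H1 H2]; case: (H n).
Qed.

(** By Bezout, [u m = 1 + v p], and the right side is invertible in [A] by [valring_unit]. *)
Lemma vunit_coprime m : coprime p m -> vunit m%:R.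
Proof.
move=> cpm; have m0 : (0 < m)%N.
  by rewrite lt0n; apply: contraTneq cpm => ->; rewrite /coprime gcdn0 neq_ltn prime_gt1 ?orbT.
split; [by rewrite pnatr_eq0 -lt0n | exact: Anat |].
have [u v uv _] := egcdnP p m0.
have E : (u * m = v * p + 1)%N by move: uv; rewrite gcdnC (eqP cpm).
have -> : m%:R^-1 = u%:R * (1 - pC * (- v%:R))^-1 :> algC.
  have -> : 1 - pC * (- v%:R) = u%:R * m%:R.
    by rewrite mulrN opprK -natrM E natrD natrM mulrC addrC.
  have u0 : (u%:R : algC) != 0.
    by rewrite pnatr_eq0; apply/eqP => u0; rewrite u0 mul0n addn1 in E.
  by rewrite invfM mulrA divff // mul1r.
by apply: AM; [exact: Anat | apply/valring_unit/AN/Anat].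
Qed.

Lemma vunit_nat n : (0 < n)%N -> vunit (n%:R * pC ^ (- (logn p n)%:Z)).
Proof.
move=> n0; have [m cpm nE] := pfactor_coprime pp n0.
rewrite {1}nE natrM natrX -mulrA exprnP -expfzDr ?pC_neq0 // subrr expr0z mulr1.
exact: vunit_coprime.
Qed.

Lemma vunit_rat (q : rat) : q != 0 -> vunit (ratr q *
  pC ^ ((logn p `|denq q|%N)%:Z - (logn p `|numq q|%N)%:Z)).
Proof.
move=> q0; rewrite /ratr expfzDr ?pC_neq0 //.
have n0 : (0 < `|numq q|)%N by rewrite absz_gt0 numq_eq0.
have d0 : (0 < `|denq q|)%N by rewrite absz_gt0 denq_neq0.
have -> : (numq q)%:~R / (denq q)%:~R *
    (pC ^ (logn p `|denq q|%N)%:Z * pC ^ (- (logn p `|numq q|%N)%:Z)) =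
   (-1) ^+ (numq q < 0)%R * (`|numq q|%N%:R * pC ^ (- (logn p `|numq q|%N)%:Z)) *
    (`|denq q|%N%:R * pC ^ (- (logn p `|denq q|%N)%:Z))^-1.
  have -> : (denq q)%:~R = `|denq q|%N%:R :> algC by rewrite -{1}absz_denq.
  have -> : (numq q)%:~R = (-1) ^+ (numq q < 0)%R * `|numq q|%N%:R :> algC.
    by rewrite {1}[numq q]intEsign rmorphM rmorphXn rmorphN.
  by rewrite invfM invr_expz opprK; ring.
apply: vunitM; last by apply/vunitV/vunit_nat.
by apply: vunitM; [apply: vunitX; exact: vunitN1 | exact: vunit_nat].
Qed.

Lemma nonunitD x y : A x -> A y -> ~ vunit x -> ~ vunit y -> ~ vunit (x + y).
Proof.
move=> Ax Ay nx ny; wlog xy : x y Ax Ay nx ny / A (x / y).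
  move=> H; have [xy|yx] := valring_total (x / y); first exact: H.
  by rewrite addrC; apply: H => //; rewrite invf_div in yx.
have [->|y0] := eqVneq y 0; first by rewrite addr0.
move=> [xy0 _ Axy]; apply: ny; split=> //.
have -> : y^-1 = (x / y + 1) * (x + y)^-1.
  by rewrite -[1](divff y0) -mulrDl mulrAC divff // mul1r.
by apply: AM => //; exact: AD.
Qed.

Lemma exists_dominant (I : eqType) (s : seq I) (f : I -> algC) : s != [::] ->
  (forall i, i \in s -> f i != 0) ->
  exists2 i, i \in s & forall j, j \in s -> A (f j / f i).
Proof.
elim: s => [//|i s IH] _ Hs; have [s0|s0] := eqVneq s [::].
  exists i; rewrite s0 ?mem_seq1 // => j; rewrite mem_seq1 => /eqP ->.
  by rewrite divff // Hs // mem_head.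
have [|k ks Hk] := IH s0; first by move=> j js; apply: Hs; rewrite inE js orbT.
have [ik|ki] := valring_total (f i / f k).
  by exists k; [rewrite inE ks orbT | move=> j; rewrite inE => /predU1P[->|/Hk]].
rewrite invf_div in ki.
exists i; first exact: mem_head.
have i0 : f i != 0 by apply: Hs; rewrite mem_head.
have k0 : f k != 0 by apply: Hs; rewrite inE ks orbT.
move=> j; rewrite inE => /predU1P[->|/Hk jk]; first by rewrite divff.
have -> : f j / f i = f j / f k * (f k / f i) by rewrite mulrA divfK.
exact: AM.
Qed.

(** The valuation of [x] is [- k / n] when that of [p] is 1, so the absolute value will be [p] to
    the power [k / n]. *)
Definition slope x n (k : int) := (0 < n)%N /\ vunit (x ^+ n * pC ^ k).

(* Two terms of a vanishing rational linear combination of powers of x have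
   the same valuation. *)
Lemma exists_slope x : x != 0 -> exists n k, slope x n k.
Proof.
move=> x0; have [q [_ mq qroot]] := minCpolyP x.
have qx : root (map_poly ratr q) x by rewrite qroot.
pose s := [seq i <- index_iota 0 (size q) | q`_i != 0].
pose f i : algC := ratr q`_i * x ^+ i.
have q0 : q != 0 by exact: monic_neq0.
have s0 : s != [::].
  have : ((size q).-1 \in s).
    rewrite mem_filter -lead_coefE lead_coef_eq0 q0 mem_index_iota /= prednK //.
    by rewrite size_poly_gt0.
  by case: s.
have f0 i : i \in s -> f i != 0.
  by rewrite mem_filter => /andP[qi _]; rewrite mulf_neq0 ?fmorph_eq0 // expf_neq0.
have [i si Hi] := exists_dominant s0 f0.
have us : uniq s by rewrite filter_uniq // iota_uniq.
have fsum : \sum_(j <- rem i s) f j / f i = -1.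
  have E : \sum_(j <- s) f j / f i = 1 + \sum_(j <- rem i s) f j / f i.
    by rewrite (big_rem i si) /= divff // f0.
  apply/eqP; rewrite -addr_eq0 addrC -E; apply/eqP.
  rewrite -mulr_suml [X in X / _](_ : _ = 0) ?mul0r //.
  rewrite big_filter big_mkcond /= -[RHS](rootP qx) horner_coef size_map_poly.
  rewrite big_mkord.
  apply: eq_bigr => j _; rewrite coef_map /=; case: eqP => // ->.
  by rewrite rmorph0 mul0r.
(* The quotients [f j / f i] with [j != i] lie in [A] and sum to -1, so they cannot all be
   nonunits. *)
have [j [js ji uj]] : exists j, [/\ j \in s, j != i & vunit (f j / f i)].
  apply: contrapT => H.
  have Hr j : j \in rem i s -> A (f j / f i) /\ ~ vunit (f j / f i).
    rewrite mem_rem_uniq // inE => /andP[ji js]; split; first exact: Hi.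
    by move=> u; apply: H; exists j.
  suff : A (\sum_(j <- rem i s) f j / f i) /\ ~ vunit (\sum_(j <- rem i s) f j / f i).
    by rewrite fsum => -[_]; apply; exact: vunitN1.
  rewrite big_seq; apply: (big_ind (fun z => A z /\ ~ vunit z)) => //.
    by split=> // -[]; rewrite eqxx.
  by move=> a b [Aa na] [Ab nb]; split; [exact: AD | exact: nonunitD].
wlog ij : i j si {Hi fsum} js ji uj / (i < j)%N.
  move=> H; have [ij|ij|ij] := ltngtP i j; first exact: (H i j).
    apply: (H j i) => //; first by rewrite eq_sym.
    by rewrite -invf_div; exact: vunitV.
  by rewrite ij eqxx in ji.
have nz k : k \in s -> q`_k != 0 by rewrite mem_filter => /andP[].
have [ui uj'] := (vunit_rat (nz i si), vunit_rat (nz j js)).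
move: ui uj'; set ki := (_ - _ : int); set kj := (_ - _ : int) => ui uj'.
exists (j - i)%N, (ki - kj); split; first by rewrite subn_gt0.
have -> : x ^+ (j - i) * pC ^ (ki - kj) =
   f j / f i * ((ratr q`_i * pC ^ ki) / (ratr q`_j * pC ^ kj)).
  have qi0 : (ratr q`_i : algC) != 0 by rewrite fmorph_eq0 nz.
  have qj0 : (ratr q`_j : algC) != 0 by rewrite fmorph_eq0 nz.
  have kj0 : pC ^ kj != 0 by rewrite expfz_neq0 // pC_neq0.
  have xi0 : x ^+ i != 0 by rewrite expf_neq0.
  have xj : x ^+ j = x ^+ (j - i) * x ^+ i by rewrite -exprD subnK // ltnW.
  rewrite /f expfzDr ?pC_neq0 // -invr_expz xj.
  by field; rewrite qi0 qj0 kj0 xi0.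
by apply: vunitM => //; apply: vunitM => //; exact: vunitV.
Qed.

Lemma slope_uniq x n k m l : x != 0 -> slope x n k -> slope x m l ->
  k * m%:Z = l * n%:Z.
Proof.
move=> x0 [n0 un] [m0 um]; apply/eqP; rewrite -subr_eq0; apply/eqP/vunit_expp.
have -> : pC ^ (k * m%:Z - l * n%:Z) =
   (x ^+ n * pC ^ k) ^+ m / (x ^+ m * pC ^ l) ^+ n.
  rewrite !exprMn -!exprM mulnC invfM expfzDr ?pC_neq0 // -invr_expz.
  rewrite -!exprz_exp -!exprnP mulrACA divff ?mul1r // expf_neq0 //.
by apply: vunitM; [|apply: vunitV]; exact: vunitX.
Qed.

Lemma slopeM x y n k m l : slope x n k -> slope y m l ->
  slope (x * y) (n * m) (k * m%:Z + l * n%:Z).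
Proof.
move=> [n0 un] [m0 um]; split; first by rewrite muln_gt0 n0.
have -> : (x * y) ^+ (n * m) * pC ^ (k * m%:Z + l * n%:Z) =
   (x ^+ n * pC ^ k) ^+ m * (y ^+ m * pC ^ l) ^+ n.
  rewrite !exprMn -!exprM [(m * n)%N]mulnC expfzDr ?pC_neq0 //.
  by rewrite -!exprz_exp -!exprnP; ring.
by apply: vunitM; exact: vunitX.
Qed.

Definition vabs x : R := if x == 0 then 0 else
  xget 0 [set r | exists n k, slope x n k /\ r = expR (k%:~R / n%:R * ln p%:R)]%classic.

Lemma vabs0 : vabs 0 = 0.
Proof. by rewrite /vabs eqxx. Qed.

Lemma vabsE x n k : x != 0 -> slope x n k ->
  vabs x = expR (k%:~R / n%:R * ln p%:R).
Proof.
move=> x0 xnk; rewrite /vabs (negPf x0).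
case: xgetP => [r _ [m [l [xml ->]]]|/(_ (expR (k%:~R / n%:R * ln p%:R)))]; last first.
  by case; exists n, k.
have [n0 m0] : (n%:R != 0 :> R) /\ (m%:R != 0 :> R).
  by rewrite !pnatr_eq0 -!lt0n; case: xnk; case: xml.
suff -> : l%:~R / m%:R = k%:~R / n%:R :> R by [].
apply/eqP; rewrite eqr_div //; apply/eqP.
by have := congr1 (intmul (1 : R)) (slope_uniq x0 xnk xml); rewrite !intrM => ->.
Qed.

Lemma lnp_gt0 : 0 < ln p%:R :> R.
Proof. by rewrite ln_gt0 // ltr1n prime_gt1. Qed.

Lemma vabs_gt0 x : x != 0 -> 0 < vabs x.
Proof.
by move=> x0; have [n [k H]] := exists_slope x0; rewrite (vabsE x0 H) expR_gt0.
Qed.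

Lemma vabsM x y : vabs (x * y) = vabs x * vabs y.
Proof.
have [->|x0] := eqVneq x 0; first by rewrite mul0r vabs0 mul0r.
have [->|y0] := eqVneq y 0; first by rewrite mulr0 vabs0 mulr0.
have [n [k Hx]] := exists_slope x0; have [m [l Hy]] := exists_slope y0.
rewrite (vabsE x0 Hx) (vabsE y0 Hy) (vabsE _ (slopeM Hx Hy)) ?mulf_neq0 //.
rewrite -expRD -mulrDl; have [n0 m0] : (n%:R != 0 :> R) /\ (m%:R != 0 :> R).
  by rewrite !pnatr_eq0 -!lt0n; case: Hx; case: Hy.
suff -> : (k * m%:Z + l * n%:Z)%:~R / (n * m)%:R = k%:~R / n%:R + l%:~R / m%:R :> R by [].
by rewrite natrM intrD !intrM -!pmulrn; field; rewrite n0 m0.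
Qed.

Lemma vabs_le1 x : vabs x <= 1 <-> A x.
Proof.
have [->|x0] := eqVneq x 0; first by rewrite vabs0 ler01.
have [n [k H]] := exists_slope x0; rewrite (vabsE x0 H) -[leRHS]expR0 ler_expR.
rewrite pmulr_lle0 ?lnp_gt0 // pmulr_lle0 ?invr_gt0 ?ltr0n; last by case: H.
rewrite lerz0; case: H => n0 [_ Hu Hui]; split.
  move=> k0; have Axn : A (x ^+ n).
    have -> : x ^+ n = x ^+ n * pC ^ k * pC ^ (- k).
      by rewrite -mulrA -expfzDr ?pC_neq0 // subrr expr0z mulr1.
    by apply: AM => //; rewrite -(lez0_abs k0) -exprnP; apply: AX; exact: Anat.
  (* Valuation rings are integrally closed: if [x^-1] is in [A], so is [x], by the equation
     below. *)
  have [//|Axi] := valring_total x.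
  have -> : x = x ^+ n * x^-1 ^+ n.-1.
    by case: n n0 {Hu Hui Axn} => // n _; rewrite exprS exprVn mulfK // expf_neq0.
  by apply: AM => //; exact: AX.
move=> Ax; rewrite leNgt; apply/negP.
case: k Hu Hui => [[|k]|k] // Hu Hui _; apply: Ap.
have xp0 : x ^+ n != 0 /\ pC ^+ k != 0 by rewrite !expf_neq0 ?pC_neq0.
have -> : pC^-1 = x ^+ n * pC ^+ k * (x ^+ n * pC ^ k.+1)^-1.
  by rewrite -exprnP exprS; field; case: xp0 => -> ->; rewrite pC_neq0.
by apply: AM => //; apply: AM; apply: AX => //; exact: Anat.
Qed.

Lemma vabs_ultra x y : vabs (x + y) <= Num.max (vabs x) (vabs y).
Proof.
wlog xy : x y / vabs x <= vabs y.
  move=> H; have [xy|xy] := boolP (vabs x <= vabs y); first exact: H.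
  by rewrite maxC addrC; apply: H; rewrite -ltNge in xy; exact: ltW.
rewrite maxEle xy; have [y0|y0] := eqVneq y 0.
  by rewrite y0 addr0 -y0.
have -> : x + y = y * (x / y + 1) by rewrite mulrDr mulr1 mulrC divfK.
rewrite vabsM; apply: ler_piMr; first by rewrite ltW ?vabs_gt0.
apply/vabs_le1; apply: AD => //; apply/vabs_le1.
rewrite -(ler_pM2l (vabs_gt0 y0)) -vabsM mulr1 mulrC divfK //.
Qed.

Lemma absval_vabs : absval vabs.
Proof.
have ge0 x : 0 <= vabs x.
  by have [->|/vabs_gt0/ltW//] := eqVneq x 0; rewrite vabs0.
split=> //; first 1 last; first exact: vabsM.
- move=> x y; apply: le_trans (vabs_ultra _ _) _.
  by rewrite ge_max lerDl lerDr !ge0.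
- move=> x; split=> [|->]; last exact: vabs0.
  by apply: contra_eq => /vabs_gt0; rewrite lt0r => /andP[].
Qed.

Lemma vabs_rat (q : rat) : vabs (ratr q) = padic_abs R p q.
Proof.
rewrite /padic_abs; case: eqP => [->|/eqP q0]; first by rewrite rmorph0 vabs0.
have u := vunit_rat q0; set k := (_ - _ : int) in u *.
have sl : slope (ratr q) 1 k by split.
rewrite (vabsE _ sl) ?fmorph_eq0 // divr1.
have p0 : 0 < p%:R :> R by rewrite ltr0n prime_gt0.
case: k {u sl} => n.
  by rewrite -pmulrn expRM_natl lnK // posrE.
by rewrite NegzE mulrNz mulNr expRN -pmulrn expRM_natl lnK // posrE.
Qed.

End ValuationRing.

Lemma padic_place : exists w : algC -> R, [/\ absval w,
  forall x y, w (x + y) <= Num.max (w x) (w y) &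
  forall q : rat, w (ratr q) = padic_abs R p q].
Proof.
have [A [sA Amax]] := exists_maximal_subring.
exists (vabs A); split.
- exact: absval_vabs.
- exact: vabs_ultra.
- exact: vabs_rat.
Qed.

End PadicPlace.

(** * The archimedean absolute value of algC *)

Section ArchimedeanPlace.
Variable R : realType.

(* algC need not embed into R, so the modulus of z is transported through the
   cut that it makes in the rationals. *)
Definition cabs (z : algC) : R :=
  sup [set r | exists2 q : rat, ratr q <= `|z| & r = ratr q]%classic.

Lemma cabs_cmp (z : algC) (q : rat) : ratr q <= `|z| \/ `|z| <= ratr q.
Proof.
have rq : (ratr q : algC) \is Num.real by rewrite Creal_Crat // Crat_rat.
by have [|/ltW] := real_leP rq (normr_real z); auto.
Qed.

Lemma cabs_has_sup (z : algC) :
  has_sup [set r : R | exists2 q : rat, ratr q <= `|z| & r = ratr q]%classic.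
Proof.
split; first by exists 0, 0; rewrite ?rmorph0.
exists (Num.bound `|z|)%:R => _ [q qz ->].
rewrite -(ratr_nat R) ler_rat -(ler_rat algC) ratr_nat.
by apply: le_trans qz _; apply/ltW/archi_boundP.
Qed.

Lemma cabs_lower (z : algC) (q : rat) : ratr q <= `|z| -> ratr q <= cabs z.
Proof. by move=> qz; apply: (ub_le_sup (cabs_has_sup z).2); exists q. Qed.

Lemma cabs_upper (z : algC) (q : rat) : `|z| <= ratr q -> cabs z <= ratr q.
Proof.
move=> zq; apply: ge_sup; first exact: (cabs_has_sup z).1.
by move=> _ [r rz ->]; rewrite ler_rat -(ler_rat algC) (le_trans rz).
Qed.

Lemma cabs_lt_norm (z : algC) (q : rat) : cabs z < ratr q -> `|z| <= ratr q.
Proof. by move=> h; have [/cabs_lower|//] := cabs_cmp z q; rewrite leNgt h. Qed.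

Lemma norm_lt_cabs (z : algC) (q : rat) : ratr q < cabs z -> ratr q <= `|z|.
Proof. by move=> h; have [//|/cabs_upper] := cabs_cmp z q; rewrite leNgt h. Qed.

Lemma rat_between (a b : R) : a < b -> exists2 q : rat, a < ratr q & ratr q < b.
Proof. by move=> /rat_in_itvoo[q]; rewrite in_itv /= => /andP[]; exists q. Qed.

Lemma cabs_ge0 z : 0 <= cabs z.
Proof. by rewrite -[0](rmorph0 ratr); apply: cabs_lower; rewrite rmorph0. Qed.

Lemma cabs_gt0 (z : algC) : z != 0 -> 0 < cabs z.
Proof.
move=> z0; have nz : 0 < `|z| by rewrite normr_gt0.
pose n := Num.bound `|z|^-1.
have zn : `|z|^-1 < n%:R by apply: archi_boundP; rewrite invr_ge0.
have n0 : (0 : algC) < n%:R by apply: lt_trans zn; rewrite invr_gt0.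
apply: (@lt_le_trans _ _ (ratr (n%:R^-1))).
  by rewrite fmorphV /= ratr_nat invr_gt0 ltr0n -(ltr0n algC).
apply: cabs_lower; rewrite fmorphV /= ratr_nat -[leRHS]invrK lef_pV2 ?posrE ?invr_gt0 //.
exact: ltW.
Qed.

Lemma cabs_ratr (q : rat) : cabs (ratr q) = `|ratr q|.
Proof.
have E (S : numFieldType) : `|ratr q : S| = ratr `|q|.
  by rewrite -ratr_norm.
by apply/eqP; rewrite eq_le E cabs_upper ?cabs_lower // E.
Qed.

Lemma cabsD x y : cabs (x + y) <= cabs x + cabs y.
Proof.
rewrite leNgt; apply/negP => h.
pose d := (cabs (x + y) - (cabs x + cabs y)) / 2.
have [|a xa ad] := @rat_between (cabs x) (cabs x + d); first by rewrite /d; lra.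
have [|b yb bd] := @rat_between (cabs y) (cabs y + d); first by rewrite /d; lra.
have : cabs (x + y) <= ratr (a + b).
  apply: cabs_upper; rewrite rmorphD; apply: le_trans (ler_normD _ _) _.
  by apply: lerD; apply: cabs_lt_norm.
by rewrite rmorphD /= => h'; move: ad bd h'; rewrite /d; lra.
Qed.

Lemma cabsM_le x y : cabs (x * y) <= cabs x * cabs y.
Proof.
rewrite leNgt; apply/negP => h.
set X := cabs x in h *; set Y := cabs y in h *; set T := cabs _ in h.
have [X0 Y0] : 0 <= X /\ 0 <= Y by rewrite !cabs_ge0.
have s0 : 0 < X + Y + 1 by rewrite ltr_wpDl // addr_ge0.
(* As [d <= 1], [(X + d) * (Y + d)] is at most [X * Y + d * (X + Y + 1)], hence at most [T]. *)
pose d := Num.min 1 ((T - X * Y) / (X + Y + 1)).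
have d0 : 0 < d by rewrite lt_min ltr01 divr_gt0 // subr_gt0.
have [|a xa ad] := @rat_between X (X + d); first by rewrite ltrDl.
have [|b yb bd] := @rat_between Y (Y + d); first by rewrite ltrDl.
have : T <= ratr (a * b).
  apply: cabs_upper; rewrite normrM rmorphM /=.
  by apply: ler_pM => //; apply: cabs_lt_norm.
rewrite rmorphM /=; apply/negP; rewrite -ltNge.
have d1 : d <= 1 by rewrite ge_min lexx.
have dT : d * (X + Y + 1) <= T - X * Y by rewrite -ler_pdivlMr // ge_min lexx orbT.
apply: (@lt_le_trans _ _ ((X + d) * (Y + d))); last by nra.
by apply: ltr_pM => //; apply: ltW; [apply: le_lt_trans xa|apply: le_lt_trans yb].
Qed.

(** Applied to [x = (x * y) * y^-1], it turns submultiplicativity into multiplicativity. *)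
Lemma cabsV_le y : y != 0 -> cabs y * cabs y^-1 <= 1.
Proof.
move=> y0; have Y0 := cabs_gt0 y0; rewrite mulrC -ler_pdivlMr // mul1r leNgt.
apply/negP => /rat_between[c c1 c2].
have c0 : 0 < (ratr c : R) by apply: lt_trans c1; rewrite invr_gt0.
have c0' : (0 : algC) < ratr c by rewrite ltr0q -(ltr0q R).
have : cabs y <= ratr c^-1.
  apply: cabs_upper; have := norm_lt_cabs c2.
  by rewrite normfV => h; rewrite fmorphV /= -[leLHS]invrK lef_pV2 ?posrE ?invr_gt0 ?normr_gt0.
by apply/negP; rewrite -ltNge fmorphV /= invf_plt // posrE.
Qed.

Lemma absval_cabs : absval cabs.
Proof.
split.
- exact: cabs_ge0.
- move=> x; split=> [|->].
    by apply: contra_eq => /cabs_gt0; rewrite lt0r => /andP[].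
  by have := cabs_ratr 0; rewrite !rmorph0 normr0.
- move=> x y; apply/eqP; rewrite eq_le cabsM_le /=.
  have [->|y0] := eqVneq y 0.
    have := cabs_ratr 0; rewrite !rmorph0 normr0 => E.
    by rewrite mulr0 E mulr0.
  have Y0 := cabs_gt0 y0.
  have := cabsM_le (x * y) y^-1; rewrite mulfK // => h.
  have := cabsV_le y0; have := cabs_ge0 (x * y); have := cabs_ge0 y^-1.
  set Z := cabs y^-1 in h *; set Y := cabs y in Y0 *; set T := cabs (x * y) in h *.
  move=> Z0 T0 YZ; apply: (@le_trans _ _ (T * Z * Y)); first by rewrite ler_wpM2r // ltW.
  by rewrite -mulrA ler_piMr // mulrC.
- exact: cabsD.
Qed.

End ArchimedeanPlace.

(** * Absolute values of algC above a place of the rationals *)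

Section PlacesOfAlgC.
Variable R : realType.

Definition is_qidx (i : nat) := (i == 0)%N || prime i.

(* Absolute values of algC over the place i of the rationals, where i = 0
   stands for the archimedean place *)
Definition over_qplace (i : nat) (u : algC -> R) : Prop :=
  if (i == 0)%N then absval u /\ forall q : rat, u (ratr q) = `|ratr q|
  else [/\ absval u, forall x y, u (x + y) <= Num.max (u x) (u y)
        & forall q : rat, u (ratr q) = padic_abs R i q].

Definition qplace (i : nat) : algC -> R := xget (cabs R) (over_qplace i).

Lemma qplaceP i : is_qidx i -> over_qplace i (qplace i).
Proof.
move=> ip; rewrite /qplace; case: xgetP => // H; exfalso; move: ip.
rewrite /is_qidx; case: eqP => [i0 _|/eqP i0 /= pi].
  apply: (H (cabs R)); rewrite i0 /over_qplace eqxx.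
  by split; [exact: absval_cabs | exact: cabs_ratr].
have [w [aw uw rw]] := @padic_place R i pi.
by apply: (H w); rewrite /over_qplace (negPf i0).
Qed.

Lemma over_qplace_absval i u : over_qplace i u -> absval u.
Proof. by rewrite /over_qplace; case: ifP => _ []. Qed.

(** The conjugates of [qplace i] are again over [i], but in general differ from it. This is why
    local estimates are made for every function satisfying [over_qplace]. *)
Lemma over_qplace_aut i u (nu : {rmorphism algC -> algC}) :
  over_qplace i u -> over_qplace i (u \o nu).
Proof.
rewrite /over_qplace; case: ifP => _ [au]; last first.
  move=> uu ur; split=> [|x y|q] /=; [exact: absval_comp au | | by rewrite fmorph_rat].
  by rewrite rmorphD.
by move=> ur; split=> [|q] /=; [exact: absval_comp au | rewrite fmorph_rat].
Qed.

Definition qabs (i : nat) (q : rat) : R :=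
  if (i == 0)%N then `|ratr q| else padic_abs R i q.

Lemma over_qplace_ratr i u q : over_qplace i u -> u (ratr q) = qabs i q.
Proof. by rewrite /over_qplace /qabs; case: ifP => _ []. Qed.

Lemma padic_abs_p p : prime p -> padic_abs R p p%:R = p%:R^-1.
Proof.
move=> pp; rewrite /padic_abs pnatr_eq0 -[(p == 0)%N]negbK -lt0n prime_gt0 //=.
have -> : numq p%:R = p%:Z by rewrite pmulrn numq_int.
have -> : denq p%:R = 1 by rewrite pmulrn denq_int.
by rewrite absz_nat /= logn1 sub0r logn_prime // eqxx exprN1.
Qed.

Lemma qabs_large i : is_qidx i -> exists c : rat, 1 < qabs i c.
Proof.
move=> qi; have H := qplaceP qi; have ai := over_qplace_absval H.
move: (qi); rewrite /is_qidx; case: eqP => [i0 _|/eqP i0 /= pi].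
  by exists 2; rewrite /qabs i0 eqxx ratr_nat normr_nat ltr1n.
exists i%:R^-1; rewrite -(over_qplace_ratr _ H) fmorphV (absvV ai) /=.
rewrite (over_qplace_ratr _ H) /qabs (negPf i0) padic_abs_p // invrK.
by rewrite ltr1n prime_gt1.
Qed.

Lemma padic_abs_prime p l : prime p -> prime l -> p != l -> padic_abs R p l%:R = 1.
Proof.
move=> pp pl npl; rewrite /padic_abs pnatr_eq0 -[(l == 0)%N]negbK -lt0n prime_gt0 //=.
have -> : numq l%:R = l%:Z by rewrite pmulrn numq_int.
have -> : denq l%:R = 1 by rewrite pmulrn denq_int.
by rewrite absz_nat /= logn1 sub0r logn_prime // (negPf npl) expr0z.
Qed.

Lemma qabs_inj i j : is_qidx i -> is_qidx j -> qabs i =1 qabs j -> i = j.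
Proof.
rewrite /is_qidx /qabs.
have H p : prime p -> (p%:R^-1 : R) < 1.
  by move=> pp; rewrite invf_lt1 ?ltr1n ?ltr0n ?prime_gt0 ?prime_gt1.
case: eqP => [->|_] /=; case: eqP => [->|_] //=.
- by move=> _ pj /(_ j%:R); rewrite padic_abs_p // ratr_nat normr_nat => E;
    have := H j pj; rewrite -E ltNge ler1n prime_gt0.
- by move=> pj _ /(_ i%:R); rewrite padic_abs_p // ratr_nat normr_nat => E;
    have := H i pj; rewrite E ltNge ler1n prime_gt0.
move=> pi pj E; apply/eqP/negPn/negP => ij.
have := E i%:R; rewrite padic_abs_p // padic_abs_prime // 1?eq_sym // => E'.
by have := H i pi; rewrite E' ltxx.
Qed.

Lemma ultra_sum (u : algC -> R) (I : Type) (s : seq I) (f : I -> algC) (b : R) :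
  u 0 = 0 -> (forall x y, u (x + y) <= Num.max (u x) (u y)) -> 0 <= b ->
  (forall i, u (f i) <= b) -> u (\sum_(i <- s) f i) <= b.
Proof.
move=> u0 uu b0 H; elim: s => [|i s IH]; first by rewrite big_nil u0.
by rewrite big_cons; apply: le_trans (uu _ _) _; rewrite ge_max H.
Qed.

Lemma padic_abs_le1 p (q : rat) : prime p -> ~~ (p %| `|denq q|)%N ->
  padic_abs R p q <= 1.
Proof.
move=> pp pq; rewrite /padic_abs; case: ifP => [_|_]; first exact: ler01.
have -> : logn p `|denq q| = 0%N.
  by apply/eqP; rewrite -leqn0 leqNgt -pfactor_dvdn ?absz_gt0 ?denq_neq0 ?expn1.
by rewrite sub0r -invr_expz -exprnP invf_le1 ?exprn_ege1 ?ler1n ?exprn_gt0 ?ltr0n ?prime_gt0.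
Qed.

(** For [p] larger than the product of the denominators of the minimal polynomial, its coefficients
    have value at most 1; if [u a > 1], the leading term would exceed all the others. *)
Lemma almost_integral (a : algC) : exists m, forall p u, (m < p)%N -> prime p ->
  over_qplace p u -> u a <= 1.
Proof.
have [q [_ mq qroot]] := minCpolyP a.
have qa : root (map_poly ratr q) a by rewrite qroot.
exists (\prod_(i < size q) `|denq q`_i|)%N => p u mp pp.
rewrite /over_qplace; case: eqP => [p0|_]; first by rewrite p0 in pp.
move=> [au uu ur]; rewrite leNgt; apply/negP => ua.
have q0 : q != 0 by exact: monic_neq0.
have sq : (0 < size q)%N by rewrite size_poly_gt0.
have u1 i : u (ratr q`_i) <= 1.
  rewrite ur; have [iq|qi] := ltnP i (size q); last first.
    by rewrite nth_default // /padic_abs eqxx ler01.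
  apply: padic_abs_le1 => //; apply/negP => /dvdn_leq.
  rewrite absz_gt0 denq_neq0 => /(_ isT); apply/negP; rewrite -ltnNge.
  apply: leq_ltn_trans mp; rewrite (bigD1 (Ordinal iq)) //= leq_pmulr //.
  by rewrite prodn_gt0 // => j; rewrite absz_gt0 denq_neq0.
have E : a ^+ (size q).-1 = - \sum_(i < (size q).-1) ratr q`_i * a ^+ i.
  apply/eqP; rewrite -addr_eq0; apply/eqP; rewrite -[RHS](rootP qa).
  rewrite horner_coef size_map_poly -[in RHS](prednK sq) big_ord_recr /= addrC.
  rewrite coef_map /= -lead_coefE (monicP mq) rmorph1 mul1r; congr (_ + _).
  by apply: eq_bigr => i _; rewrite coef_map.
have a0 : a != 0 by rewrite -(absv_gt0 au) (lt_trans _ ua).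
case sz : (size q).-1 E => [|n] E.
  by move: E; rewrite expr0 big_ord0 oppr0 => /eqP; rewrite oner_eq0.
have : u (a ^+ n.+1) <= u a ^+ n.
  rewrite E absvN //; apply: ultra_sum => //; rewrite ?absv0 ?exprn_ge0 ?absv_ge0 //.
  move=> i; rewrite (absvM au) (absvX au); apply: le_trans (_ : 1 * u a ^+ i <= _).
    by rewrite ler_wpM2r // exprn_ge0 // absv_ge0.
  by rewrite mul1r ler_weXn2l ?ltW // -ltnS.
by rewrite (absvX au) exprS ger_pMl ?exprn_gt0 ?absv_gt0 // leNgt ua.
Qed.

End PlacesOfAlgC.

(** * Heights as products over embeddings *)

Section Embeddings.

(** The image of [e] is a field that contains the images of the generators of K, hence the image of
    [k]; [iota] is [k] followed by the inverse of [e]. *)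
Lemma embedding_lift (E K : fieldExtType rat) (e : {rmorphism E -> algC})
    (k : {rmorphism K -> algC}) (s : seq K) :
  <<1 & s>>%VS = fullv -> (forall a, a \in s -> exists b, e b = k a) ->
  exists iota : {rmorphism K -> E}, forall u, e (iota u) = k u.
Proof.
move=> gen Hs.
have Hin u : exists b, e b = k u.
  have: u \in <<1 & s>>%VS by rewrite gen memvf.
  elim/last_ind: s {gen} Hs u => [|s a IH] Hs u.
    by rewrite Fadjoin_nil => /vlineP[q ->]; exists q%:A; rewrite !alg_num_field !fmorph_rat.
  rewrite adjoin_rcons => /Fadjoin_polyP[p ps ->].
  have {}IH : forall v, v \in <<1 & s>>%VS -> exists b, e b = k v.
    by apply: IH => b bs; apply: Hs; rewrite mem_rcons inE bs orbT.
  have [|b bE] := Hs a; first by rewrite mem_rcons mem_head.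
  have /fin_all_exists[f fE] (i : 'I_(size p)) : exists c, e c = k p`_i.
    by apply: IH; exact: (polyOverP ps).
  exists (\sum_(i < size p) f i * b ^+ i); rewrite horner_coef !rmorph_sum.
  by apply: eq_bigr => i _; rewrite !rmorphM !rmorphXn /= fE bE.
have [f fE] := choice Hin.
have fZ : zmod_morphism f.
  by move=> x y; apply: (fmorph_inj e); rewrite rmorphB /= !fE rmorphB.
have fM : monoid_morphism f.
  by split=> [|x y]; apply: (fmorph_inj e); rewrite ?rmorph1 ?rmorphM /= !fE ?rmorph1 ?rmorphM.
pose F : {rmorphism K -> E} := HB.pack f (GRing.isZmodMorphism.Build K E f fZ)
  (GRing.isMonoidMorphism.Build K E f fM).
by exists F.
Qed.

(** [E] is generated by all the roots of the product of the minimal polynomials, which makes it a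
    splitting field. *)
Lemma splitting_field_exists (s : seq algC) :
  exists (E : splittingFieldType rat) (e : {rmorphism E -> algC}),
    forall a, a \in s -> exists b, e b = a.
Proof.
have Hmin a := minCpolyP a.
pose P : {poly rat} := \prod_(a <- s) sval (Hmin a).
have [rs rsE] := closed_field_poly_normal (map_poly ratr P : {poly algC}).
have Pm : P \is monic by apply: monic_prod => a _; case: (Hmin a) => p [].
have {}rsE : map_poly ratr P = \prod_(z <- rs) ('X - z%:P) :> {poly algC}.
  by rewrite rsE (monicP (monic_map _ Pm)) scale1r.
have [L [l [t tE gent]]] := num_field_exists rs.
have split : splittingFieldFor 1 (map_poly (in_alg L) P) {:L}.
  exists t => //; rewrite -(eqp_map l).
  have -> : map_poly l (map_poly (in_alg L) P) = map_poly ratr P.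
    by rewrite -map_poly_comp; apply: eq_map_poly => q; rewrite /= alg_num_field fmorph_rat.
  rewrite rsE -tE big_map rmorph_prod /=.
  rewrite [X in _ %= X](eq_bigr (fun i => 'X - (l i)%:P)) ?eqpxx // => i _.
  by rewrite rmorphB /= map_polyX map_polyC.
have L_ax : FieldExt_isSplittingField _ L.
  by constructor; exists (map_poly (in_alg L) P) => //; apply/polyOver1P; exists P.
pose E : splittingFieldType rat := HB.pack L L_ax.
exists E, l => a sa.
have : a \in rs.
  rewrite -root_prod_XsubC -rsE /P (big_rem a) //= rmorphM rootM.
  by case: (Hmin a) => p /= [pE _ _]; rewrite -pE root_minCpoly.
by rewrite -tE => /mapP[b _ ->]; exists b.
Qed.

End Embeddings.

Section LocalNorm.
Variable R : realType.

(** The local height without its exponent. The square root makes both cases homogeneous of degree 1,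
    so that both receive the same exponent [d_v / d]. *)
Definition lnorm (I : finType) (F : Type) (arch : bool) (w : F -> R) (x : I -> F) : R :=
  if arch then Num.sqrt (\sum_i w (x i) ^+ 2) else \big[Num.max/0]_i w (x i).

Lemma lnorm_ge0 (I : finType) (F : Type) arch (w : F -> R) (x : I -> F) :
  (forall u, 0 <= w u) -> 0 <= lnorm arch w x.
Proof.
move=> w0; rewrite /lnorm; case: arch; first exact: sqrtr_ge0.
by elim/big_rec: _ => // i y _ y0; rewrite le_max w0.
Qed.

Lemma max_powR (I : finType) (f : I -> R) (c : R) : (forall i, 0 <= f i) -> 0 < c ->
  \big[Num.max/0]_i (f i `^ c) = (\big[Num.max/0]_i f i) `^ c.
Proof.
move=> f0 c0.
suff [] : 0 <= \big[Num.max/0]_i f i /\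
  \big[Num.max/0]_i (f i `^ c) = (\big[Num.max/0]_i f i) `^ c by [].
elim/big_rec2: _ => [|i y z _ [z0 ->]]; first by rewrite powR0 // gt_eqF.
split; first by rewrite le_max f0.
have [h|/ltW h] := leP (f i) z.
  by rewrite max_r // ge0_ler_powR // ?nnegrE // ltW.
by rewrite max_l // ge0_ler_powR // ?nnegrE // ltW.
Qed.

End LocalNorm.

Section HeightFormula.
Variables (R : realType) (E : splittingFieldType rat) (e : {rmorphism E -> algC}).
Variables (K : fieldExtType rat) (iota : {rmorphism K -> E}).
Implicit Types g h : gal_of {:E}.

Definition vv i g : K -> R := fun u => qplace R i (e (g (iota u))).

Lemma vv_alg i g q : is_qidx i -> vv i g q%:A = qabs R i q.
Proof.
by move=> qi; rewrite /vv iota_alg gal_alg alg_num_field fmorph_rat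
  (over_qplace_ratr _ (qplaceP R qi)).
Qed.

Lemma absval_qplace_e i : is_qidx i -> absval (qplace R i \o e).
Proof. by move=> qi; apply: absval_comp (over_qplace_absval (qplaceP R qi)). Qed.

Lemma absval_vv i g : is_qidx i -> absval (vv i g).
Proof. by move=> qi; exact: (absval_comp (g \o iota) (absval_qplace_e qi)). Qed.

Lemma vv_inj i j g h : is_qidx i -> is_qidx j -> vv i g = vv j h -> i = j.
Proof.
move=> qi qj E'; apply: (@qabs_inj R) => // q.
by rewrite -(vv_alg g q qi) -(vv_alg h q qj) E'.
Qed.

Lemma qplace_e_large i : is_qidx i -> exists c : rat, 1 < (qplace R i \o e) c%:A.
Proof.
move=> qi; have [c c1] := qabs_large R qi; exists c.
by rewrite /= alg_num_field fmorph_rat (over_qplace_ratr _ (qplaceP R qi)).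
Qed.

Lemma placesP (v : K -> R) :
  places v <-> exists i g, is_qidx i /\ v = vv i g.
Proof.
split=> [[av vp]|[i [g [qi ->]]]].
  have [i [qi vq]] : exists i, is_qidx i /\ forall q : rat, v q%:A = qabs R i q.
    case: vp => [va|[p [pp vq]]]; first by exists 0%N.
    exists p; rewrite /is_qidx pp orbT; split=> // q; rewrite vq /qabs.
    by rewrite -[(p == 0)%N]negbK -lt0n prime_gt0.
  have [c c1] := qplace_e_large qi.
  have [|g gS] := absval_conjugate iota (absval_qplace_e qi) c1 av.
    move=> q; rewrite vq /= alg_num_field fmorph_rat.
    by rewrite (over_qplace_ratr _ (qplaceP R qi)).
  exists i, g; split=> //; apply/funext => u.
  by rewrite -(over_placeP _ _ _ _ gS u).
split; first exact: absval_vv.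
move: (qi); rewrite /is_qidx; case: eqP => [i0 _|/eqP i0 /= pi].
  by left => q; rewrite vv_alg // /qabs i0 eqxx.
by right; exists i; split=> // q; rewrite vv_alg // /qabs (negPf i0).
Qed.

Lemma archimedean_vv i g : is_qidx i -> `[< archimedean (vv i g) >] = (i == 0%N).
Proof.
move=> qi; apply/asboolP/eqP => [H|i0 q].
  by apply: (@qabs_inj R) => // q; rewrite -(vv_alg g q qi) H.
by rewrite vv_alg // i0 /qabs eqxx.
Qed.

(** The exponent [d_v / d] is the number of automorphisms that induce [v] divided by the order of
    the group, so each of them receives the inverse of that order. *)
Lemma local_height_vv (I : finType) (y : I -> K) i g : is_qidx i ->
  local_height (vv i g) y =
  \prod_(h | vv i h == vv i g) lnorm (i == 0%N) (vv i h) y `^ #|{: gal_of {:E}}|%:R^-1.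
Proof.
move=> qi; have [c c1] := qplace_e_large qi; have [t gent] := primitive_element K.
have gS : g \in over_place iota (qplace R i \o e) (vv i g) by exact/over_placeP.
have := local_degree_count gent (absval_qplace_e qi) c1 gS.
set d := local_degree _; set G := #|{: gal_of {:E}}|; set S := #|_| => dE.
have G0 : (0 < G)%N by apply/card_gt0P; exists 1%g.
have S0 : (0 < S)%N by apply/card_gt0P; exists g.
have D0 : (0 < degree K)%N := adim_gt0 {:K}%AS.
have d0 : (0 < d)%N by move: dE; case: (d) => // /esym/eqP; rewrite mul0n muln_eq0 !gtn_eqF.
have rE : d%:R / (degree K)%:R = G%:R^-1 * S%:R :> R.
  apply/eqP; rewrite mulrC -[G%:R^-1 * _]mulrC eq_sym -[X in _ == X]mulrC eqr_div ?pnatr_eq0 -?lt0n //.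
  by rewrite -!natrM dE mulnC.
have r0 : 0 < d%:R / (degree K)%:R :> R by rewrite divr_gt0 // ltr0n.
have av := absval_vv g qi.
transitivity (lnorm (i == 0%N) (vv i g) y `^ (d%:R / (degree K)%:R)).
  rewrite /local_height archimedean_vv // /lnorm; case: ifP => _; last first.
    by rewrite -max_powR // => j; exact: absv_ge0.
  rewrite -powR12_sqrt; last by apply: sumr_ge0 => j _; exact: sqr_ge0.
  by rewrite -powRrM -/d invfM mulrCA.
rewrite rE powRrM powR_mulrn ?powR_ge0 //.
rewrite (eq_bigr (fun=> lnorm (i == 0%N) (vv i g) y `^ G%:R^-1)); last first.
  by move=> h /eqP ->.
rewrite prodr_const; congr (_ ^+ _); apply: eq_card => h.
have -> : (h \in over_place iota (qplace R i \o e) (vv i g)) = (vv i h == vv i g).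
  apply/over_placeP/eqP => [H|H u]; first exact/funext.
  by rewrite -[RHS]/(vv i g u) -H.
by [].
Qed.

(* Each factor of the height is a product over the embeddings of K above a
   fixed place of Q *)
Lemma field_height_vv (I : finType) (y : I -> K) (B : nat) :
  (forall i g, is_qidx i -> (B <= i)%N -> lnorm (i == 0%N) (vv i g) y = 1) ->
  field_height R y = \prod_(i < B | is_qidx i) \prod_(g : gal_of {:E})
     lnorm (i == 0%N :> nat) (vv i g) y `^ #|{: gal_of {:E}}|%:R^-1.
Proof.
move=> HB; pose G := {: gal_of {:E}}.
pose F i g := lnorm (i == 0%N) (vv i g) y `^ #|G|%:R^-1.
pose s := [seq p <- [seq (i, g) | i <- index_iota 0 B, g <- enum G] | is_qidx p.1].
pose T := undup [seq vv p.1 p.2 | p <- s].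
have TP v : v \in T -> exists i g, [/\ is_qidx i, (i < B)%N & v = vv i g].
  rewrite mem_undup => /mapP[[i g]]; rewrite mem_filter /= => /andP[qi].
  move=> /allpairsP[[i' g'] /= [iB _ [iE gE]]] ->; exists i, g; rewrite iE.
  by rewrite -iE qi; move: iB; rewrite mem_index_iota iE.
have Tplaces : ([set` T] `<=` @places R K)%classic.
  by move=> v /TP[i [g [qi _ ->]]]; apply/placesP; exists i, g.
rewrite /field_height -(fsbig_widen [set` T]) //; last first.
  move=> v [/placesP[i [g [qi ->]]] /= nT].
  have Bi : (B <= i)%N.
    rewrite leqNgt; apply/negP => iB; apply: nT; rewrite /= mem_undup; apply/mapP.
    exists (i, g) => //; rewrite mem_filter qi /=.
    by apply/allpairsP; exists (i, g); rewrite mem_index_iota mem_enum.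
  rewrite local_height_vv // big1 // => h /eqP vE.
  by rewrite vE HB // powR1.
rewrite -fsbig_seq ?undup_uniq //.
transitivity (\prod_(p <- s) F p.1 p.2).
  (* The pairs [(i, g)] are grouped by the place that they induce; a place determines [i] by
     [vv_inj]. *)
  transitivity (\prod_(v <- T) \prod_(p <- s | vv p.1 p.2 == v) F p.1 p.2).
    apply: eq_big_seq => v /TP[i [g [qi iB ->]]].
    rewrite local_height_vv // /s big_filter_cond [RHS]big_mkcond big_allpairs /=.
    rewrite (bigD1_seq i) ?iota_uniq ?mem_index_iota //= [X in _ * X]big1 ?mulr1.
      by rewrite -big_mkcond big_enum_cond /= qi.
    move=> j ji; rewrite big1 // => h _; case: ifP => // /andP[qj /eqP vE].
    by rewrite (vv_inj qj qi vE) eqxx in ji.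
  rewrite (exchange_big_dep xpredT) //=; apply: eq_big_seq => p ps.
  rewrite (eq_bigl (fun v => v == vv p.1 p.2)); last by move=> v; rewrite eq_sym.
  by rewrite -big_filter filter_pred1_uniq ?undup_uniq ?big_seq1 // mem_undup;
    apply/mapP; exists p.
rewrite /s big_filter big_mkcond big_allpairs /= big_mkord [RHS]big_mkcond.
apply: eq_bigr => i _; case: ifP => _; first by rewrite big_enum.
by rewrite big1.
Qed.

End HeightFormula.

(** * Heights over algC and the product formula *)

Section HeightOverAlgC.
Variable R : realType.

(** At almost all primes every coordinate is integral, and so is the inverse of [x j0]. *)
Lemma lnorm_almost_one (I : finType) (x : I -> algC) (j0 : I) : x j0 != 0 ->
  exists B, forall i u, is_qidx i -> over_qplace i u -> (B <= i)%N ->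
    lnorm (R := R) (i == 0%N) u x = 1.
Proof.
move=> xj0.
have /fin_all_exists[m Hm] (j : I) := almost_integral R (x j).
have [m' Hm'] := almost_integral R (x j0)^-1.
exists (m' + \sum_j m j).+1 => i u qi ui Bi.
have i0 : (i == 0%N) = false by apply: gtn_eqF; apply: leq_trans Bi.
have pi : prime i by move: qi; rewrite /is_qidx i0.
have au := over_qplace_absval ui.
have ux j : u (x j) <= 1.
  apply: (Hm j) pi ui; apply: leq_trans Bi; rewrite ltnS (bigD1 j) //=.
  by rewrite addnCA leq_addr.
have uj0 : u (x j0) = 1.
  apply/eqP; rewrite eq_le ux /= -[u _]invrK invf_ge1 ?invr_gt0 ?absv_gt0 //.
  rewrite -(absvV au); apply: Hm' pi ui; apply: leq_trans Bi; rewrite ltnS leq_addr //.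
rewrite i0 /lnorm; apply/eqP; rewrite eq_le; apply/andP; split.
  by elim/big_rec: _ => [|j y _ y1]; rewrite ?ler01 // ge_max ux.
by rewrite (bigD1 j0) //= le_max uj0 lexx.
Qed.

Section Formula.
Variables (E : splittingFieldType rat) (e : {rmorphism E -> algC}).
Variable nu : gal_of {:E} -> {rmorphism algC -> algC}.
Hypothesis nuE : forall g a, nu g (e a) = e (g a).

(** As [nu g] extends [g] to algC, a conjugate place applies to any vector over algC, whichever
    field its coordinates generate. *)
Definition conj_place i g : algC -> R := qplace R i \o nu g.

Lemma conj_placeP i g : is_qidx i -> over_qplace i (conj_place i g).
Proof. by move=> qi; exact: over_qplace_aut (qplaceP R qi). Qed.

Definition partial_height (I : finType) (B : nat) (x : I -> algC) : R :=
  \prod_(i < B | is_qidx i) \prod_(g : gal_of {:E})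
     lnorm (i == 0%N :> nat) (conj_place i g) x `^ #|{: gal_of {:E}}|%:R^-1.

(** [E] may be larger than the field of the coordinates, so several vectors can share it; the
    threshold [B0] lets them share [B] as well. *)
Lemma height_formula (I : finType) (x : I -> algC) : (exists j, x j != 0) ->
  (forall j, exists b, e b = x j) ->
  exists B0, forall B, (B0 <= B)%N -> height R x = partial_height B x.
Proof.
move=> [j0 xj0] xE; have [B0 HB0] := lnorm_almost_one xj0.
exists B0 => B BB; rewrite /height.
case: num_field_exists => K [k [s sE gen]].
have sx a : a \in s -> exists b, e b = k a.
  by move=> sa; have : k a \in codom x by [rewrite -sE map_f]; move=> /codomP[j ->].
have [iota iotaE] := embedding_lift gen sx.
set y := fun j : I => s`_(enum_rank j).
have ky j : k (y j) = x j.
  have rj : (enum_rank j < size s)%N.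
    by rewrite -(size_map k) sE size_map -cardE ltn_ord.
  by rewrite /y -(nth_map 0 0) // sE nth_codom enum_rankK.
have vvE i g : vv R e iota i g = conj_place i g \o k.
  by apply/funext => u; rewrite /vv /conj_place /= -iotaE nuE.
have lE i g : lnorm (i == 0%N) (vv R e iota i g) y = lnorm (i == 0%N) (conj_place i g) x.
  rewrite vvE /lnorm; case: ifP => _.
    by congr Num.sqrt; apply: eq_bigr => j _; rewrite /= ky.
  by apply: eq_bigr => j _; rewrite /= ky.
rewrite (@field_height_vv R E e K iota I y B).
  by apply: eq_bigr => i _; apply: eq_bigr => g _; rewrite lE.
move=> i g qi Bi; rewrite lE HB0 //; first exact: conj_placeP.
exact: leq_trans BB Bi.
Qed.

End Formula.

Lemma galois_data (s : seq algC) :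
  exists (E : splittingFieldType rat) (e : {rmorphism E -> algC})
    (nu : gal_of {:E} -> {rmorphism algC -> algC}),
    (forall g a, nu g (e a) = e (g a)) /\ forall a, a \in s -> exists b, e b = a.
Proof.
have [E [e He]] := splitting_field_exists s; exists E, e.
pose f (g : gal_of {:E}) := extend_algC_subfield_aut e g.
exists (fun g => sval (f g)); split=> // g a.
by case: (f g) => /= nu ->.
Qed.

(** The index type is packed with the vector, so that matrices of different sizes and scalars fit in
    one list. *)
Definition vec := {I : finType & I -> algC}.
Definition mkvec (I : finType) (x : I -> algC) : vec :=
  existT (fun I : finType => I -> algC) I x.
Definition vnonzero (y : vec) : Prop := exists j, projT2 y j != 0.
Definition vheight (y : vec) : R := height R (projT2 y).
Definition vnorm (i : nat) (u : algC -> R) (y : vec) : R :=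
  lnorm (i == 0%N) u (projT2 y).

(** All heights are written as products over the same automorphisms and the same range of places,
    and the local inequality is applied factor by factor. *)
Theorem height_le_prod (x : vec) (ys : seq vec) (c : R) :
  0 <= c -> vnonzero x -> (forall k, (k < size ys)%N -> vnonzero (nth x ys k)) ->
  (forall i u, is_qidx i -> over_qplace i u ->
     vnorm i u x <= (if (i == 0)%N then c else 1) * \prod_(y <- ys) vnorm i u y) ->
  vheight x <= c * \prod_(y <- ys) vheight y.
Proof.
move=> c0 x0 ys0 H.
have [E [e [nu [nuE Hs]]]] :=
  galois_data (codom (projT2 x) ++ flatten [seq codom (projT2 y) | y <- ys]).
pose G := #|{: gal_of {:E}}|.
have G0 : (0 < G)%N by apply/card_gt0P; exists 1%g.
pose cp := @conj_place E nu.
have cpP i g : is_qidx i -> over_qplace i (cp i g) by move=> qi; exact: conj_placeP.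
have vn0 i g y : is_qidx i -> 0 <= vnorm i (cp i g) y.
  move=> qi; apply: lnorm_ge0; apply: absv_ge0; exact: over_qplace_absval (cpP i g qi).
have [|B1 HB1] := @height_formula E e nu nuE _ (projT2 x) x0.
  by move=> j; apply: Hs; rewrite mem_cat codom_f.
have [B2 HB2] : exists B0, forall B, (B0 <= B)%N ->
   \prod_(y <- ys) vheight y = \prod_(i < B | is_qidx i) \prod_(g : gal_of {:E})
     (\prod_(y <- ys) vnorm i (cp i g) y) `^ G%:R^-1.
  have {Hs}Hs : forall a, a \in flatten [seq codom (projT2 y) | y <- ys] -> exists b, e b = a.
    by move=> a ha; apply: Hs; rewrite mem_cat ha orbT.
  elim: ys ys0 {H} Hs => [|y ys IH] ys0 Hs.
    exists 0%N => B _; rewrite big_nil big1 // => i _; rewrite big1 // => g _.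
    by rewrite big_nil powR1.
  have [||Ba HBa] := IH.
  - by move=> k kys; exact: (ys0 k.+1).
  - by move=> a ha; apply: Hs; rewrite /= mem_cat ha orbT.
  have [||Bb HBb] := @height_formula E e nu nuE _ (projT2 y).
  - exact: (ys0 0%N).
  - by move=> j; apply: Hs; rewrite /= mem_cat codom_f.
  exists (maxn Ba Bb) => B; rewrite geq_max => /andP[/HBa ha /HBb hb].
  rewrite big_cons ha /vheight hb /partial_height -big_split; apply: eq_bigr => i qi.
  rewrite -big_split; apply: eq_bigr => g _; rewrite /= big_cons powRM //.
    exact: vn0.
  by apply: prodr_ge0 => z _; exact: vn0.
pose B := (maxn B1 B2).+1.
rewrite (HB2 B) ?leqW ?leq_maxr // /vheight (HB1 B) ?leqW ?leq_maxl // /partial_height.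
(* [c] is spread evenly over the automorphisms at the archimedean place, whose exponents [1 / G] add
   up to 1. *)
have -> : c = \prod_(i < B | is_qidx i) \prod_(g : gal_of {:E})
    (if (i == 0 :> nat)%N then c else 1) `^ G%:R^-1.
  rewrite (bigD1 ord0) //= [X in _ * X]big1 ?mulr1; last first.
    by move=> i /andP[_ i0]; rewrite big1 // => g _; rewrite -val_eqE /= in i0;
      rewrite (negPf i0) powR1.
  rewrite prodr_const -powR_mulrn ?powR_ge0 // -powRrM mulVf ?powRr1 //.
  by rewrite pnatr_eq0 -lt0n.
rewrite -big_split /=; apply: ler_prod => i qi; apply/andP; split.
  by apply: prodr_ge0 => g _; exact: powR_ge0.
rewrite -big_split /=; apply: ler_prod => g _; apply/andP; split; first exact: powR_ge0.
have c1 : 0 <= (if (i == 0 :> nat)%N then c else 1) by case: ifP.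
rewrite -powRM //; last by apply: prodr_ge0 => z _; exact: vn0.
apply: ge0_ler_powR; rewrite ?invr_ge0 ?ler0n ?nnegrE //.
- exact: (vn0 i g x qi).
- by apply: mulr_ge0 => //; apply: prodr_ge0 => z _; exact: vn0.
- exact: (H i (cp i g) qi (cpP i g qi)).
Qed.

Lemma absval_qabs i : is_qidx i -> absval (qabs R i).
Proof.
move=> qi; have H := qplaceP R qi.
have -> : qabs R i = qplace R i \o (ratr : {rmorphism rat -> algC}).
  by apply/funext => q; rewrite /= (over_qplace_ratr _ H).
exact: absval_comp (over_qplace_absval H).
Qed.

(** Multiplicativity reduces this to primes; for a prime [p] the archimedean factor [p] cancels the
    factor [1 / p]. *)
Lemma product_formula (q : rat) : q != 0 -> exists B0, forall B, (B0 <= B)%N ->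
  \prod_(i < B | is_qidx i) qabs R i q = 1.
Proof.
pose Phi B (q : rat) : R := \prod_(i < B | is_qidx i) qabs R i q.
have PhiM B a b : Phi B (a * b) = Phi B a * Phi B b.
  by rewrite -big_split; apply: eq_bigr => i /absval_qabs ai; rewrite /= (absvM ai).
have PhiV B a : Phi B a^-1 = (Phi B a)^-1.
  by rewrite /Phi -prodfV; apply: eq_bigr => i /absval_qabs ai; rewrite /= (absvV ai).
have PhiN B a : Phi B (- a) = Phi B a.
  by apply: eq_bigr => i /absval_qabs ai; rewrite /= (absvN ai).
have Phi1 B : Phi B 1 = 1.
  by rewrite /Phi big1 // => i /absval_qabs ai; rewrite (absv1 ai).
have Phip B p : prime p -> (p < B)%N -> Phi B p%:R = 1.
  move=> pp pB; have B0 : (0 < B)%N by exact: leq_ltn_trans pB.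
  rewrite /Phi (bigD1 (Ordinal B0)) //= (bigD1 (Ordinal pB)) /=; last first.
    by rewrite /is_qidx pp orbT /= -val_eqE /= -lt0n prime_gt0.
  rewrite [X in _ * (_ * X)]big1 ?mulr1.
    rewrite /qabs /= -[(p == 0)%N]negbK -lt0n prime_gt0 //= padic_abs_p //.
    by rewrite ratr_nat normr_nat divff // pnatr_eq0 -lt0n prime_gt0.
  move=> i /andP[/andP[qi i0] ip]; rewrite /qabs.
  have i0' : (i == 0 :> nat)%N = false by apply: negbTE; rewrite -val_eqE in i0.
  rewrite i0' padic_abs_prime //; first by move: qi; rewrite /is_qidx i0'.
have Phin n B : (0 < n)%N -> (n < B)%N -> Phi B n%:R = 1.
  have [m] := ubnP n; elim: m n => // m IH n; rewrite ltnS => nm n0 nB.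
  have [n1|n1] := leqP n 1.
    by have -> : n = 1%N by [apply/eqP; rewrite eqn_leq n1]; exact: Phi1.
  rewrite -(divnK (pdiv_dvd n)) natrM PhiM.
  have pn := pdiv_prime n1.
  have d0 : (0 < n %/ pdiv n)%N by rewrite divn_gt0 ?pdiv_leq ?pdiv_gt0.
  have dn : (n %/ pdiv n < n)%N by rewrite ltn_Pdiv // prime_gt1.
  have pB : (pdiv n < B)%N by apply: leq_ltn_trans nB; exact: pdiv_leq.
  rewrite (Phip _ _ pn pB) mulr1.
  by apply: IH => //; [exact: leq_trans dn nm | exact: ltn_trans nB].
move=> q0; exists (maxn `|numq q| `|denq q|).+1 => B; rewrite gtn_max => /andP[nB dB].
rewrite -/(Phi B q) -(divq_num_den q) PhiM PhiV.
have PhiZ (z : int) : z != 0 -> (`|z| < B)%N -> Phi B z%:~R = 1.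
  case: z => z z0 zB; first by rewrite -pmulrn Phin // lt0n.
  by rewrite NegzE mulrNz PhiN -pmulrn Phin.
by rewrite !PhiZ ?invr1 ?mulr1 // ?denq_neq0 // numq_eq0.
Qed.

Lemma prod_powR (I : finType) (P : pred I) (f : I -> R) (c : R) :
  (forall i, P i -> 0 <= f i) ->
  \prod_(i | P i) (f i `^ c) = (\prod_(i | P i) f i) `^ c.
Proof.
move=> f0; suff [] : 0 <= \prod_(i | P i) f i /\
  \prod_(i | P i) (f i `^ c) = (\prod_(i | P i) f i) `^ c by [].
elim/big_rec2: _ => [|i y z Pi [z0 ->]]; first by rewrite powR1 ler01.
by rewrite powRM ?mulr_ge0 ?f0.
Qed.

Definition scalar_vec (a : algC) : vec := mkvec (fun _ : unit => a).

Lemma vnorm_scalar i u a : over_qplace i u -> vnorm i u (scalar_vec a) = u a.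
Proof.
move=> /over_qplace_absval au; rewrite /vnorm /lnorm /=.
rewrite !big_const card_unit /= addr0; case: ifP => _.
  by rewrite sqrtr_sqr ger0_norm // absv_ge0.
by rewrite max_l // absv_ge0.
Qed.

(** Above each place of the rationals the factors combine into the value of the product of the
    conjugates of [a], a rational number to which [product_formula] applies. *)
Lemma vheight_scalar (a : algC) : a != 0 -> vheight (scalar_vec a) = 1.
Proof.
move=> a0; have [E [e [nu [nuE Hs]]]] := galois_data [:: a].
have [b bE] := Hs a (mem_head _ _).
have [||B1 HB1] := @height_formula E e nu nuE _ (fun _ : unit => a).
- by exists tt.
- by move=> _; exists b.
have [q qE] := gal_prod_rat b.
have q0 : q != 0.
  apply/eqP => q0; move/eqP: qE; rewrite q0 scale0r => /prodf_eq0[g _].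
  by rewrite fmorph_eq0 -(fmorph_eq0 e) bE (negPf a0).
have [B2 HB2] := product_formula q0.
rewrite /vheight (HB1 (maxn B1 B2)) ?leq_maxl // /partial_height.
rewrite (eq_bigr (fun i : 'I__ => qabs R i q `^ #|{: gal_of {:E}}|%:R^-1)).
  rewrite prod_powR ?HB2 ?leq_maxr ?powR1 // => i qi; exact: absv_ge0 (absval_qabs qi) _.
move=> i qi; have ci g := conj_placeP nu g qi.
have ai := over_qplace_absval (qplaceP R qi).
rewrite (eq_bigr (fun g => conj_place nu i g a `^ #|{: gal_of {:E}}|%:R^-1)); last first.
  by move=> g _; rewrite -(vnorm_scalar a (ci g)).
rewrite prod_powR; last by move=> g _; exact: absv_ge0 (over_qplace_absval (ci g)) _.
rewrite (eq_bigr (fun g : gal_of {:E} => qplace R i (e (g b)))); last first.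
  by move=> g _; rewrite /conj_place /= -bE nuE.
rewrite -(absv_prod ai) -rmorph_prod qE alg_num_field fmorph_rat.
by rewrite (over_qplace_ratr _ (qplaceP R qi)).
Qed.

Lemma le_vnorm i u (y : vec) j : over_qplace i u -> u (projT2 y j) <= vnorm i u y.
Proof.
move=> /over_qplace_absval au; rewrite /vnorm /lnorm; case: ifP => _; last first.
  by rewrite (bigD1 j) //= le_max lexx.
rewrite -[leLHS]ger0_norm ?absv_ge0 // -sqrtr_sqr ler_wsqrtr // (bigD1 j) //= lerDl.
by apply: sumr_ge0 => k _; exact: sqr_ge0.
Qed.

Lemma vnorm_ge0 i u (y : vec) : over_qplace i u -> 0 <= vnorm i u y.
Proof. by move=> /over_qplace_absval au; apply: lnorm_ge0; exact: absv_ge0. Qed.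

(** A nonzero coordinate has height 1, and its local norms are at most those of [y]. *)
Lemma vheight_ge1 (y : vec) : vnonzero y -> 1 <= vheight y.
Proof.
move=> y0; have [j yj0] := y0; rewrite -(vheight_scalar yj0).
have := @height_le_prod (scalar_vec (projT2 y j)) [:: y] 1 ler01.
rewrite !big_seq1 mul1r; apply; first by exists tt.
  by case.
move=> i u qi ui; rewrite big_seq1 vnorm_scalar // if_same mul1r.
exact: le_vnorm.
Qed.

End HeightOverAlgC.

(** * Heights of matrices *)

Section MatrixHeights.
Variable R : realType.

Definition mxv m n (A : 'M[algC]_(m, n)) : vec :=
  mkvec (fun ij : 'I_m * 'I_n => A ij.1 ij.2).

Lemma vnonzero_mx m n (A : 'M[algC]_(m, n)) : A != 0 -> vnonzero (mxv A).
Proof.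
move=> A0; apply: contrapT => H; case/eqP: A0; apply/matrixP => i j; rewrite mxE.
by apply/eqP/negPn/negP => Aij; apply: H; exists (i, j).
Qed.

Lemma mx_heightE m n (A : 'M[algC]_(m, n)) : mx_height R A = vheight R (mxv A).
Proof. by []. Qed.

Lemma mx_height_ge1 m n (A : 'M[algC]_(m, n)) : A != 0 -> 1 <= mx_height R A.
Proof. by move=> A0; rewrite mx_heightE; apply: vheight_ge1; exact: vnonzero_mx. Qed.

Definition cst (i : nat) (c : R) := if (i == 0)%N then c else 1.

Lemma cst_ge1 i c : 1 <= c -> 1 <= cst i c.
Proof. by rewrite /cst; case: ifP. Qed.

Section LocalNorms.
Variables (i : nat) (u : algC -> R).
Hypothesis ui : over_qplace i u.
Let au : absval u := over_qplace_absval ui.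

Definition mnorm m n (A : 'M[algC]_(m, n)) : R := vnorm i u (mxv A).

Lemma mnorm_ge0 m n (A : 'M[algC]_(m, n)) : 0 <= mnorm A.
Proof. exact: vnorm_ge0. Qed.

Lemma le_mnorm m n (A : 'M[algC]_(m, n)) j k : u (A j k) <= mnorm A.
Proof. exact: (@le_vnorm _ _ _ (mxv A) (j, k) ui). Qed.

Lemma vnorm_leP (y : vec) (M : R) : 0 <= M ->
  (if (i == 0)%N then is_true (\sum_j u (projT2 y j) ^+ 2 <= M ^+ 2)
   else forall j, u (projT2 y j) <= M) -> vnorm i u y <= M.
Proof.
move=> M0; rewrite /vnorm /lnorm; case: ifP => _ H.
  by rewrite -(ger0_norm M0) -sqrtr_sqr ler_wsqrtr.
by elim/big_rec: _ => // j z _ zM; rewrite ge_max H.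
Qed.

Lemma vnorm_arch (y : vec) : (i == 0)%N ->
  vnorm i u y ^+ 2 = \sum_j u (projT2 y j) ^+ 2.
Proof.
move=> i0; rewrite /vnorm /lnorm i0 sqr_sqrtr //.
by apply: sumr_ge0 => j _; exact: sqr_ge0.
Qed.

Lemma ultra x y : (i == 0)%N = false -> u (x + y) <= Num.max (u x) (u y).
Proof. by move=> i0; move: ui; rewrite /over_qplace i0 => -[]. Qed.

Lemma vnormD (I : finType) (x y : I -> algC) (M : R) :
  vnorm i u (mkvec x) <= M -> vnorm i u (mkvec y) <= M ->
  vnorm i u (mkvec (fun j => x j + y j)) <= cst i 2 * M.
Proof.
move=> xM yM.
have M0 : 0 <= M := le_trans (vnorm_ge0 (mkvec x) ui) xM.
apply: vnorm_leP; first by rewrite mulr_ge0 // (le_trans ler01) // cst_ge1 // ler1n.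
rewrite /cst; case i0 : (i == 0)%N; last first.
  move=> j; rewrite mul1r; apply: le_trans (ultra _ _ i0) _; rewrite ge_max.
  by rewrite (le_trans (@le_vnorm _ _ _ (mkvec x) j ui)) //
    (le_trans (@le_vnorm _ _ _ (mkvec y) j ui)).
have x2 : vnorm i u (mkvec x) ^+ 2 <= M ^+ 2 by rewrite ler_pXn2r ?nnegrE ?vnorm_ge0.
have y2 : vnorm i u (mkvec y) ^+ 2 <= M ^+ 2 by rewrite ler_pXn2r ?nnegrE ?vnorm_ge0.
move: x2 y2; rewrite !vnorm_arch //= => x2 y2.
apply: (@le_trans _ _ (\sum_j (2 * u (x j) ^+ 2 + 2 * u (y j) ^+ 2))).
  apply: ler_sum => j _; have := absvD au (x j) (y j).
  have := absv_ge0 au (x j + y j); have := absv_ge0 au (x j); have := absv_ge0 au (y j).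
  set a := u (x j); set b := u (y j); set c := u _ => b0 a0 c0 cab.
  apply: (@le_trans _ _ ((a + b) ^+ 2)); first by rewrite ler_pXn2r ?nnegrE ?addr_ge0.
  by have := sqr_ge0 (a - b); rewrite !expr2; lra.
by rewrite big_split -!mulr_sumr /= exprMn; lra.
Qed.

Lemma mnormD m n (A B : 'M[algC]_(m, n)) (M : R) :
  mnorm A <= M -> mnorm B <= M -> mnorm (A + B) <= cst i 2 * M.
Proof.
move=> AM BM; rewrite /mnorm /mxv.
have -> : (fun ij : 'I_m * 'I_n => (A + B) ij.1 ij.2) =
          (fun ij : 'I_m * 'I_n => A ij.1 ij.2 + B ij.1 ij.2).
  by apply/funext => ij; rewrite mxE.
exact: vnormD.
Qed.

Lemma eq_mnorm m n p q (A : 'M[algC]_(m, n)) (B : 'M[algC]_(p, q))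
    (f : 'I_m * 'I_n -> 'I_p * 'I_q) : injective f ->
  (forall ij, A ij.1 ij.2 = B (f ij).1 (f ij).2) -> mnorm A <= mnorm B.
Proof.
move=> finj AB; apply: vnorm_leP; first exact: mnorm_ge0.
case: ifP => i0; last by move=> ij; rewrite /= AB; exact: le_mnorm.
rewrite /mnorm vnorm_arch //= (eq_bigr (fun ij => u (B (f ij).1 (f ij).2) ^+ 2)); last first.
  by move=> ij _; rewrite AB.
pose g (k : 'I_p * 'I_q) := u (B k.1 k.2) ^+ 2.
rewrite -[leLHS]/(\sum_ij g (f ij)) -[leRHS]/(\sum_k g k).
have -> : \sum_ij g (f ij) = \sum_(k in map f (enum {: 'I_m * 'I_n})) g k.
  by rewrite -[RHS]big_uniq ?(map_inj_uniq finj) ?enum_uniq //= big_map big_enum.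
rewrite [leRHS](bigID [in map f (enum {: 'I_m * 'I_n})]) /= lerDl.
by apply: sumr_ge0 => k _; exact: sqr_ge0.
Qed.

Lemma mnorm_tr m n (A : 'M[algC]_(m, n)) : mnorm A^T = mnorm A.
Proof.
have H p q (B : 'M[algC]_(p, q)) : mnorm B^T <= mnorm B.
  apply: (@eq_mnorm _ _ _ _ _ _ (fun ij => (ij.2, ij.1))) => [[a b] [c d] [-> ->]//|ij].
  by rewrite mxE.
by apply/eqP; rewrite eq_le H -{1}[A]trmxK H.
Qed.

Lemma mnormZ m n (a : algC) (A : 'M[algC]_(m, n)) : mnorm (a *: A) <= u a * mnorm A.
Proof.
apply: vnorm_leP; first by rewrite mulr_ge0 ?mnorm_ge0 ?absv_ge0.
case: ifP => i0; last first.
  by move=> ij; rewrite /= mxE (absvM au) ler_wpM2l ?le_mnorm ?absv_ge0.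
rewrite exprMn /mnorm vnorm_arch // mulr_sumr; apply: ler_sum => ij _.
by rewrite /= mxE (absvM au) exprMn.
Qed.

(** Lagrange's identity writes the difference of the two sides as half a sum of squares. *)
Lemma cauchy_schwarz (I : finType) (a b : I -> R) :
  (\sum_k a k * b k) ^+ 2 <= (\sum_k a k ^+ 2) * (\sum_k b k ^+ 2).
Proof.
rewrite -subr_ge0.
have -> : (\sum_k a k ^+ 2) * (\sum_k b k ^+ 2) - (\sum_k a k * b k) ^+ 2 =
   2^-1 * \sum_k \sum_l (a k * b l - a l * b k) ^+ 2.
  have -> : \sum_k \sum_l (a k * b l - a l * b k) ^+ 2 =
     \sum_k \sum_l a k ^+ 2 * b l ^+ 2 + \sum_k \sum_l a l ^+ 2 * b k ^+ 2
     - 2 * \sum_k \sum_l (a k * b k) * (a l * b l).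
    rewrite mulr_sumr -sumrN -!big_split /=; apply: eq_bigr => k _.
    rewrite mulr_sumr -sumrN -!big_split /=; apply: eq_bigr => l _; ring.
  rewrite [X in _ + X - _]exchange_big /=.
  have D (f g : I -> R) : \sum_k \sum_l f k * g l = (\sum_k f k) * (\sum_l g l).
    by rewrite mulr_suml; apply: eq_bigr => k _; rewrite mulr_sumr.
  rewrite !D expr2; by field.
rewrite mulr_ge0 ?invr_ge0 // sumr_ge0 // => k _; rewrite sumr_ge0 // => l _.
exact: sqr_ge0.
Qed.

(** At the archimedean place the Frobenius norm is submultiplicative, by Cauchy-Schwarz for a row of
    [A] and a column of [B]; elsewhere the ultrametric inequality suffices. *)
Lemma mnormM m n p (A : 'M[algC]_(m, n)) (B : 'M[algC]_(n, p)) :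
  mnorm (A *m B) <= mnorm A * mnorm B.
Proof.
apply: vnorm_leP; first by rewrite mulr_ge0 ?mnorm_ge0.
case: ifP => i0; last first.
  move=> [j k]; rewrite /= mxE; apply: ultra_sum => //.
  - exact: absv0.
  - by move=> x y; exact: ultra.
  - by rewrite mulr_ge0 ?mnorm_ge0.
  by move=> l; rewrite (absvM au) ler_pM ?absv_ge0 ?le_mnorm.
rewrite exprMn /mnorm !vnorm_arch //=.
pose a j := \sum_l u (A j l) ^+ 2; pose b k := \sum_l u (B l k) ^+ 2.
have -> : \sum_(ij : 'I_m * 'I_n) u (A ij.1 ij.2) ^+ 2 = \sum_j a j.
  by rewrite pair_bigA.
have -> : \sum_(ij : 'I_n * 'I_p) u (B ij.1 ij.2) ^+ 2 = \sum_k b k.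
  by rewrite exchange_big pair_bigA.
rewrite mulr_suml; under [leRHS]eq_bigr => j _ do rewrite mulr_sumr.
rewrite pair_bigA; apply: ler_sum => -[j k] _ /=; rewrite mxE.
apply: le_trans _ (cauchy_schwarz (fun l => u (A j l)) (fun l => u (B l k))).
rewrite ler_pXn2r ?nnegrE ?absv_ge0 //; last first.
  by apply: sumr_ge0 => l _; rewrite mulr_ge0 ?absv_ge0.
apply: le_trans (absv_sum au _ _ _) _; apply: ler_sum => l _.
by rewrite (absvM au).
Qed.

Lemma mnorm1 n : (0 < n)%N -> mnorm (1%:M : 'M[algC]_n) <= cst i n%:R.
Proof.
move=> n0; have c0 : 0 <= cst i n%:R by rewrite (le_trans ler01) // cst_ge1 // ler1n.
apply: vnorm_leP => //; rewrite /cst; case i0 : (i == 0)%N; last first.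
  by move=> [j k]; rewrite /= mxE; case: eqP => _; rewrite ?absv1 ?absv0 ?ler01.
rewrite -(pair_bigA _ (fun j k => u ((1%:M : 'M[algC]_n) j k) ^+ 2)) /=.
rewrite (eq_bigr (fun=> 1)) => [|j _].
  by rewrite sumr_const card_ord expr2 -natrM ler_nat leq_pmulr.
rewrite (bigD1 j) //= mxE eqxx absv1 // expr1n big1 ?addr0 // => k kj.
by rewrite mxE eq_sym (negPf kj) absv0 // expr0n.
Qed.

Lemma u_nat2 : u 2 <= cst i 2.
Proof.
rewrite /cst; case: ifP => i0.
  by have := absvD au 1 1; rewrite absv1.
by apply: le_trans (ultra 1 1 i0) _; rewrite absv1 // maxxx.
Qed.

End LocalNorms.

Lemma mx_height_mul m n p (A : 'M[algC]_(m, n)) (B : 'M[algC]_(n, p)) :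
  A *m B != 0 -> mx_height R (A *m B) <= mx_height R A * mx_height R B.
Proof.
move=> AB0; have A0 : A != 0 by apply: contraNneq AB0 => ->; rewrite mul0mx.
have B0 : B != 0 by apply: contraNneq AB0 => ->; rewrite mulmx0.
have := @height_le_prod R (mxv (A *m B)) [:: mxv A; mxv B] 1 ler01 (vnonzero_mx AB0).
rewrite big_cons big_seq1 mul1r; apply.
  by case=> [|[|]] //= _; exact: vnonzero_mx.
by move=> i u qi ui; rewrite big_cons big_seq1 if_same mul1r; exact: mnormM.
Qed.

(** Scaling is free because a nonzero scalar has height 1; this allows denominators to be cleared
    before local estimates. *)
Lemma mx_heightZ_le m n (a : algC) (A : 'M[algC]_(m, n)) : a != 0 -> A != 0 ->
  mx_height R (a *: A) <= mx_height R A.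
Proof.
move=> a0 A0; have aA0 : a *: A != 0 by rewrite scaler_eq0 (negPf a0).
have := @height_le_prod R (mxv (a *: A)) [:: scalar_vec a; mxv A] 1 ler01 (vnonzero_mx aA0).
rewrite big_cons big_seq1 vheight_scalar // !mul1r; apply.
  by case=> [|[|]] //= _; [exists tt | exact: vnonzero_mx].
move=> i u qi ui; rewrite big_cons big_seq1 if_same mul1r vnorm_scalar //.
exact: mnormZ.
Qed.

Lemma mx_heightZ m n (a : algC) (A : 'M[algC]_(m, n)) : a != 0 -> A != 0 ->
  mx_height R (a *: A) = mx_height R A.
Proof.
move=> a0 A0; apply/eqP; rewrite eq_le mx_heightZ_le //=.
rewrite -{1}[A](scalerK a0) mx_heightZ_le ?invr_eq0 //.
by rewrite scaler_eq0 (negPf a0).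
Qed.

End MatrixHeights.

(** * Reflections and the Cartan-Dieudonne induction *)

Section Reflections.
Variables (N : nat) (F : 'M[algC]_N).
Hypothesis Fsym : F^T = F.

Definition qf (y : 'cV[algC]_N) : algC := (y^T *m F *m y) 0 0.

Definition refl_mx (y : 'cV[algC]_N) : 'M[algC]_N :=
  1%:M - (2 / qf y) *: (y *m (y^T *m F)).

Lemma form11 (x y : 'cV[algC]_N) : x^T *m F *m y = (bilin F x y)%:M.
Proof. by rewrite bilinE -mx11_scalar. Qed.

Lemma bilin_sym x y : bilin F x y = bilin F y x.
Proof.
rewrite !bilinE -[LHS](mxE (matrix_key) (fun i j => (x^T *m F *m y) j i)).
have -> : \matrix[matrix_key]_(i, j) (x^T *m F *m y) j i = (x^T *m F *m y)^T.
  by apply/matrixP => i j; rewrite !mxE.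
by rewrite !trmx_mul trmxK Fsym mulmxA.
Qed.

Lemma qfE y : qf y = bilin F y y. Proof. by rewrite bilinE. Qed.

Lemma refl_mxE y m (M : 'M[algC]_(N, m)) :
  refl_mx y *m M = M - (2 / qf y) *: (y *m (y^T *m F *m M)).
Proof. by rewrite mulmxBl mul1mx -scalemxAl !mulmxA. Qed.

Lemma refl_mx_fix y m (M : 'M[algC]_(N, m)) : y^T *m F *m M = 0 -> refl_mx y *m M = M.
Proof. by move=> H; rewrite refl_mxE H mulmx0 scaler0 subr0. Qed.

Lemma refl_mx_vec y z : refl_mx y *m z = z - (2 * bilin F y z / qf y) *: y.
Proof.
rewrite refl_mxE form11 mul_mx_scalar scalerA; congr (_ - _ *: _).
by rewrite mulrAC.
Qed.

Lemma refl_mx_self y : qf y != 0 -> refl_mx y *m y = - y.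
Proof.
move=> q0; rewrite refl_mx_vec -qfE mulfK // scaler_nat mulr2n opprD addrA.
by rewrite subrr sub0r.
Qed.

Lemma refl_mxK y : qf y != 0 -> refl_mx y *m refl_mx y = 1%:M.
Proof.
move=> q0; rewrite {2}/refl_mx mulmxBr mulmx1 -scalemxAr.
rewrite (mulmxA (refl_mx y) y) refl_mx_self //.
by rewrite mulNmx scalerN opprK /refl_mx subrK.
Qed.

Lemma refl_mx_unit y : qf y != 0 -> refl_mx y \in unitmx.
Proof. by move=> q0; case/mulmx1_unit: (refl_mxK q0). Qed.

Definition isometry_mx (A : 'M[algC]_N) := A^T *m F *m A = F.

Lemma refl_mx_isometry y : qf y != 0 -> isometry_mx (refl_mx y).
Proof.
move=> q0; rewrite /isometry_mx.
have E : (refl_mx y)^T *m F = F *m refl_mx y.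
  rewrite /refl_mx linearB /= trmx1 mulmxBl mul1mx mulmxBr mulmx1; congr (_ - _).
  rewrite linearZ /= -scalemxAl -scalemxAr !trmx_mul trmxK Fsym; congr (_ *: _).
  by rewrite !mulmxA.
by rewrite E -mulmxA refl_mxK // mulmx1.
Qed.

Lemma isometry_mxM A B : isometry_mx A -> isometry_mx B -> isometry_mx (A *m B).
Proof.
move=> HA HB; rewrite /isometry_mx -[RHS]HB -{2}HA trmx_mul.
by rewrite !mulmxA.
Qed.

Lemma isometry_bilin A x y : isometry_mx A -> bilin F (A *m x) (A *m y) = bilin F x y.
Proof.
by move=> HA; rewrite !bilinE -{2}HA trmx_mul !mulmxA.
Qed.

Lemma bilinDl x y z : bilin F (x + y) z = bilin F x z + bilin F y z.
Proof. by rewrite !bilinE linearD /= !mulmxDl mxE. Qed.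

Lemma bilinDr x y z : bilin F x (y + z) = bilin F x y + bilin F x z.
Proof. by rewrite !bilinE mulmxDr mxE. Qed.

Lemma bilinNl x y : bilin F (- x) y = - bilin F x y.
Proof. by rewrite !bilinE linearN /= !mulNmx mxE. Qed.

Lemma bilinNr x y : bilin F x (- y) = - bilin F x y.
Proof. by rewrite !bilinE mulmxN mxE. Qed.

Lemma bilinZr a x y : bilin F x (a *: y) = a * bilin F x y.
Proof. by rewrite !bilinE -scalemxAr mxE. Qed.

(** [A x] and [x] have the same value under the form, so the reflection in their difference
    exchanges them. *)
Lemma cd_step_minus A x : isometry_mx A -> qf (A *m x - x) != 0 ->
  refl_mx (A *m x - x) *m (A *m x) = x.
Proof.
move=> HA; rewrite refl_mx_vec qfE; set y := _ - x.
have Eyy : bilin F y y = 2 * bilin F y (A *m x).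
  rewrite /y !(bilinDl, bilinDr, bilinNl, bilinNr) (isometry_bilin x x HA).
  by rewrite (bilin_sym (A *m x) x); ring.
by move=> q0; rewrite -Eyy divff // scale1r /y opprB addrC subrK.
Qed.

(** If [A x - x] is isotropic, then [F(x, A x) = F(x, x)], so [A x + x] has the value [4 F(x, x)].
    Its reflection maps [A x] to [- x], and the reflection in [x] restores the sign. *)
Lemma cd_step_plus A x : isometry_mx A -> qf x != 0 -> qf (A *m x - x) = 0 ->
  qf (A *m x + x) != 0 /\ refl_mx x *m (refl_mx (A *m x + x) *m (A *m x)) = x.
Proof.
move=> HA x0; rewrite (refl_mx_vec (A *m x + x)) !qfE.
set a := bilin F x x; set b := bilin F x (A *m x) => q0.
have AA : bilin F (A *m x) (A *m x) = a by exact: isometry_bilin.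
have Ax : bilin F (A *m x) x = b by rewrite bilin_sym.
have ab : b = a.
  have : 2 * (a - b) = 0.
    by rewrite -[RHS]q0 !(bilinDl, bilinDr, bilinNl, bilinNr) AA Ax -/a -/b; ring.
  by move/eqP; rewrite mulf_eq0 pnatr_eq0 /= subr_eq0 => /eqP.
have E4 : bilin F (A *m x + x) (A *m x + x) = 4 * a.
  by rewrite !(bilinDl, bilinDr) AA Ax -/a -/b ab; ring.
have E2 : 2 * bilin F (A *m x + x) (A *m x) = 4 * a.
  by rewrite bilinDl AA -/b ab; ring.
have a4 : 4 * a != 0 by rewrite mulf_neq0 ?pnatr_eq0 // /a -qfE.
rewrite E4 E2; split=> //.
by rewrite divff // scale1r opprD addrA subrr sub0r mulmxN refl_mx_self // opprK.
Qed.

(* By polarization, not all the vectors X e_i and X (e_i + e_j) are isotropic. *)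
Lemma exists_anisotropic k (X : 'M[algC]_(N, k.+1)) : X^T *m F *m X != 0 ->
  exists (c : 'cV[algC]_k.+1) (i j : 'I_k.+1), [/\ c i 0 = 1,
    qf (X *m c) != 0 & X *m c = col i X \/ X *m c = col i X + col j X].
Proof.
move=> XFX; pose d i : 'cV[algC]_k.+1 := delta_mx i 0.
have Xd i : X *m d i = col i X by rewrite colE.
have [[i qi]|H] := pselect (exists i, qf (X *m d i) != 0).
  by exists (d i), i, i; rewrite !mxE !eqxx; split=> //; left.
have {}H i : bilin F (X *m d i) (X *m d i) = 0.
  by apply/eqP/negPn/negP => Hi; apply: H; exists i; rewrite qfE.
have [i [j bij]] : exists i j, bilin F (X *m d i) (X *m d j) != 0.
  apply: contrapT => H'; case/eqP: XFX; apply/matrixP => i j; rewrite [RHS]mxE.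
  apply/eqP/negPn/negP => Hij; apply: H'; exists i, j.
  have E : (X *m d i)^T *m F *m (X *m d j) = row i (col j (X^T *m F *m X)).
    by rewrite rowE colE trmx_mul trmx_delta !mulmxA.
  have rc (M : 'M[algC]_k.+1) : row i (col j M) 0 0 = M i j by rewrite !mxE.
  by rewrite bilinE E rc.
have ij : i != j by apply: contraNneq bij => ->; rewrite H.
exists (d i + d j), i, j; split.
- by rewrite !mxE !eqxx (negPf ij) addr0.
- rewrite qfE mulmxDr !(bilinDl, bilinDr) !H add0r addr0 (bilin_sym (X *m d j)) -mulr2n.
  by rewrite mulrn_eq0.
- by right; rewrite mulmxDr !Xd.
Qed.

End Reflections.

(** * Splitting off an anisotropic vector *)

Section Deflation.
Variables (N k : nat) (F : 'M[algC]_N) (X : 'M[algC]_(N, k.+1)).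
Variables (c : 'cV[algC]_k.+1) (i : 'I_k.+1).
Hypotheses (Fsym : F^T = F) (ci : c i 0 = 1).
Let x := X *m c.
Hypothesis qx : qf F x != 0.

Definition deflate_coef : 'M[algC]_k.+1 := qf F x *: 1%:M - c *m (x^T *m F *m X).

(* The columns of X other than the i-th, projected onto the orthogonal
   complement of x and multiplied by qf F x *)
Definition deflate : 'M[algC]_(N, k) := col' i (X *m deflate_coef).

Lemma mul_deflate_coef : X *m deflate_coef = qf F x *: X - x *m (x^T *m F *m X).
Proof. by rewrite /deflate_coef mulmxBr -scalemxAr mulmx1 (mulmxA X c). Qed.

Lemma deflateE : deflate = X *m col' i deflate_coef.
Proof. by rewrite /deflate !col'Esub mulmx_colsub. Qed.

Lemma ortho_coef : x^T *m F *m (X *m deflate_coef) = 0.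
Proof.
rewrite mul_deflate_coef mulmxBr -scalemxAr (mulmxA (x^T *m F) x) form11.
by rewrite mul_scalar_mx qfE subrr.
Qed.

Lemma ortho_deflate : x^T *m F *m deflate = 0.
Proof.
rewrite /deflate col'Esub mulmx_colsub ortho_coef.
by apply/matrixP => a b; rewrite !mxE.
Qed.

Lemma mulmx_split_col m (Y : 'M[algC]_(N, k.+1)) (b : 'M[algC]_(k.+1, m)) :
  Y *m b = col i Y *m row i b + col' i Y *m row' i b.
Proof.
apply/matrixP => r s; rewrite !mxE (bigD1_ord i) //= big_ord1 !mxE.
by congr (_ + _); apply: eq_bigr => j _; rewrite !mxE.
Qed.

(** [X *m deflate_coef] kills [c], so a multiple of [c] may be subtracted from [a]. As [c i 0 = 1],
    this clears row [i], and column [i] can be left out. *)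
Lemma in_deflate m (a : 'M[algC]_(k.+1, m)) : x^T *m F *m (X *m a) = 0 ->
  exists a1, X *m a = deflate *m a1.
Proof.
move=> Ha; pose a' := a - c *m row i a.
have Qc : X *m deflate_coef *m c = 0.
  rewrite mul_deflate_coef mulmxBl -scalemxAl -(mulmxA x) -(mulmxA (x^T *m F)) -/x.
  by rewrite form11 mul_mx_scalar qfE subrr.
have Qa' : X *m deflate_coef *m a' = qf F x *: (X *m a).
  rewrite mulmxBr mulmxA Qc mul0mx subr0 mul_deflate_coef mulmxBl -scalemxAl.
  by rewrite -(mulmxA x) -(mulmxA (x^T *m F)) Ha mulmx0 subr0.
have ra' : row i a' = 0.
  apply/rowP => j; rewrite !mxE big_ord1 !mxE ci mul1r subrr //.
exists ((qf F x)^-1 *: row' i a').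
rewrite -scalemxAr; apply: (canRL (scalerK qx)).
by rewrite -Qa' mulmx_split_col ra' mulmx0 add0r.
Qed.

(** Together, [x] and the deflated columns span the columns of [X]. *)
Lemma deflate_ext m (M M' : 'M[algC]_(m, N)) :
  M *m deflate = M' *m deflate -> M *m x = M' *m x -> M *m X = M' *m X.
Proof.
move=> M1 Mx; have [a1 a1E] := in_deflate ortho_coef.
have XE : qf F x *: X = X *m deflate_coef + x *m (x^T *m F *m X).
  by rewrite mul_deflate_coef subrK.
rewrite a1E in XE; apply: (can_inj (scalerK qx)).
rewrite !scalemxAr XE !mulmxDr (mulmxA M deflate) (mulmxA M x).
by rewrite (mulmxA M' deflate) (mulmxA M' x) M1 Mx.
Qed.

(** A kernel vector [v] gives a combination of the deflated columns that is orthogonal to all of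
    them and to [x], hence to [X]. Nondegeneracy makes its coordinates with respect to [X] vanish,
    and then [v] vanishes. *)
Lemma deflate_gram : X^T *m F *m X \in unitmx -> deflate^T *m F *m deflate \in unitmx.
Proof.
move=> XU; rewrite unitmxE unitfE; apply/det0P => -[v v0 vG].
have Dx : deflate^T *m F *m x = 0.
  apply: trmx_inj; rewrite trmx0 (trmx_mul _ x) (trmx_mul deflate^T F) trmxK Fsym mulmxA.
  exact: ortho_deflate.
have vX : v *m deflate^T *m F *m X = 0 *m X.
  apply: deflate_ext; rewrite mul0mx -(mulmxA v) -(mulmxA v); last by rewrite Dx mulmx0.
  exact: vG.
have vQ : v *m (col' i deflate_coef)^T = 0.
  have : v *m (col' i deflate_coef)^T *m (X^T *m F *m X) = 0.
    by rewrite -[RHS](mul0mx _ X) -vX deflateE trmx_mul !mulmxA.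
  by move/(congr1 (mulmx^~ (invmx (X^T *m F *m X)))); rewrite mulmxK // mul0mx.
(* The columns of [col' i deflate_coef] are independent: row [i], where [c] is 1, gives [mu = 0],
   and row [lift i j] then gives [v 0 j * qf F x = 0]. *)
pose l := x^T *m F *m X; pose mu := \sum_j v 0 j * l 0 (lift i j).
have dE r s : deflate_coef r s = qf F x *+ (r == s) - c r 0 * l 0 s.
  rewrite /deflate_coef -/l; move: (l) (qf F x) => l' q.
  by rewrite !mxE big_ord1 mulr_natr.
have vQE r : \sum_j v 0 j * (qf F x *+ (r == lift i j)) = c r 0 * mu.
  have := congr1 (fun M : 'rV[algC]_k.+1 => M 0 r) vQ; rewrite !mxE => /eqP.
  rewrite (eq_bigr (fun j => v 0 j * (qf F x *+ (r == lift i j))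
     - c r 0 * (v 0 j * l 0 (lift i j)))).
    by rewrite sumrB -mulr_sumr subr_eq0 => /eqP.
  move=> j _; rewrite mxE [col' _ _ _ _]mxE dE mulrBr; congr (_ - _).
  by rewrite mulrCA.
have mu0 : mu = 0.
  have := vQE i; rewrite ci mul1r => <-; rewrite big1 // => j _.
  by rewrite (negPf (neq_lift i j)) mulr0n mulr0.
case/eqP: v0; apply/rowP => j; rewrite [RHS]mxE.
have := vQE (lift i j); rewrite mu0 mulr0 (bigD1 j) //= eqxx mulr1n big1.
  by rewrite addr0 => /eqP; rewrite mulf_eq0 (negPf qx) orbF => /eqP.
move=> j' jj'; rewrite (inj_eq lift_inj) eq_sym (negPf jj') mulr0n mulr0 //.
Qed.

End Deflation.

(** * Heights of reflections, of their vectors and of deflated bases *)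

Section ReflectionHeights.
Variables (R : realType) (N : nat) (F : 'M[algC]_N).
Hypotheses (N2 : (2 <= N)%N) (Fsym : F^T = F) (F0 : F != 0).
Local Notation H := (mx_height R).

Let N0 : (0 < N)%N. Proof. exact: leq_trans N2. Qed.

Lemma mnorm_form i u k m (X : 'M[algC]_(N, k)) (Y : 'M[algC]_(N, m)) : over_qplace i u ->
  mnorm (R := R) i u (X^T *m F *m Y) <= mnorm i u X * mnorm i u F * mnorm i u Y.
Proof.
move=> ui; apply: le_trans (mnormM ui _ _) _.
rewrite ler_wpM2r ?mnorm_ge0 //; apply: le_trans (mnormM ui _ _) _.
by rewrite (mnorm_tr ui).
Qed.

Lemma mnorm_qf i u (y : 'cV[algC]_N) : over_qplace i u ->
  u (qf F y) <= mnorm (R := R) i u y * mnorm i u F * mnorm i u y.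
Proof.
by move=> ui; apply: le_trans (le_mnorm ui _ _ _) _; exact: mnorm_form.
Qed.

Lemma refl_mx_neq0 y : qf F y != 0 -> refl_mx F y != 0.
Proof.
move=> q0; apply/eqP => R0; have := refl_mxK q0; rewrite R0 mul0mx => /esym/eqP.
case: (N) N0 (F) => // n _ _; exact/negP/matrix_nonzero1.
Qed.

Lemma qf_vec_neq0 y : qf F y != 0 -> y != 0.
Proof. by apply: contraNneq => ->; rewrite /qf mulmx0 mxE. Qed.

(** The matrix is first multiplied by [qf F y], which leaves the height unchanged and makes the
    entries polynomial in [F] and [y]. At the archimedean place, [N] bounds the norm of the identity
    and 2 is the cost of the sum. *)
Lemma height_refl_mx y : qf F y != 0 -> H (refl_mx F y) <= 2 * N%:R * (H F * H y ^+ 2).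
Proof.
move=> q0; have y0 := qf_vec_neq0 q0; have R0 := refl_mx_neq0 q0.
rewrite -(mx_heightZ R q0 R0).
have qR0 : qf F y *: refl_mx F y != 0 by rewrite scaler_eq0 negb_or q0.
have := @height_le_prod R (mxv (qf F y *: refl_mx F y)) [:: mxv F; mxv y; mxv y]
  (2 * N%:R) _ (vnonzero_mx qR0).
rewrite !big_cons big_nil mulr1 -expr2; apply.
- by rewrite mulr_ge0.
- by case=> [|[|[|]]] //= _; exact: vnonzero_mx.
move=> i u qi ui; rewrite !big_cons big_nil mulr1.
have -> : qf F y *: refl_mx F y = qf F y *: 1%:M + (- 2) *: (y *m (y^T *m F)).
  by rewrite scalerBr scalerA mulrCA divff // mulr1 scaleNr.
rewrite -!/(mnorm i u _); set f := mnorm i u F; set h := mnorm i u y.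
have f0 : 0 <= f by exact: mnorm_ge0.
have h0 : 0 <= h by exact: mnorm_ge0.
have -> : (if (i == 0)%N then 2 * N%:R else 1) = cst i 2 * cst i (N%:R : R).
  by rewrite /cst; case: ifP => _; rewrite ?mulr1.
rewrite -mulrA; apply: mnormD => //.
  apply: le_trans (mnormZ ui _ _) _; rewrite mulrC.
  apply: ler_pM; rewrite ?mnorm_ge0 ?absv_ge0 ?(over_qplace_absval ui) //.
  - exact: over_qplace_absval ui.
  - exact: mnorm1.
  - apply: le_trans (mnorm_qf _ ui) _; rewrite -/f -/h le_eqVlt.
    by apply/orP; left; apply/eqP; ring.
apply: le_trans (mnormZ ui _ _) _.
rewrite (absvN (over_qplace_absval ui)); apply: ler_pM.
- exact: absv_ge0 (over_qplace_absval ui) _.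
- exact: mnorm_ge0.
- apply: le_trans (u_nat2 ui) _; rewrite /cst; case: ifP => // _.
  by rewrite ler_nat.
apply: le_trans (mnormM ui _ _) _; rewrite -/h.
have := mnormM ui y^T F; rewrite (mnorm_tr ui) -/h -/f => hf.
by rewrite (mulrC f) -!mulrA ler_wpM2l // (mulrC h f) mulrC.
Qed.

(** In [A^T F A = F] the norm of [F] cancels. At every place the term [s *: x] can therefore be
    absorbed in the bound for [A *m x]. *)
Lemma one_le_mnorm_isometry i u (A : 'M[algC]_N) : over_qplace i u ->
  isometry_mx F A -> 1 <= mnorm (R := R) i u A.
Proof.
move=> ui HA; set a := mnorm i u A; have a0 : 0 <= a by exact: mnorm_ge0.
have f0 : 0 < mnorm (R := R) i u F.
  have [[j k] /= Fjk] := vnonzero_mx F0.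
  apply: lt_le_trans (le_mnorm ui F j k).
  by rewrite (absv_gt0 (over_qplace_absval ui)).
have : mnorm (R := R) i u F <= a * mnorm i u F * a.
  by rewrite -{1}HA; exact: mnorm_form.
rewrite mulrAC -expr2 -{1}[mnorm i u F]mul1r ler_pM2r // => a2.
by rewrite -(@ler_pXn2r _ 2) ?nnegrE // expr1n.
Qed.

Lemma height_iso_shift (A : 'M[algC]_N) (x : 'cV[algC]_N) (s : algC) :
  isometry_mx F A -> x != 0 -> s ^+ 2 = 1 -> A *m x + s *: x != 0 ->
  H (A *m x + s *: x) <= 2 * (H A * H x).
Proof.
move=> HA x0 s2 y0.
have A0 : A != 0.
  by apply: contraNneq F0 => A0; rewrite -HA A0 mulmx0.
have := @height_le_prod R (mxv (A *m x + s *: x)) [:: mxv A; mxv x] 2 _ (vnonzero_mx y0).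
rewrite !big_cons big_nil mulr1; apply => //.
  by case=> [|[|]] //= _; exact: vnonzero_mx.
move=> i u qi ui; rewrite !big_cons big_nil mulr1 -!/(mnorm i u _) -/(cst i 2).
apply: mnormD => //; first exact: mnormM.
apply: le_trans (mnormZ ui _ _) _.
have -> : u s = 1.
  have au := over_qplace_absval ui.
  have : u s ^+ 2 = 1 by rewrite -(absvX au) s2 absv1.
  by move/eqP; rewrite sqrf_eq1 => /orP[/eqP//|/eqP E];
    have := absv_ge0 au s; rewrite E oppr_ge0 ler10.
by rewrite ler_wpM2r ?mnorm_ge0 // one_le_mnorm_isometry.
Qed.

Lemma height_col_sum k (X : 'M[algC]_(N, k)) (x : 'cV[algC]_N) (i j : 'I_k) :
  x = col i X \/ x = col i X + col j X -> x != 0 -> X != 0 -> H x <= 2 * H X.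
Proof.
move=> xE x0 X0.
have := @height_le_prod R (mxv x) [:: mxv X] 2 _ (vnonzero_mx x0).
rewrite big_seq1; apply => //.
  by case=> [|] //= _; exact: vnonzero_mx.
move=> p u qp up; rewrite big_seq1 -!/(mnorm p u _) -/(cst p 2).
have colle l : mnorm (R := R) p u (col l X) <= mnorm p u X.
  apply: (@eq_mnorm _ _ _ up _ _ _ _ _ _ (fun ij => (ij.1, l))).
    by move=> [a b] [a' b'] /= [->]; rewrite (ord1 b) (ord1 b').
  by move=> [a b]; rewrite /= mxE.
case: xE => ->; last exact: mnormD.
apply: le_trans (colle i) _; rewrite ler_peMl ?mnorm_ge0 //.
by apply: cst_ge1; rewrite ler1n.
Qed.

(** The columns were scaled by [qf F x], so their entries are polynomials of degree 1 in [F], 2 in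
    [x] and 1 in [X]. *)
Lemma height_deflate k (X : 'M[algC]_(N, k.+1)) c i :
  let x := X *m c in x != 0 -> X != 0 -> deflate F X c i != 0 ->
  H (deflate F X c i) <= 2 * (H F * H x ^+ 2 * H X).
Proof.
move=> x x0 X0 D0.
have := @height_le_prod R (mxv (deflate F X c i)) [:: mxv F; mxv x; mxv x; mxv X] 2 _
  (vnonzero_mx D0).
have -> : 2 * (H F * H x ^+ 2 * H X) = 2 * (H F * (H x * (H x * H X))) by ring.
rewrite !big_cons big_nil mulr1; apply => //.
  by case=> [|[|[|[|]]]] //= _; exact: vnonzero_mx.
move=> p u qp up; rewrite !big_cons big_nil mulr1 -!/(mnorm p u _) -/(cst p 2).
set f := mnorm p u F; set h := mnorm p u x; set g := mnorm p u X.
have [f0 h0 g0] : [/\ 0 <= f, 0 <= h & 0 <= g] by split; exact: mnorm_ge0.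
apply: (@le_trans _ _ (mnorm p u (X *m deflate_coef F X c))).
  apply: (@eq_mnorm _ _ _ up _ _ _ _ _ _ (fun ij => (ij.1, lift i ij.2))).
    move=> [a b] [a' b'] /= E; have -> : a = a' by case: E.
    by have -> : b = b' by apply: (@lift_inj _ i); apply: val_inj; case: E.
  by move=> [a b]; rewrite /deflate mxE.
rewrite mul_deflate_coef; apply: mnormD => //.
  apply: le_trans (mnormZ up _ _) _; rewrite -/g.
  have := mnorm_qf x up; rewrite -/f -/h => qle.
  by rewrite !mulrA ler_wpM2r // (mulrC f) mulrAC (mulrC _ f) mulrA (mulrC f).
have -> : - (x *m (x^T *m F *m X)) = (-1) *: (x *m (x^T *m F *m X)) by rewrite scaleN1r.
apply: le_trans (mnormZ up _ _) _.
have au := over_qplace_absval up.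
rewrite (absvN au) (absv1 au) mul1r; apply: le_trans (mnormM up _ _) _.
have := mnorm_form x X up; rewrite -/f -/h -/g => fle.
apply: (@le_trans _ _ (h * (h * f * g))); first by rewrite ler_wpM2l.
by rewrite le_eqVlt; apply/orP; left; apply/eqP; ring.
Qed.

End ReflectionHeights.

(** * The induction on the dimension *)

Section CartanDieudonne.
Variables (R : realType) (N : nat) (F : 'M[algC]_N).
Hypotheses (N2 : (2 <= N)%N) (Fsym : F^T = F) (F0 : F != 0).
Local Notation H := (mx_height R).

(* Bound for the reflections in dimension k + 1; f, h and s stand for the
   heights of the form, of a basis matrix and of the isometry. *)
Fixpoint cd_bound (k : nat) (f h s : R) : R :=
  if k is k'.+1 then
    cd_bound k' f (8 * f * h ^+ 3) (256 * N%:R ^+ 2 * f ^+ 2 * h ^+ 4 * s ^+ 3)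
  else s.

Lemma cd_bound_mono k (f h h' s s' : R) : 0 <= f -> 0 <= h <= h' -> 0 <= s <= s' ->
  cd_bound k f h s <= cd_bound k f h' s'.
Proof.
move=> f0; elim: k h h' s s' => [|k IH] h h' s s' /andP[h0 hh] /andP[s0 ss] //=.
have p n (a b : R) : 0 <= a -> a <= b -> 0 <= a ^+ n <= b ^+ n.
  by move=> a0 ab; rewrite exprn_ge0 //= lerXn2r ?nnegrE // (le_trans a0).
have /andP[h3 hh3] := p 3%N _ _ h0 hh; have /andP[h4 hh4] := p 4%N _ _ h0 hh.
have /andP[s3 ss3] := p 3%N _ _ s0 ss.
have f2 : 0 <= 256 * N%:R ^+ 2 * f ^+ 2 by rewrite !mulr_ge0 ?ler0n // exprn_ge0.
apply: IH; apply/andP; split.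
- by rewrite !mulr_ge0.
- by rewrite ler_wpM2l // mulr_ge0.
- by rewrite !mulr_ge0 ?ler0n // exprn_ge0.
- by apply: ler_pM; [exact: mulr_ge0 | exact: s3 | rewrite ler_wpM2l | exact: ss3].
Qed.

Lemma cd_step_ge (f h s : R) : 1 <= f -> 1 <= h -> 1 <= s ->
  [/\ 32 * N%:R * f * h ^+ 2 * s ^+ 2 <= 256 * N%:R ^+ 2 * f ^+ 2 * h ^+ 4 * s ^+ 3,
      1 <= 8 * f * h ^+ 3 & 1 <= 256 * N%:R ^+ 2 * f ^+ 2 * h ^+ 4 * s ^+ 3].
Proof.
move=> f1 h1 s1.
have n1 : 1 <= N%:R :> R by rewrite ler1n (leq_trans _ N2).
have e n (x : R) : 1 <= x -> 1 <= x ^+ n by move=> x1; exact: exprn_ege1.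
have m (a b : R) : 1 <= a -> 1 <= b -> 1 <= a * b by move=> a1 b1; nra.
split; last 2 first.
- by rewrite !m ?e // ler1n.
- by rewrite !m ?e // ler1n.
have -> : 256 * N%:R ^+ 2 * f ^+ 2 * h ^+ 4 * s ^+ 3 =
   (32 * N%:R * f * h ^+ 2 * s ^+ 2) * (8 * (N%:R * (f * (h ^+ 2 * s)))) by ring.
rewrite ler_peMr //; last by rewrite !m ?e // ler1n.
by rewrite (le_trans ler01) // !m ?e // ler1n.
Qed.

Lemma cd_bound_ge k (f h s : R) : 1 <= f -> 1 <= h -> 1 <= s -> s <= cd_bound k f h s.
Proof.
move=> f1; elim: k h s => [|k IH] h s h1 s1 //=.
have [_ h'1 s'1] := cd_step_ge f1 h1 s1.
apply: le_trans (IH _ _ h'1 s'1).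
have n1 : 1 <= N%:R :> R by rewrite ler1n (leq_trans _ N2).
have e n (x : R) : 1 <= x -> 1 <= x ^+ n by move=> x1; exact: exprn_ege1.
have m (a b : R) : 1 <= a -> 1 <= b -> 1 <= a * b by move=> a1 b1; nra.
have -> : 256 * N%:R ^+ 2 * f ^+ 2 * h ^+ 4 * s ^+ 3 =
   s * (256 * (N%:R ^+ 2 * (f ^+ 2 * (h ^+ 4 * s ^+ 2)))) by ring.
by rewrite ler_peMr ?(le_trans ler01) // !m ?e // ler1n.
Qed.

(* p.1 is the vector of a reflection of the span of X and p.2 an isometry of
   the whole space that extends it and is controlled by A elsewhere. *)
Definition good_refl m (X : 'M[algC]_(N, m)) (A : 'M[algC]_N) (M : R)
    (p : 'cV[algC]_N * 'M[algC]_N) : Prop :=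
  [/\ exists c, p.1 = X *m c, qf F p.1 != 0, p.2 \in unitmx, isometry_mx F p.2
    & [/\ p.2 *m X = refl_mx F p.1 *m X,
          forall z : 'cV[algC]_N, A *m z = z -> X^T *m F *m z = 0 -> p.2 *m z = z
        & H p.2 <= M]].

Definition refl_prod (ys : seq ('cV[algC]_N * 'M[algC]_N)) : 'M[algC]_N :=
  foldr (fun p M => refl_mx F p.1 *m M) 1%:M ys.

Lemma good_refl_self m (X : 'M[algC]_(N, m)) A M y c : y = X *m c -> qf F y != 0 ->
  H (refl_mx F y) <= M -> good_refl X A M (y, refl_mx F y).
Proof.
move=> yE q0 HM; split=> /=; first by exists c.
- exact: q0.
- exact: refl_mx_unit.
- exact: refl_mx_isometry.
split=> // z _ Xz; apply: refl_mx_fix.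
by rewrite yE trmx_mul -!mulmxA (mulmxA X^T) Xz mulmx0.
Qed.

(** On a line, an isometry other than the identity is multiplication by -1. The extension is [A]
    itself, so the height of [X] does not enter the bound. *)
Lemma cd_last (X : 'cV[algC]_N) (A : 'M[algC]_N) : X^T *m F *m X \in unitmx ->
  A \in unitmx -> isometry_mx F A -> (exists P, A *m X = X *m P) -> A *m X <> X ->
  good_refl X A (H A) (X, A) /\ A *m X = refl_mx F X *m X.
Proof.
move=> XU AU HA [P AX] nAX.
have qX : qf F X != 0 by move: XU; rewrite unitmxE det_mx11 unitfE.
have X0 : X != 0 by exact: qf_vec_neq0 qX.
pose p := P 0 0; have {}AX : A *m X = p *: X.
  by rewrite AX [P]mx11_scalar mul_mx_scalar.
have : bilin F (A *m X) (A *m X) = qf F X by rewrite isometry_bilin // qfE.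
rewrite AX bilinZr (bilin_sym Fsym) bilinZr -qfE mulrA -expr2 => p2.
have /eqP : p ^+ 2 = 1 by apply: (mulIf qX); rewrite mul1r.
rewrite sqrf_eq1 => /predU1P[p1|/eqP p1].
  by case: nAX; rewrite AX p1 scale1r.
have ER : A *m X = refl_mx F X *m X by rewrite refl_mx_self // AX p1 scaleN1r.
split; last by rewrite -AX; exact: ER.
split; [by exists 1%:M; rewrite mulmx1 | exact: qX | exact: AU | exact: HA |].
by split; [exact: ER | move=> z | exact: lexx].
Qed.

Lemma cartan_dieudonne k : forall (X : 'M[algC]_(N, k.+1)) (A : 'M[algC]_N),
  X^T *m F *m X \in unitmx -> A \in unitmx -> isometry_mx F A ->
  (exists P, A *m X = X *m P) ->
  exists ys : seq ('cV[algC]_N * 'M[algC]_N),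
    [/\ (size ys <= 2 * k + 1)%N,
        forall p, p \in ys -> good_refl X A (cd_bound k (H F) (H X) (H A)) p
      & A *m X = refl_prod ys *m X].
Proof.
elim: k => [|k IH] X A XU AU HA AXP.
  have [AX|nAX] := pselect (A *m X = X).
    by exists [::]; split; rewrite ?mul1mx.
  have [gA EA] := cd_last XU AU HA AXP nAX.
  exists [:: (X, A)]; split=> //=; last by rewrite mulmx1.
  by move=> p; rewrite inE => /eqP ->.
have [AX|nAX] := pselect (A *m X = X).
  by exists [::]; split; rewrite ?mul1mx.
have [P AX] := AXP.
have XU0 : X^T *m F *m X != 0.
  by apply: contraTneq XU => ->; rewrite unitmxE det0 unitr0.
have X0 : X != 0 by apply: contraNneq XU0 => ->; rewrite mulmx0.
have A0 : A != 0 by apply: contraNneq F0 => A0; rewrite -HA A0 mulmx0.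
have [c [i [j [ci qx xE]]]] := exists_anisotropic Fsym XU0.
set x := X *m c in qx xE.
have x0 := qf_vec_neq0 qx.
set f := H F; set h := H X; set s := H A.
have [f1 h1 s1] : [/\ 1 <= f, 1 <= h & 1 <= s] by split; exact: mx_height_ge1.
have hx : H x <= 2 * h by exact: height_col_sum xE x0 X0.
have hx1 : 1 <= H x by exact: mx_height_ge1.
have n1 : 1 <= N%:R :> R by rewrite ler1n (leq_trans _ N2).
have [f0 h0 s0 hx0] : [/\ 0 <= f, 0 <= h, 0 <= s & 0 <= H x].
  by split; exact: le_trans ler01 _.
have Hrefl y (b : R) : qf F y != 0 -> H y <= b -> H (refl_mx F y) <= 2 * N%:R * f * b ^+ 2.
  move=> qy yb; apply: le_trans (height_refl_mx R N2 F0 qy) _; rewrite mulrA.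
  have y1 : 1 <= H y by apply: mx_height_ge1; exact: qf_vec_neq0 qy.
  have b0 : 0 <= b by rewrite (le_trans _ yb) // (le_trans ler01).
  rewrite ler_wpM2l ?mulr_ge0 // lerXn2r ?nnegrE //.
  exact: le_trans ler01 y1.
have [stepA stepB stepC] := cd_step_ge f1 h1 s1.
set h' := 8 * f * h ^+ 3 in stepB; set s' := 256 * _ * _ * _ * _ in stepA stepC.
have s'M : s' <= cd_bound k.+1 f h s by exact: cd_bound_ge.
have rx : H (refl_mx F x) <= 8 * N%:R * f * h ^+ 2.
  by have := Hrefl _ _ qx hx; congr (_ <= _); ring.
have xM : H (refl_mx F x) <= s'.
  apply: le_trans stepA; apply: le_trans rx _.
  have -> : 32 * N%:R * f * h ^+ 2 * s ^+ 2 = (8 * N%:R * f * h ^+ 2) * (4 * s ^+ 2) by ring.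
  rewrite ler_peMr ?mulr_ge0 ?exprn_ge0 //.
  by have := exprn_ege1 2 s1; lra.
have ry y (e : algC) : y = A *m x + e *: x -> e ^+ 2 = 1 -> qf F y != 0 ->
    H (refl_mx F y) <= 32 * N%:R * f * h ^+ 2 * s ^+ 2.
  move=> yE e2 qy; have y0 := qf_vec_neq0 qy; rewrite yE in y0.
  have yb : H y <= 2 * (s * (2 * h)).
    rewrite yE; apply: le_trans (height_iso_shift R F0 HA x0 e2 y0) _.
    by rewrite ler_pM2l // ler_wpM2l.
  by have := Hrefl _ _ qy yb; congr (_ <= _); ring.
have yspan (e : algC) : exists c', A *m x + e *: x = X *m c'.
  by exists (P *m c + e *: c); rewrite mulmxDr -scalemxAr mulmxA -AX -mulmxA.
have reflspan y c' m (a : 'M[algC]_(k.+2, m)) : y = X *m c' ->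
    exists b, refl_mx F y *m (X *m a) = X *m b.
  move=> ->; exists (a - (2 / qf F (X *m c')) *: (c' *m ((X *m c')^T *m F *m (X *m a)))).
  by rewrite refl_mxE mulmxBr -scalemxAr (mulmxA X c').
have RE y : qf F y != 0 -> refl_mx F y != 0 by exact: (refl_mx_neq0 N2).
have unit_neq0 (M : 'M[algC]_N) : isometry_mx F M -> M != 0.
  by move=> HM; apply: contraNneq F0 => M0; rewrite -HM M0 mulmx0.
(* The vectors of the reflections in [pre] lie in the span of [X], so [A'] still fixes whatever [A]
   fixes orthogonally to that span. This carries the clause of [good_refl] on fixed vectors through
   the induction. *)
have [pre [A' [spre gpre AE [A'U HA' A'x A'X HA's] A'z]]] : exists pre A',
  [/\ (size pre <= 2)%N, forall p, p \in pre -> good_refl X A (cd_bound k.+1 f h s) p,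
      A = refl_prod pre *m A',
      [/\ A' \in unitmx, isometry_mx F A', A' *m x = x,
          exists P', A' *m X = X *m P' & H A' <= s']
    & forall z : 'cV[algC]_N, A *m z = z -> X^T *m F *m z = 0 -> A' *m z = z].
  have [qy|qy] := eqVneq (qf F (A *m x - x)) 0.
    have [qy' E] := cd_step_plus Fsym HA qx qy.
    have [c' yE] := yspan 1; rewrite scale1r in yE.
    have yR : H (refl_mx F (A *m x + x)) <= 32 * N%:R * f * h ^+ 2 * s ^+ 2.
      by apply: (ry _ 1) => //; rewrite ?scale1r ?expr1n.
    set y := A *m x + x in qy' E yE yR.
    have I1 := isometry_mxM (refl_mx_isometry Fsym qy') HA.
    have I2 := isometry_mxM (refl_mx_isometry Fsym qx) I1.
    exists [:: (y, refl_mx F y); (x, refl_mx F x)], (refl_mx F x *m (refl_mx F y *m A)).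
    split=> //.
    - move=> p; rewrite !inE => /orP[] /eqP ->.
        apply: (good_refl_self A yE qy'); apply: le_trans s'M; exact: le_trans stepA.
      by apply: (good_refl_self A (erefl x)) => //; apply: le_trans s'M.
    - rewrite /refl_prod /= mulmx1 -mulmxA (mulmxA (refl_mx F x) (refl_mx F x)) refl_mxK //.
      by rewrite mul1mx mulmxA refl_mxK // mul1mx.
    - split=> //.
      + by rewrite !unitmx_mul AU !refl_mx_unit.
      + by rewrite -!mulmxA.
      + rewrite -!mulmxA AX; have [b ->] := reflspan _ _ _ P yE.
        exact: reflspan (erefl x).
      apply: le_trans (mx_height_mul R _) _; first exact: unit_neq0.
      (* The three factors bound the heights of the reflections in [x] and [y] and of [A]; their
         product is the third argument in the recursion of [cd_bound]. *)
      apply: (@le_trans _ _ ((8 * N%:R * f * h ^+ 2) * (32 * N%:R * f * h ^+ 2 * s ^+ 2 * s))).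
        apply: ler_pM => //.
        + by rewrite (le_trans ler01) // mx_height_ge1 // RE.
        + by rewrite (le_trans ler01) // mx_height_ge1 // unit_neq0.
        apply: le_trans (mx_height_mul R _) _; first exact: unit_neq0.
        by rewrite ler_wpM2r.
      by rewrite le_eqVlt; apply/orP; left; apply/eqP; rewrite /s'; ring.
    move=> z Az Xz.
    have xz : x^T *m F *m z = 0 by rewrite /x trmx_mul -!mulmxA (mulmxA X^T) Xz mulmx0.
    have yz : y^T *m F *m z = 0 by rewrite yE trmx_mul -!mulmxA (mulmxA X^T) Xz mulmx0.
    by rewrite -!mulmxA Az (refl_mx_fix yz) (refl_mx_fix xz).
  have E := cd_step_minus Fsym HA qy.
  have [c' yE] := yspan (-1); rewrite scaleN1r in yE.
  have yR : H (refl_mx F (A *m x - x)) <= 32 * N%:R * f * h ^+ 2 * s ^+ 2.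
    by apply: (ry _ (-1)) => //; rewrite ?scaleN1r ?sqrrN ?expr1n.
  set y := A *m x - x in qy E yE yR.
  have I1 := isometry_mxM (refl_mx_isometry Fsym qy) HA.
  exists [:: (y, refl_mx F y)], (refl_mx F y *m A).
  split=> //.
  - move=> p; rewrite !inE => /eqP ->.
    by apply: (good_refl_self A yE) => //; apply: le_trans s'M; exact: le_trans stepA.
  - by rewrite /refl_prod /= mulmx1 mulmxA refl_mxK // mul1mx.
  - split=> //.
    + by rewrite unitmx_mul AU refl_mx_unit.
    + by rewrite -mulmxA.
    + by rewrite -mulmxA AX; exact: reflspan yE.
    apply: le_trans (mx_height_mul R _) _; first exact: unit_neq0.
    apply: (@le_trans _ _ (32 * N%:R * f * h ^+ 2 * s ^+ 2 * s)); first by rewrite ler_wpM2r.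
    have -> : s' = (32 * N%:R * f * h ^+ 2 * s ^+ 2 * s) * (8 * (N%:R * (f * h ^+ 2))).
      by rewrite /s'; ring.
    rewrite ler_peMr ?mulr_ge0 ?exprn_ge0 //.
    have m (a b : R) : 1 <= a -> 1 <= b -> 1 <= a * b by move=> a1 b1; nra.
    by rewrite !m ?exprn_ege1 // ler1n.
  move=> z Az Xz.
  have yz : y^T *m F *m z = 0 by rewrite yE trmx_mul -!mulmxA (mulmxA X^T) Xz mulmx0.
  by rewrite -mulmxA Az (refl_mx_fix yz).
pose X1 := deflate F X c i.
have X1U : X1^T *m F *m X1 \in unitmx by exact: deflate_gram.
have X1E : X1 = X *m col' i (deflate_coef F X c) by exact: deflateE.
have xX1 : x^T *m F *m X1 = 0 by exact: ortho_deflate.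
have X1x : X1^T *m F *m x = 0.
  apply: trmx_inj; rewrite trmx0 (trmx_mul _ x) (trmx_mul X1^T F) trmxK Fsym mulmxA.
  exact: xX1.
have X10 : X1 != 0.
  by apply: contraTneq X1U => ->; rewrite mulmx0 unitmxE det0 unitr0.
(* [A'] fixes [x] and preserves the span of [X], so it preserves the orthogonal complement of [x] in
   that span. *)
have A'X1 : exists P1, A' *m X1 = X1 *m P1.
  have [P' A'XE] := A'X.
  have E1 : A' *m X1 = X *m (P' *m col' i (deflate_coef F X c)).
    by rewrite X1E (mulmxA A') A'XE -mulmxA.
  have h0' : x^T *m F *m (X *m (P' *m col' i (deflate_coef F X c))) = 0.
    rewrite -E1 -[X in X^T]A'x (trmx_mul A' x) -[RHS]xX1 -[in RHS]HA'.
    by rewrite !mulmxA.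
  by have [a1 a1E] := in_deflate ci qx h0'; exists a1; rewrite E1 a1E.
have [ys [sys gys A'E]] := IH X1 A' X1U A'U HA' A'X1.
(* [x] is fixed by [A'] and orthogonal to [X1], so every extension from the induction hypothesis
   fixes it. Hence [p.2] agrees with the reflection on all of [X], and not only on [X1]. *)
have gx p : p \in ys -> p.2 *m x = x /\ refl_mx F p.1 *m x = x.
  move=> /gys[[c1 c1E] _ _ _ [_ Hz _]]; split; first exact: Hz.
  by apply: refl_mx_fix; rewrite c1E trmx_mul -!mulmxA (mulmxA X1^T) X1x mulmx0.
have prodx : refl_prod ys *m x = x.
  move: gx; elim: ys {sys gys A'E} => [|p ys IHys] gx; first by rewrite /refl_prod mul1mx.
  rewrite /refl_prod /= -mulmxA IHys; last by move=> q qys; apply: gx; rewrite inE qys orbT.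
  by case: (gx p); rewrite ?mem_head.
have A'XE : A' *m X = refl_prod ys *m X.
  by apply: (deflate_ext ci qx) => //; rewrite A'x prodx.
have prod_cat : refl_prod (pre ++ ys) = refl_prod pre *m refl_prod ys.
  elim: (pre) => [|p l IHl]; first by rewrite /refl_prod /= mul1mx.
  by rewrite /refl_prod /= -/(refl_prod _) IHl mulmxA.
exists (pre ++ ys); split.
- rewrite size_cat; apply: leq_trans (leq_add spre sys) _.
  by rewrite mulnS addnA.
- move=> p; rewrite mem_cat => /orP[/gpre //|pys].
  have [[c1 c1E] qp pU Hp [pX1 Hz HM]] := gys p pys; have [px rpx] := gx p pys.
  split=> //; first by exists (col' i (deflate_coef F X c) *m c1); rewrite mulmxA -X1E.
  split.
  + by apply: (deflate_ext ci qx) => //; rewrite px rpx.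
  + move=> z Az Xz; apply: Hz; first exact: A'z.
    by rewrite X1E trmx_mul -!mulmxA (mulmxA X^T) Xz mulmx0.
  apply: le_trans HM _ => /=; apply: cd_bound_mono => //; apply/andP; split=> //.
  + by rewrite (le_trans ler01) // mx_height_ge1.
  + have Hd : H X1 <= 2 * (f * H x ^+ 2 * h) := height_deflate R F0 x0 X0 X10.
    apply: le_trans Hd _; rewrite /h'.
    have : H x ^+ 2 <= (2 * h) ^+ 2 by rewrite lerXn2r ?nnegrE ?mulr_ge0.
    have fh : 0 <= 2 * f * h by rewrite !mulr_ge0.
    by move/(ler_wpM2l fh); congr (_ <= _); ring.
  by rewrite (le_trans ler01) // mx_height_ge1 // unit_neq0.
by rewrite prod_cat -mulmxA -A'XE mulmxA -AE.
Qed.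

End CartanDieudonne.

(** * Exponents of the final bound *)

Section NumericBound.
Variable R : realType.

(* Exponents of sqrt 2 * N, of f, of h and of s in an upper bound for
   cd_bound k f h s *)
Fixpoint cd_exps (k : nat) : nat * nat * nat * nat :=
  if k is k'.+1 then
    let: (e, b, a, t) := cd_exps k' in
    (e + 2 * a + 7 * t, b + a + 2 * t, 3 * a + 4 * t, 3 * t)%N
  else (0, 0, 0, 1)%N.

(** [t] is [3 ^ k], and the other exponents exceed it by polynomial factors only. With [L = k.+1],
    the factors 2 and 3 are the denominators of [L / 2] and [L / 3], and [e + a + t] is the exponent
    of [sqrt 2 * N] after the constants in [N * h] and [2 * s] are absorbed. *)
Lemma cd_exps_le k : (0 < k)%N -> let: (e, b, a, t) := cd_exps k in
  [/\ t <= 5 ^ k, 2 * a <= k.+1 * 5 ^ k, 3 * b <= k.+1 * 5 ^ k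
    & e + a + t <= k.+1 * k.+1 * 5 ^ k]%N.
Proof.
case: k => // k _.
suff : let: (e, b, a, t) := cd_exps k.+1 in
  [/\ 5 * t <= 3 * 5 ^ k.+1, 2 * a <= k.+2 * 5 ^ k.+1, 3 * b <= k.+2 * 5 ^ k.+1
    & e + a + t <= k.+2 * k.+2 * 5 ^ k.+1]%N.
  case: (cd_exps k.+1) => [[[e b] a] t] [H1 H2 H3 H4]; split=> //.
  by rewrite -(@leq_pmul2l 5) // (leq_trans H1) // leq_mul2r orbT.
elim: k => [|k IH]; first by vm_compute.
have -> : cd_exps k.+2 = (let: (e, b, a, t) := cd_exps k.+1 in
  (e + 2 * a + 7 * t, b + a + 2 * t, 3 * a + 4 * t, 3 * t)%N) by [].
case: (cd_exps k.+1) IH => [[[e b] a] t] [].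
rewrite (expnS 5 k.+1); move: (5 ^ k.+1)%N => q H1 H2 H3 H4.
have {}H2 : (2 * a <= k * q + 2 * q)%N by nia.
have {}H3 : (3 * b <= k * q + 2 * q)%N by nia.
have {}H4 : (e + a + t <= k * (k * q) + 4 * (k * q) + 4 * q)%N by nia.
have -> : (k.+3 * (5 * q) = 5 * (k * q) + 15 * q)%N by nia.
have -> : (k.+3 * k.+3 * (5 * q) = 5 * (k * (k * q)) + 30 * (k * q) + 45 * q)%N by nia.
move: (k * q)%N H2 H3 H4 => kq H2 H3 H4.
move: (k * kq)%N H4 => kkq H4.
by split; lia.
Qed.

Lemma cd_bound_exps (N k : nat) (r f h s : R) : 1 <= r -> 8 <= r ^+ 2 ->
  256 * N%:R ^+ 2 <= r ^+ 7 -> 1 <= f -> 1 <= h -> 1 <= s ->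
  let: (e, b, a, t) := cd_exps k in
  cd_bound N k f h s <= r ^+ e * f ^+ b * h ^+ a * s ^+ t.
Proof.
move=> r1 r8 r256 f1; elim: k h s => [|k IH] h s h1 s1.
  by rewrite /= !expr0 !mul1r expr1.
have -> : cd_exps k.+1 = (let: (e, b, a, t) := cd_exps k in
  (e + 2 * a + 7 * t, b + a + 2 * t, 3 * a + 4 * t, 3 * t)%N) by [].
have m (a b : R) : 1 <= a -> 1 <= b -> 1 <= a * b by move=> a1 b1; nra.
have ex (x : R) n : 1 <= x -> 1 <= x ^+ n by move=> x1; exact: exprn_ege1.
have {}IH := IH (r ^+ 2 * f * h ^+ 3) (r ^+ 7 * f ^+ 2 * h ^+ 4 * s ^+ 3)
  ltac:(by rewrite !m ?ex) ltac:(by rewrite !m ?ex).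
case: (cd_exps k) IH => [[[e b] a] t] IH.
apply: le_trans (_ : _ <= cd_bound N k f (r ^+ 2 * f * h ^+ 3)
   (r ^+ 7 * f ^+ 2 * h ^+ 4 * s ^+ 3)) _.
  have pos (x : R) : 1 <= x -> 0 <= x by exact: le_trans ler01.
  have [f0 h0 s0] : [/\ 0 <= f, 0 <= h & 0 <= s] by split; exact: pos.
  rewrite [leLHS]/=; apply: cd_bound_mono => //; apply/andP; split.
  - by rewrite !mulr_ge0 ?ler0n // exprn_ge0.
  - by rewrite ler_wpM2r ?exprn_ge0 // ler_wpM2r.
  - by rewrite !mulr_ge0 ?ler0n // exprn_ge0.
  - by do 3 rewrite ler_wpM2r ?exprn_ge0 //.
apply: le_trans IH _; rewrite le_eqVlt; apply/orP; left; apply/eqP.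
have E3 (x y z : R) n : (x * y * z) ^+ n = x ^+ n * y ^+ n * z ^+ n.
  by rewrite exprMn [(x * y) ^+ n]exprMn.
have E4 (x y z u : R) n : (x * y * z * u) ^+ n = x ^+ n * y ^+ n * z ^+ n * u ^+ n.
  by rewrite exprMn E3.
rewrite (E3 (r ^+ 2)) (E4 (r ^+ 7)) -!exprM !exprD.
move: (r ^+ e) (r ^+ _) (r ^+ _) (f ^+ b) (f ^+ a) (f ^+ _) (h ^+ _) (h ^+ _) (s ^+ _).
by move=> *; ring.
Qed.

Lemma cd_bound_final (N L : nat) (f h s : R) : (2 <= N)%N -> (2 <= L)%N ->
  1 <= f -> 1 <= h -> 1 <= s ->
  cd_bound N (L - 1) f (N%:R * h) (2 * s) <=
  ((2 * N%:R ^+ 2 * 3 `^ ((L%:R - 1) / 2)) `^ (L%:R ^+ 2 / 2)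
     * f `^ (L%:R / 3) * h `^ (L%:R / 2) * s) ^+ (5 ^ (L - 1)).
Proof.
case: L => [//|k] N2; rewrite ltnS => k0 f1 h1 s1; rewrite subSS subn0.
have n2 : 2 <= N%:R :> R by rewrite ler_nat.
(* [r ^+ 2] is the factor [2 * N ^ 2] of the statement, and both [N] and 2 are at most [r]. *)
pose r : R := Num.sqrt 2 * N%:R.
have s2 : 1 <= Num.sqrt (2 : R).
  by rewrite -[leLHS]sqrtr1 ler_wsqrtr // ler1n.
have r2 : r ^+ 2 = 2 * N%:R ^+ 2 by rewrite exprMn sqr_sqrtr.
have rN : N%:R <= r by rewrite /r ler_peMl // ler0n.
have r2' : 2 <= r by exact: le_trans rN.
have r1 : 1 <= r by apply: le_trans r2'; rewrite ler1n.
have r8 : 8 <= r ^+ 2 by rewrite r2; nra.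
(* For [N = 2] the sixth power of [r] is too small; this is the origin of the 7 in [cd_exps]. *)
have r256 : 256 * N%:R ^+ 2 <= r ^+ 7.
  have -> : 256 * N%:R ^+ 2 = 128 * r ^+ 2 by rewrite r2; ring.
  have -> : r ^+ 7 = (r ^+ 2) ^+ 2 * r * r ^+ 2 by ring.
  rewrite ler_wpM2r ?exprn_ge0 ?(le_trans ler01) //.
  have : 64 <= (r ^+ 2) ^+ 2 by nra.
  by nra.
have pos (x : R) : 1 <= x -> 0 <= x by exact: le_trans ler01.
have [f0 h0 s0] : [/\ 0 <= f, 0 <= h & 0 <= s] by split; exact: pos.
have N1 : 1 <= N%:R :> R by apply: le_trans n2; rewrite ler1n.
have nh : 1 <= N%:R * h by nra.
have ss : 1 <= 2 * s by nra.
have := cd_bound_exps k r1 r8 r256 f1 nh ss.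
have := cd_exps_le k0.
case: (cd_exps k) => [[[e b] a] t] [Ht Ha Hb He] H.
apply: le_trans H _; set q := (5 ^ k)%N in Ht Ha Hb He *.
apply: (@le_trans _ _ (r ^+ (e + a + t) * f ^+ b * h ^+ a * s ^+ t)).
  rewrite [(N%:R * h) ^+ a]exprMn [(2 * s) ^+ t]exprMn !exprD.
  have a1 : N%:R ^+ a <= r ^+ a by rewrite lerXn2r ?nnegrE // pos.
  have t1 : 2 ^+ t <= r ^+ t by rewrite lerXn2r ?nnegrE // pos.
  have -> : r ^+ e * f ^+ b * (N%:R ^+ a * h ^+ a) * (2 ^+ t * s ^+ t) =
    (N%:R ^+ a * 2 ^+ t) * (r ^+ e * f ^+ b * h ^+ a * s ^+ t) by ring.
  have -> : r ^+ e * r ^+ a * r ^+ t * f ^+ b * h ^+ a * s ^+ t =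
    (r ^+ a * r ^+ t) * (r ^+ e * f ^+ b * h ^+ a * s ^+ t) by ring.
  rewrite ler_wpM2r //; first by rewrite !mulr_ge0 // exprn_ge0 // pos.
  by apply: ler_pM => //; rewrite exprn_ge0 ?ler0n.
have pw (x : R) (n : nat) (c : R) : 1 <= x -> n%:R <= c * q%:R -> x ^+ n <= (x `^ c) ^+ q.
  move=> x1 nc; have x0 := pos _ x1.
  by rewrite -[X in _ <= X]powR_mulrn ?powR_ge0 // -powRrM -powR_mulrn // ler_powR.
have natle (x y c : nat) : (0 < c)%N -> (c * x <= y * q)%N ->
    x%:R <= y%:R / c%:R * q%:R :> R.
  move=> c0 cx; rewrite mulrAC ler_pdivlMr ?ltr0n // -!natrM ler_nat mulnC //.
have E4 (x y z u : R) n : (x * y * z * u) ^+ n = x ^+ n * y ^+ n * z ^+ n * u ^+ n.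
  by rewrite exprMn [(x * y * z) ^+ n]exprMn [(x * y) ^+ n]exprMn.
have ge0 (x : R) n : 0 <= x -> 0 <= x ^+ n by exact: exprn_ge0.
set c := 2 * _ * _; have rc : r ^+ 2 <= c.
  rewrite /c -r2 ler_peMr ?ge0 ?pos //.
  rewrite -[leLHS](powRr0 3); apply: ler_powR; first by rewrite ler1n.
  by rewrite divr_ge0 // subr_ge0 ler1n.
have c0 : 0 <= c by apply: le_trans rc; rewrite ge0 ?pos.
have q1 : r ^+ (e + a + t) <= (c `^ (k.+1%:R ^+ 2 / 2)) ^+ q.
  apply: (@le_trans _ _ (((r ^+ 2) `^ (k.+1%:R ^+ 2 / 2)) ^+ q)).
    rewrite -[X in X `^ _]powR_mulrn ?pos // -powRrM.
    apply: pw => //; rewrite mulrCA divff ?mulr1 ?pnatr_eq0 // -natrX -natrM ler_nat.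
    by rewrite expnS expn1.
  rewrite lerXn2r ?nnegrE ?powR_ge0 //.
  apply: ge0_ler_powR; rewrite ?nnegrE.
  - by apply: divr_ge0 => //; apply: ge0; exact: ler0n.
  - by apply: ge0; exact: pos.
  - exact: c0.
  - exact: rc.
have q2 : f ^+ b <= (f `^ (k.+1%:R / 3)) ^+ q by apply: pw => //; apply: natle.
have q3 : h ^+ a <= (h `^ (k.+1%:R / 2)) ^+ q by apply: pw => //; apply: natle.
have q4 : s ^+ t <= s ^+ q by rewrite ler_weXn2l.
have r0 := pos _ r1.
rewrite E4; apply: ler_pM q4; rewrite ?mulr_ge0 ?ge0 //.
apply: ler_pM q3; rewrite ?mulr_ge0 ?ge0 //.
by apply: ler_pM q2; rewrite ?ge0.
Qed.

End NumericBound.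

(** * Bases of subspaces and isometries *)

Section SubspaceBasis.
Variables (N : nat) (Z : {vspace 'cV[algC]_N}).
Local Notation L := (\dim Z).
Local Notation B := (basis_mx Z).

Lemma mul_basis_mx (a : 'cV[algC]_L) : B *m a = \sum_j a j 0 *: (vbasis Z)`_j.
Proof.
apply/colP => i; rewrite mxE summxE; apply: eq_bigr => j _.
by rewrite !mxE mulrC.
Qed.

Lemma mem_basis_mx (z : 'cV[algC]_N) : z \in Z -> exists a, z = B *m a.
Proof.
move=> zZ; exists (\col_j coord (vbasis Z) j z); rewrite mul_basis_mx.
by rewrite {1}(coord_vbasis zZ); apply: eq_bigr => j _; rewrite mxE.
Qed.

Lemma basis_mx_mem (a : 'cV[algC]_L) : B *m a \in Z.
Proof.
rewrite mul_basis_mx; apply: memv_suml => j _; apply/memvZ/vbasis_mem.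
by rewrite mem_nth ?size_tuple.
Qed.

Lemma basis_mx_inj (a : 'cV[algC]_L) : B *m a = 0 -> a = 0.
Proof.
rewrite mul_basis_mx => H; apply/colP => j; rewrite mxE.
have /freeP Hf := basis_free (vbasisP Z); exact: (Hf (fun j => a j 0) H j).
Qed.

Lemma basis_mx_gram (F : 'M[algC]_N) : F^T = F -> bilin_regular F Z ->
  B^T *m F *m B \in unitmx.
Proof.
move=> Fsym reg; rewrite unitmxE unitfE; apply/det0P => -[v v0 vG].
have z0 : B *m v^T != 0.
  apply: contraNneq v0 => /basis_mx_inj v0.
  by rewrite -[v]trmxK v0 trmx0.
have [y yZ] := reg _ (basis_mx_mem v^T) z0.
have [a ->] := mem_basis_mx yZ; case/eqP.
rewrite bilinE trmx_mul trmxK.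
have -> : v *m B^T *m F *m (B *m a) = v *m (B^T *m F *m B) *m a by rewrite !mulmxA.
by rewrite vG mul0mx mxE.
Qed.

Lemma basis_mx_rank : row_full B.
Proof.
rewrite /row_full -mxrank_tr; apply: inj_row_free => v vB.
have : B *m v^T = 0 by apply: trmx_inj; rewrite trmx_mul trmxK vB trmx0.
by move/basis_mx_inj => v0; rewrite -[v]trmxK v0 trmx0.
Qed.

Section Minors.
Variable R : realType.
Implicit Types g : 'I_L -> 'I_N.

Definition minors_vec : vec :=
  mkvec (fun f : row_choice N L => \det (rowsub (val f) B)).

Lemma subspace_heightE : subspace_height R Z = vheight R minors_vec.
Proof. by []. Qed.

(* Any maximal minor is zero or, up to sign, a minor with increasing rows. *)
Lemma minor_le i u g : over_qplace i u ->
  u (\det (rowsub g B)) <= vnorm (R := R) i u minors_vec.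
Proof.
move=> ui; have au := over_qplace_absval ui.
have [ginj|] := boolP (injectiveb g); last first.
  case/injectivePn => a [b ab gab].
  rewrite (@determinant_alternate _ _ _ a b) ?absv0 ?vnorm_ge0 // => j.
  by rewrite !mxE gab.
move/injectiveP in ginj.
pose S : {set 'I_N} := [set g x | x : 'I_L]%SET.
have cS : #|S| = L by rewrite card_imset // card_ord.
pose f0 (j : 'I_L) : 'I_N := enum_val (cast_ord (esym cS) j).
have f0mono (a b : 'I_L) : (a < b)%N -> (f0 a < f0 b)%N.
  move=> ab; rewrite /f0 !(enum_val_nth (g a)) /=.
  have sS : sorted ltn (map val (enum S)).
    apply: subseq_sorted ltn_trans _ _ _ (iota_ltn_sorted 0 N).
    by rewrite -val_enum_ord; apply: map_subseq; rewrite enumT; exact: filter_subseq.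
  have szS : size (enum S) = L by rewrite -cardE.
  have := sorted_ltn_nth ltn_trans (g a : nat) sS a b.
  rewrite !inE size_map szS !ltn_ord => /(_ isT isT ab).
  by rewrite !(nth_map (g a)) ?szS.
have f0ok : [forall a : 'I_L, forall b : 'I_L, (a < b)%N ==>
    (finfun f0 a < finfun f0 b)%N].
  apply/forallP => a; apply/forallP => b; apply/implyP => ab; rewrite !ffunE.
  exact: f0mono.
pose f : row_choice N L := exist _ (finfun f0) f0ok.
have gS x : g x \in S by exact: imset_f.
pose s0 x : 'I_L := cast_ord cS (enum_rank_in (gS x) (g x)).
have s0E x : f0 (s0 x) = g x.
  by rewrite /f0 /s0 cast_ordK enum_rankK_in.
have s0inj : injective s0.
  by move=> x y E; apply: ginj; rewrite -!s0E E.
have -> : rowsub g B = row_perm (perm s0inj) (rowsub (val f) B).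
  by apply/matrixP => x y; rewrite !mxE permE ffunE s0E.
rewrite row_permE det_mulmx det_perm (absvM au) (absvX au) (absvN au) (absv1 au).
rewrite expr1n mul1r; exact: (@le_vnorm _ _ _ minors_vec f ui).
Qed.

(** If all increasing minors vanished, [minor_le] at the archimedean place would make every maximal
    minor vanish, against the full rank of the basis. *)
Lemma minors_vec_nonzero : vnonzero minors_vec.
Proof.
pose g := fullrankfun basis_mx_rank.
have : \det (rowsub g B) != 0.
  by move: (fullrowsub_unit basis_mx_rank); rewrite unitmxE unitfE.
move=> d0; apply: contrapT => H; move/negP: d0; apply.
have uq := qplaceP R (isT : is_qidx 0); have aq := over_qplace_absval uq.
rewrite -(absv_eq0 aq) eq_le absv_ge0 // andbT.
apply: le_trans (minor_le g uq) _; rewrite /vnorm /lnorm eqxx.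
rewrite big1 ?sqrtr0 // => f _; suff -> : projT2 minors_vec f = 0 by rewrite absv0 // expr0n.
by apply/eqP/negPn/negP => Hf; apply: H; exists f.
Qed.

Lemma subspace_height_ge1 : 1 <= subspace_height R Z.
Proof. by rewrite subspace_heightE vheight_ge1 //; exact: minors_vec_nonzero. Qed.

(* By Cramer's rule the entries of this matrix are maximal minors. *)
Definition minor_basis g : 'M[algC]_(N, L) := B *m \adj (rowsub g B).

Lemma minor_basisE g i j :
  minor_basis g i j = \det (rowsub (fun k => if k == j then i else g k) B).
Proof.
rewrite (expand_det_row _ j) mxE; apply: eq_bigr => k _.
rewrite !mxE eqxx; congr (_ * _); rewrite /cofactor; congr (_ * \det _).
by apply/matrixP => a b; rewrite !mxE eq_sym (negPf (neq_lift j a)).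
Qed.

(** The adjugate of an invertible block changes the basis so that all entries become maximal minors.
    The factor [N] arises at the archimedean place, where the sum of squares has [N L <= N^2]
    terms. *)
Lemma exists_minor_basis : (0 < L)%N -> exists U : 'M[algC]_L,
  U \in unitmx /\ mx_height R (B *m U) <= N%:R * subspace_height R Z.
Proof.
move=> L0; pose g := fullrankfun basis_mx_rank.
have gU : rowsub g B \in unitmx := fullrowsub_unit basis_mx_rank.
have dU : \det (rowsub g B) != 0 by move: gU; rewrite unitmxE unitfE.
have adjU : \adj (rowsub g B) \in unitmx.
  have : rowsub g B *m \adj (rowsub g B) \in unitmx.
    by rewrite mul_mx_adj -scalemx1 unitmxZ ?unitfE // unitmx1.
  by rewrite unitmx_mul gU.
exists (\adj (rowsub g B)); split=> //.
have BU : rowsub g (B *m \adj (rowsub g B)) = (\det (rowsub g B))%:M.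
  by rewrite -mul_rowsub_mx mul_mx_adj.
have X0 : B *m \adj (rowsub g B) != 0.
  apply: contraNneq dU => X0; move: BU; rewrite X0 => /matrixP/(_ (Ordinal L0) (Ordinal L0)).
  by rewrite !mxE eqxx mulr1n => <-.
have entry_le i u j k : over_qplace i u ->
    u ((B *m \adj (rowsub g B)) j k) <= vnorm (R := R) i u minors_vec.
  by move=> ui; rewrite -[_ j k]/(minor_basis g j k) minor_basisE minor_le.
have := @height_le_prod R (mxv (B *m \adj (rowsub g B))) [:: minors_vec] N%:R
  (ler0n _ _) (vnonzero_mx X0).
rewrite big_seq1; apply; first by case=> //= _; exact: minors_vec_nonzero.
move=> i u qi ui; rewrite big_seq1; set M := vnorm i u minors_vec.
have M0 : 0 <= M by exact: vnorm_ge0.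
have LN : (L <= N)%N.
  by have := rank_leq_row B; rewrite (eqP basis_mx_rank).
apply: vnorm_leP => //; first by rewrite mulr_ge0 //; case: ifP.
case i0 : (i == 0)%N; last by move=> [j k]; rewrite mul1r /=; exact: entry_le.
apply: (@le_trans _ _ (\sum_(jk : 'I_N * 'I_L) M ^+ 2)).
  apply: ler_sum => -[j k] _ /=; rewrite lerXn2r ?nnegrE ?absv_ge0 ?entry_le //.
  exact: over_qplace_absval ui.
rewrite sumr_const card_prod !card_ord -[_ *+ _]mulr_natl [leRHS]exprMn.
rewrite ler_wpM2r ?sqr_ge0 //.
by rewrite -natrX ler_nat expnS expn1 leq_mul2l LN orbT.
Qed.

End Minors.
End SubspaceBasis.

(** * Extensions of isometries and of reflections of Z *)

Section IsometryHeights.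
Variables (R : realType) (N : nat) (F : 'M[algC]_N) (Z : {vspace 'cV[algC]_N}).
Hypotheses (N2 : (2 <= N)%N) (Fsym : F^T = F) (regZ : bilin_regular F Z).
Implicit Types (s : 'End(subvs_of Z)) (A : 'M[algC]_N).
Local Notation B := (basis_mx Z).

Lemma isometry_extension_mem s A : A \in unitmx -> isometry_mx F A ->
  (forall z : subvs_of Z, A *m vsval z = vsval (s z)) -> bilin_isometry F s ->
  isometry_extensions F s A.
Proof.
move=> AU HA AZ [[s1 sK s1K] _].
have AZ' (x : 'cV[algC]_N) : x \in orthc F Z -> A *m x \in orthc F Z.
  move/mem_orthc => xZ; apply/mem_orthc => z zZ.
  (* As [s] is onto, [z] is the image under [A] of a vector of Z, and [A] preserves the form. *)
  have <- : A *m vsval (s1 (vsproj Z z)) = z by rewrite AZ s1K vsprojK.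
  by rewrite isometry_bilin // xZ // subvsP.
pose f (z : subvs_of (orthc F Z)) := vsproj (orthc F Z) (A *m vsval z).
have fE z : vsval (f z) = A *m vsval z by rewrite vsprojK // AZ' // subvsP.
have flin : linear f.
  move=> a x y; rewrite /f -linearP; congr (vsproj _ _).
  by rewrite -[vsval (_ + _)]/(a *: vsval x + vsval y) (mulmxDr A) scalemxAr.
pose fL : {linear subvs_of (orthc F Z) -> subvs_of (orthc F Z)} :=
  HB.pack f (GRing.isLinear.Build _ _ _ _ f flin).
have finj : injective (linfun fL).
  move=> x y; rewrite !lfunE /= => /(congr1 vsval); rewrite !fE => H.
  by apply: val_inj; rewrite /= -[vsval x](mulKmx AU) H mulKmx.
split=> //; first by move=> x y; exact: isometry_bilin.
exists (linfun fL); last by move=> z; rewrite lfunE /= fE.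
split; last by move=> x y; rewrite !lfunE /= !fE isometry_bilin.
have kf : lker (linfun fL) == 0%VS by apply/lker0P.
by exists (linfun fL)^-1%VF; [move=> x; rewrite lker0_lfunK | move=> x; rewrite lker0_lfunVK].
Qed.

Lemma reflection_is_linear (y : subvs_of Z) :
  linear (fun z : subvs_of Z =>
    z - (2 * bilin F (vsval y) (vsval z) / bilin F (vsval y) (vsval y)) *: y).
Proof.
move=> a u v; rewrite linearP /= bilinDr bilinZr.
rewrite (mulrDr 2) mulrDl scalerDl scalerBr opprD addrACA scalerA.
by rewrite (mulrCA 2 a) -(mulrA a).
Qed.

Definition reflection_fun (y : subvs_of Z) : {linear subvs_of Z -> subvs_of Z} :=
  HB.pack (fun z : subvs_of Z =>
    z - (2 * bilin F (vsval y) (vsval z) / bilin F (vsval y) (vsval y)) *: y)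
  (GRing.isLinear.Build _ _ _ _ _ (reflection_is_linear y)).

Definition reflection (y : subvs_of Z) : 'End(subvs_of Z) := linfun (reflection_fun y).

Lemma reflectionE y z : reflection y z =
  z - (2 * bilin F (vsval y) (vsval z) / bilin F (vsval y) (vsval y)) *: y.
Proof. by rewrite lfunE. Qed.

Lemma vsval_reflection y z :
  vsval (reflection y z) = refl_mx F (vsval y) *m vsval z.
Proof. by rewrite reflectionE linearB linearZ /= refl_mx_vec qfE scalerN. Qed.

Lemma reflectionP y : qf F (vsval y) != 0 -> bilin_reflection F (reflection y).
Proof.
move=> qy; split; last by exists y; [rewrite -qfE | exact: reflectionE].
split; last first.
  move=> u v; rewrite !vsval_reflection isometry_bilin //.
  exact: refl_mx_isometry.
have K : cancel (reflection y) (reflection y).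
  move=> z; apply: val_inj; rewrite /= !vsval_reflection mulmxA refl_mxK //.
  by rewrite mul1mx.
by exists (reflection y).
Qed.

Lemma mem_span_basis m (M : 'M[algC]_(N, m)) : (forall j, col j M \in Z) ->
  exists P, M = B *m P.
Proof.
move=> MZ; have /fin_all_exists[a aE] (j : 'I_m) := mem_basis_mx (MZ j).
exists (\matrix_(i, j) a j i 0); apply/matrixP => i j.
have := congr1 (fun c : 'cV_N => c i 0) (aE j); rewrite !mxE => ->.
by apply: eq_bigr => l _; rewrite !mxE.
Qed.

Lemma isometry_basis s : exists P : 'M[algC]_(\dim Z),
  forall (z : subvs_of Z) a, vsval z = B *m a -> vsval (s z) = B *m (P *m a).
Proof.
pose b (j : 'I_(\dim Z)) : subvs_of Z := vsproj Z (vbasis Z)`_j.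
have bE j : vsval (b j) = (vbasis Z)`_j.
  by rewrite vsprojK // vbasis_mem // mem_nth // size_tuple.
have [|P PE] := @mem_span_basis _ (\matrix_(i, j) vsval (s (b j)) i 0).
  move=> j; rewrite (_ : col j _ = vsval (s (b j))) ?subvsP //.
  by apply/colP => i; rewrite !mxE.
exists P => z a za.
have -> : z = \sum_j a j 0 *: b j.
  apply: val_inj; rewrite /= za mul_basis_mx linear_sum /=.
  by apply: eq_bigr => j _; rewrite /= bE.
rewrite !linear_sum /= mulmxA -PE; apply/colP => i; rewrite mxE summxE.
by apply: eq_bigr => j _; rewrite !linearZ /= !mxE mulrC.
Qed.

(** [s] is extended by the identity on the orthogonal complement of Z. Thus the infimum that defines
    [isometry_height] is over a nonempty set. *)
Lemma exists_isometry_extension s : bilin_isometry F s ->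
  exists A, isometry_extensions F s A.
Proof.
move=> sI; have [P PE] := isometry_basis s.
have GU := basis_mx_gram Fsym regZ; set G := B^T *m F *m B in GU.
have Gsym : G^T = G by rewrite /G !trmx_mul trmxK Fsym mulmxA.
(* [K] gives the coordinates of the orthogonal projection to Z, so [B *m K] is this projection. *)
have [K GK KB] : exists2 K, G *m K = B^T *m F & K *m B = 1%:M.
  exists (invmx G *m (B^T *m F)); first by rewrite mulKVmx.
  by rewrite -mulmxA mulVmx.
have PG : P^T *m G *m P = G.
  have key (a b : 'cV[algC]_(\dim Z)) : a^T *m (P^T *m G *m P) *m b = a^T *m G *m b.
    have va c : vsval (vsproj Z (B *m c)) = B *m c by rewrite vsprojK // basis_mx_mem.
    have := sI.2 (vsproj Z (B *m a)) (vsproj Z (B *m b)).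
    rewrite (PE _ _ (va a)) (PE _ _ (va b)) (va a) (va b) !bilinE => H.
    rewrite [LHS]mx11_scalar [RHS]mx11_scalar; congr (scalar_mx _).
    by move: H; rewrite !trmx_mul /G !mulmxA.
  apply/matrixP => i j.
  have := congr1 (fun M : 'M[algC]_1 => M 0 0) (key (delta_mx i 0) (delta_mx j 0)).
  by rewrite !trmx_delta -!rowE -!colE !mxE.
have PU : P \in unitmx.
  have : P^T *m G *m P \in unitmx by rewrite PG.
  by rewrite !unitmx_mul => /andP[].
clearbody G; pose A (Q : 'M[algC]_(\dim Z)) : 'M[algC]_N := 1%:M + B *m (Q - 1%:M) *m K.
have AM : A P *m A (invmx P) = 1%:M.
  have E : B *m (P - 1%:M) *m K *m (B *m (invmx P - 1%:M) *m K)
      = B *m ((P - 1%:M) *m (invmx P - 1%:M)) *m K.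
    by rewrite -!mulmxA (mulmxA K B) KB mul1mx.
  rewrite mulmxDl !mul1mx mulmxDr mulmx1 E -addrA -!mulmxDl -!mulmxDr.
  rewrite mulmxBl mul1mx mulmxBr mulmx1 mulmxV // opprB.
  rewrite (_ : _ - 1%:M + _ = 0) ?mulmx0 ?mul0mx ?addr0 //.
  by rewrite addrCA addrA -(opprB P) -(opprB (invmx P)) -opprD subrr.
exists (A P); apply: isometry_extension_mem => //.
- by case: (mulmx1_unit AM).
- have FBK : F *m B = K^T *m G by rewrite -[LHS]trmxK trmx_mul Fsym -GK trmx_mul Gsym.
  move: PG; rewrite /isometry_mx /A -{1 2}[P](subrK 1%:M).
  move: (P - 1%:M) => T PG.
  have E1 : (B *m T *m K)^T *m F = K^T *m (T^T *m G) *m K.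
    by rewrite !trmx_mul -!mulmxA -GK !mulmxA.
  have E2 : F *m (B *m T *m K) = K^T *m (G *m T) *m K by rewrite !mulmxA FBK.
  have E3 : (B *m T *m K)^T *m F *m (B *m T *m K) = K^T *m (T^T *m G *m T) *m K.
    by rewrite E1 -!mulmxA (mulmxA K B) KB mul1mx.
  (* The relation [PG], expanded at [P = T + 1]. *)
  have PG0 : T^T *m G + G *m T + T^T *m G *m T = 0.
    apply: (addrI G); rewrite addr0 -[RHS]PG.
    have -> : (T + 1%:M)^T = T^T + 1%:M by rewrite [LHS]linearD /= trmx1.
    rewrite (mulmxDl T^T) mul1mx mulmxDr mulmx1 mulmxDl addrC [RHS]addrA.
    by rewrite (addrC _ (T^T *m G)) (addrC (T^T *m G *m T)) addrA.
  have -> : (1%:M + B *m T *m K)^T = 1%:M + (B *m T *m K)^T.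
    by rewrite [LHS]linearD /= trmx1.
  rewrite mulmxDl mul1mx mulmxDr mulmx1 mulmxDl E3 E1 E2.
  by rewrite -addrA -!mulmxDl -!mulmxDr addrA PG0 mulmx0 mul0mx addr0.
- move=> z; have [a za] := mem_basis_mx (subvsP z).
  rewrite (PE _ _ za) za mulmxDl mul1mx -!mulmxA (mulmxA K) KB mul1mx.
  by rewrite mulmxBl mul1mx mulmxBr addrC subrK.
Qed.

End IsometryHeights.

Lemma unitmx_neq0 n (A : 'M[algC]_n) : (0 < n)%N -> A \in unitmx -> A != 0.
Proof.
by case: n A => // n A _; apply: contraTneq => ->; rewrite unitmxE det0 unitr0.
Qed.

(** * From matrices back to isometries of Z *)

Section Assembly.
Variables (R : realType) (N : nat) (F : 'M[algC]_N) (Z : {vspace 'cV[algC]_N}).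
Hypotheses (N2 : (2 <= N)%N) (Fsym : F^T = F) (regZ : bilin_regular F Z).
Implicit Types (s : 'End(subvs_of Z)) (A : 'M[algC]_N) (y : subvs_of Z).

Lemma unit_mx_height_ge1 A : A \in unitmx -> 1 <= mx_height R A.
Proof. by move=> AU; apply/mx_height_ge1/unitmx_neq0 => //; exact: ltnW. Qed.

Lemma isometry_extensions_lb s :
  lbound [set mx_height R A | A in isometry_extensions F s]%classic 1.
Proof. by move=> _ [A [AU _ _ _] <-]; exact: unit_mx_height_ge1. Qed.

Lemma isometry_height_le s A :
  isometry_extensions F s A -> isometry_height F R s <= mx_height R A.
Proof.
move=> HA; apply: ge_inf; last by exists A.
by exists 1; exact: isometry_extensions_lb.
Qed.

(** The existence of an extension matters here, since the infimum of the empty set is 0 by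
    convention. *)
Lemma isometry_height_ge1 s : bilin_isometry F s -> 1 <= isometry_height F R s.
Proof.
move=> sI; apply: lb_le_inf; last exact: isometry_extensions_lb.
have [A HA] := exists_isometry_extension Fsym regZ sI.
by exists (mx_height R A), A.
Qed.

(** Some extension has height below the infimum plus 1, and the infimum is at least 1. *)
Lemma exists_isometry_extension_le s : bilin_isometry F s ->
  exists2 A, isometry_extensions F s A &
    mx_height R A <= 2 * isometry_height F R s.
Proof.
move=> sI; have s1 := isometry_height_ge1 sI.
have [_ [A HA <-] lt1] : exists2 h : R,
    [set mx_height R A | A in isometry_extensions F s]%classic h &
    h < isometry_height F R s + 1.
  apply: inf_adherent; first exact: ltr01.
  have [A HA] := exists_isometry_extension Fsym regZ sI; split.
    by exists (mx_height R A), A.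
  by exists 1; exact: isometry_extensions_lb.
by exists A => //; rewrite mulr_natl mulr2n (le_trans (ltW lt1)) // lerD2l.
Qed.

Lemma isometry_extension_isometry_mx s A :
  isometry_extensions F s A -> isometry_mx F A.
Proof.
case=> _ HA _ _; apply/matrixP => i j.
have key (M : 'M[algC]_N) :
    ((delta_mx i 0 : 'cV_N)^T *m M *m (delta_mx j 0 : 'cV_N)) 0 0 = M i j.
  by rewrite trmx_delta -rowE -colE !mxE.
rewrite -[RHS]key -[LHS]key -[RHS]bilinE -HA bilinE trmx_mul.
by rewrite !mulmxA.
Qed.

Lemma exists_gram_basis k : \dim Z = k.+1 -> exists X : 'M[algC]_(N, k.+1),
  [/\ X^T *m F *m X \in unitmx, forall a, X *m a \in Z,
      forall z, z \in Z -> exists a, z = X *m a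
    & mx_height R X <= N%:R * subspace_height R Z].
Proof.
move=> Zk; have [U [UU UH]] : exists U : 'M[algC]_(\dim Z), U \in unitmx /\
    mx_height R (basis_mx Z *m U) <= N%:R * subspace_height R Z.
  by apply: exists_minor_basis; rewrite Zk.
have : [/\ (basis_mx Z *m U)^T *m F *m (basis_mx Z *m U) \in unitmx,
    forall a, basis_mx Z *m U *m a \in Z,
    forall z, z \in Z -> exists a, z = basis_mx Z *m U *m a
  & mx_height R (basis_mx Z *m U) <= N%:R * subspace_height R Z].
  split=> //.
  - have -> : (basis_mx Z *m U)^T *m F *m (basis_mx Z *m U)
        = U^T *m ((basis_mx Z)^T *m F *m basis_mx Z) *m U by rewrite trmx_mul !mulmxA.
    by rewrite !unitmx_mul unitmx_tr UU basis_mx_gram.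
  - by move=> a; rewrite -mulmxA basis_mx_mem.
  move=> z /mem_basis_mx[a ->]; exists (invmx U *m a).
  by rewrite -mulmxA mulKVmx.
(* [\dim Z] occurs in the type of the matrix, which is generalized so that [\dim Z] can be replaced
   by [k.+1]. *)
move: (basis_mx Z *m U); move: {U UU UH} (\dim Z) Zk => n -> X HX.
by exists X.
Qed.

Lemma reflection_decomposition k s A : \dim Z = k.+1 -> isometry_extensions F s A ->
  exists ys : seq (subvs_of Z),
  [/\ (size ys <= 2 * k + 1)%N,
      forall y, y \in ys -> qf F (vsval y) != 0 /\
        isometry_height F R (reflection F y) <=
          cd_bound N k (mx_height R F) (N%:R * subspace_height R Z) (mx_height R A)
    & s = \big[(@comp_lfun _ _ _ _) / \1%VF]_(y <- ys) reflection F y].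
Proof.
move=> Zk HA; have [AU _ AZ _] := HA; have AF := isometry_extension_isometry_mx HA.
have [X [XU XZ ZX XH]] := exists_gram_basis Zk.
have F0 : F != 0.
  by apply: contraTneq XU => ->; rewrite mulmx0 mul0mx unitmxE det0 unitr0.
have [P PE] : exists P, A *m X = X *m P.
  have /fin_all_exists[a aE] (j : 'I_k.+1) : exists a, A *m col j X = X *m a.
    apply: ZX; rewrite colE.
    have XZj : X *m delta_mx j 0 \in Z by [].
    by rewrite -(vsprojK XZj) AZ subvsP.
  exists (\matrix_(i, j) a j i 0); apply/matrixP => i j.
  have := congr1 (fun c : 'cV_N => c i 0) (aE j); rewrite colE mulmxA -colE [LHS]mxE => ->.
  by rewrite !mxE; apply: eq_bigr => l _; rewrite !mxE.
have [ps [szp psg AX]] := cartan_dieudonne R N2 Fsym F0 XU AU AF (ex_intro _ P PE).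
exists [seq vsproj Z p.1 | p <- ps]; split.
- by rewrite size_map.
- move=> _ /mapP[p /psg[[c pc] q0 pU pI [pX _ pH]] ->].
  have vp : vsval (vsproj Z p.1) = p.1 by rewrite vsprojK // pc.
  split; first by rewrite vp.
  apply: (@le_trans _ _ (mx_height R p.2)).
    (* [p.2] acts on Z as the reflection in [p.1], so its height bounds that of the reflection. *)
    apply: isometry_height_le; apply: isometry_extension_mem => //; last first.
      by case: (@reflectionP _ _ _ Fsym (vsproj Z p.1)) => //; rewrite vp.
    move=> z; rewrite vsval_reflection vp.
    by have [a ->] := ZX _ (subvsP z); rewrite !mulmxA pX.
  apply: le_trans pH _; apply: cd_bound_mono.
  - by rewrite (le_trans ler01) // mx_height_ge1.
  - rewrite XH andbT (le_trans ler01) // mx_height_ge1 //.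
    by apply: contraTneq XU => ->; rewrite mulmx0 unitmxE det0 unitr0.
  - by rewrite lexx andbT (le_trans ler01) // unit_mx_height_ge1.
apply/lfunP => z; apply: val_inj; rewrite /= -AZ.
have [a za] := ZX _ (subvsP z).
have -> : A *m vsval z = refl_prod F ps *m vsval z by rewrite za !mulmxA AX.
elim: ps psg {szp AX} => [|p ps IH] psg; first by rewrite big_nil id_lfunE mul1mx.
rewrite big_cons comp_lfunE vsval_reflection /= -mulmxA IH; last first.
  by move=> q qps; apply: psg; rewrite inE qps orbT.
have [[c pc] _ _ _ _] := psg p (mem_head _ _).
by rewrite vsprojK // pc.
Qed.

End Assembly.

Lemma powR_ge1 (R : realType) (a x : R) : 1 <= a -> 0 <= x -> 1 <= a `^ x.
Proof. by move=> a1 x0; rewrite -(powRr0 a) ler_powR. Qed.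

Theorem theorem6p4 (R : realType) (N L : nat) (F : 'M[algC]_N)
    (Z : {vspace 'cV[algC]_N}) (sigma : 'End(subvs_of Z)) :
  (2 <= N)%N -> (1 <= L <= N)%N ->
  F^T = F -> \dim Z = L -> bilin_regular F Z -> bilin_isometry F sigma ->
  sigma = \1%VF \/
  exists (l : nat) (tau : 'I_l -> 'End(subvs_of Z)),
    [/\ (1 <= l <= 2 * L - 1)%N,
        forall i, bilin_reflection F (tau i),
        sigma = \big[(@comp_lfun _ _ _ _) / \1%VF]_(i < l) tau i
      & forall i, isometry_height F R (tau i) <=
          ((2 * N%:R ^+ 2 * 3 `^ ((L%:R - 1) / 2)) `^ (L%:R ^+ 2 / 2)
           * mx_height R F `^ (L%:R / 3)
           * subspace_height R Z `^ (L%:R / 2)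
           * isometry_height F R sigma) ^+ (5 ^ (L - 1))].
Proof.
move=> N2 /andP[L1 LN] Fsym dimZ regZ sI.
have [->|sN1] := eqVneq sigma \1%VF; [by left | right].
case: L L1 LN dimZ => // k _ LN dimZ.
have [A HA HA2] := exists_isometry_extension_le R N2 Fsym regZ sI.
have [ys [szys good sE]] := reflection_decomposition R N2 Fsym regZ dimZ HA.
have s1 := isometry_height_ge1 R N2 Fsym regZ sI.
have Z1 := subspace_height_ge1 Z R.
have F1 : 1 <= mx_height R F.
  apply: mx_height_ge1; apply: contraTneq (basis_mx_gram Fsym regZ) => ->.
  rewrite mulmx0 mul0mx; apply/negP => H0.
  by have := unitmx_neq0 _ H0; rewrite dimZ eqxx => /(_ isT).
(* An empty product would make [sigma] the identity. *)
have ys0 : (0 < size ys)%N.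
  by case: ys sE {szys good} => // sE; rewrite sE big_nil eqxx in sN1.
exists (size ys), (fun i => reflection F (tnth (in_tuple ys) i)); split.
- by rewrite ys0 /=; lia.
- by move=> i; apply: reflectionP => //; case: (good _ (mem_tnth i (in_tuple ys))).
- by rewrite sE big_tnth.
move=> i; have [_ iH] := good _ (mem_tnth i (in_tuple ys)).
(* For [L >= 2] the numerical bound absorbs the factor 2 of [HA2]. For [L = 1] the list has one
   entry, its reflection is [sigma], and the other factors of the bound are at least 1. *)
case: k => [|k] in LN dimZ szys good iH *; last first.
  apply: le_trans iH _; apply: le_trans (cd_bound_final N2 _ F1 Z1 s1) => //.
  rewrite subn1; apply: (cd_bound_mono N k.+1).
  - exact: le_trans ler01 F1.
  - by rewrite lexx andbT; apply: mulr_ge0 => //; exact: le_trans ler01 Z1.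
  by rewrite HA2 andbT (le_trans ler01) // unit_mx_height_ge1 //; case: HA.
have -> : reflection F (tnth (in_tuple ys) i) = sigma.
  case: ys sE szys {ys0 good iH} i => [|y [|y' ys]] // sE _ i; first by case: i.
  by rewrite sE big_cons big_nil comp_lfun1r (ord1 i).
rewrite subnn expn0 expr1 ler_peMl ?(le_trans ler01) //.
rewrite !mulr_ege1 ?powR_ge1 // subrr mul0r powRr0 mulr1 mulr_ege1 //.
  by rewrite ler1n.
by rewrite -natrX ler1n expn_gt0 (ltnW N2).
Qed.
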